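(* Let $\mathfrak{g}=\mathfrak{sl}(2)\ltimes\mathfrak{h}_n$, $n\ge 1$, $m=2n-1$. Let $V_1=V(a_0)\oplus V(a_1)\oplus V(a_2)$ and $V_2=V(b_0)\oplus\cdots\oplus V(b_\ell)$, $\ell\ge 1$, be the socle decompositions of two uniserial $\mathfrak{g}$-modules, where $V_1$ is standard faithful and $V_2$ is of type $Z$. Then $\mathrm{soc}(V_1\otimes V_2)=S_0\oplus S_1$, where, as $\mathfrak{sl}(2)$-modules, $$S_0=\mathrm{soc}(V_1)\otimes\mathrm{soc}(V_2)\simeq\bigoplus_{k=0}^{\min\{a_0,b_0\}}V(a_0+b_0-2k),$$ and $S_1$ is as follows. Case $n=1$ ($m=1$): - $V_1=FU^+_{a_0}$, $V_2=Z(b_0,\ell)$: $S_1\simeq V(a_0+b_0+m)$. - $V_1=FU^+_{a_0}$, $V_2=Z(b_\ell,\ell)^*$: $S_1\simeq V(b_1-a_0)$ if $b_1\ge a_0$, and $S_1=0$ otherwise. - $V_1=FU^-_{a_0}$ ($a_0\ge1$), $V_2=Z(b_0,\ell)$: $S_1\simeq V(a_0-b_1)$ if $a_0\ge b_1$, and $S_1=0$ otherwise. - $V_1=FU^-_{a_0}$ ($a_0\ge 1$), $V_2=Z(b_\ell,\ell)^*$: $S_1=0$. Case $n>1$ ($m\ge3$): - $V_1=FU_{(a_0,a_0+m,a_0)}$ ($a_0\in\{0,1\}$), $V_2=Z(b_0,\ell)$: $S_1\simeq V(a_0+b_0+m)$. - $V_1=FU_{(a_0,a_0+m,a_0)}$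 ($a_0\in\{0,1\}$), $V_2=Z(b_\ell,\ell)^*$: $S_1\simeq V(b_1-a_0)$ if $a_0\le b_1$, and $S_1=0$ if $a_0>b_1$. - $V_1=FU_{(1,m-1,1)}$, $V_2=Z(b_0,\ell)$: $S_1\simeq V(m-1)$ if $b_0=0$, and $S_1=0$ otherwise. - $V_1=FU_{(1,m-1,1)}$, $V_2=Z(b_\ell,\ell)^*$: $S_1=0$.
   Context: $\mathbb{F}$ is a field of characteristic zero; all modules are finite dimensional. $V(k)$ is the irreducible $\mathfrak{sl}(2)$-module of highest weight $k$. $\mathfrak{h}_n$ is the Heisenberg Lie algebra of dimension $2n+1$ with center $\mathbb{F}z$; $\mathfrak{sl}(2)$ acts by derivations with $\mathfrak{h}_n=\mathfrak{h}_n(m)\oplus\mathbb{F}z$, $\mathfrak{h}_n(m)\simeq V(m)$, $\mathbb{F}z\simeq V(0)$; $\mathfrak{g}=\mathfrak{sl}(2)\ltimes\mathfrak{h}_n$. For a $\mathfrak{g}$-module $U$, $\mathrm{soc}(U)$ is the sum of its irreducible submodules; $\mathrm{soc}^0(U)=0$, $\mathrm{soc}^i(U)/\mathrm{soc}^{i-1}(U)=\mathrm{soc}(U/\mathrm{soc}^{i-1}(U))$; $U$ is uniserial if it has a unique composition series. A socle decomposition of a uniserial $U$ of length $\ell+1$ is $U=V(a_0)\oplus\cdots\oplus V(a_\ell)$ (irreducible $\mathfrak{sl}(2)$-submodules) with $\mathrm{soc}^{i+1}(U)=V(a_0)\oplus\cdots\oplus V(a_i)$. For socle decompositions $V=\bigoplus_iV(a_i)$,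 $W=\bigoplus_jV(b_j)$, $S_t=S_t(V,W)=\big(\bigoplus_{i+j=t}V(a_i)\otimes V(b_j)\big)^{\mathfrak{h}_n}$ (vectors killed by $\mathfrak{h}_n$, with $x(v\otimes w)=xv\otimes w+v\otimes xw$). Type $Z$: for integers $\alpha,\ell\ge0$, $Z(\alpha,\ell)$ is the $\mathfrak{sl}(2)$-module $V(\alpha)\oplus V(\alpha+m)\oplus\cdots\oplus V(\alpha+\ell m)$ (this is its socle decomposition) on which $z$ acts trivially and $\mathfrak{h}_n(m)$ kills $V(\alpha)$ and maps $V(\alpha+im)$ to $V(\alpha+(i-1)m)$ via a nonzero $\mathfrak{sl}(2)$-equivariant map $\mathfrak{h}_n(m)\otimes V(\alpha+im)\to V(\alpha+(i-1)m)$ (unique up to scalar). $Z(\alpha,\ell)^*$ is its dual, with socle decomposition $V(\alpha+\ell m)\oplus\cdots\oplus V(\alpha)$; thus writing $V_2=Z(b_\ell,\ell)^*$ means $b_j=b_\ell+(\ell-j)m$. Modules $Z(\alpha,\ell)$ and $Z(\alpha,\ell)^*$ are said to be of type $Z$. Faithful modules: a uniserial $\mathfrak{g}$-module is faithful iff $z$ acts nontrivially. Every faithful uniserial $\mathfrak{g}$-module has length $3$ and socle decomposition $V(a_0)\oplus V(a_1)\oplus V(a_0)$, with $\mathfrak{h}_n(m)$ mapping $V(a_2)\to V(a_1)\to V(a_0)$ by nonzero equivariant maps and $z$ acting as a nonzero isomorphism $V(a_2)\to V(a_0)$; it is determined up to isomorphism by the triple, denoted $FU_{(a_0,a_1,a_0)}$.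 The occurring triples are: $n=1$: $(a,a+1,a)$, $a\ge0$ (written $FU^+_a$) and $(a,a-1,a)$, $a\ge1$ (written $FU^-_a$); $n=2$: $(0,3,0),(1,4,1),(1,2,1),(4,3,4)$; $n\ge3$: $(0,m,0),(1,m+1,1),(1,m-1,1)$. Standard faithful means faithful and not isomorphic to the $n=2$ module $FU_{(4,3,4)}$. *)

(* Defs.v *)
(* Finite-dimensional g-modules, g = sl(2) |x h_n, are
   represented concretely as matrix representations acting on ROW vectors
   (v |-> v *m A), by the images of a basis e,h,f,x_0..x_m,z of g. *)
From HB Require Import structures.
From mathcomp Require Import all_boot all_order all_algebra.
From mathcomp Require Import mxtens.
Set Implicit Arguments. Unset Strict Implicit. Unset Printing Implicit Defensive.
Import GRing.Theory.
Local Open Scope ring_scope.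

Section Defs.
Variable F : fieldType.

Definition mdeg (n : nat) : nat := (n.*2).-1.

(* images of the basis e, h, f, x_0, ..., x_m, z of g in gl(F^d) *)
Record grep (n d : nat) := GRep {
  rE : 'M[F]_d; rH : 'M[F]_d; rF : 'M[F]_d;
  rX : 'I_(mdeg n).+1 -> 'M[F]_d; rZ : 'M[F]_d }.

(* bracket of operators for the row-vector action: x.v := v *m A_x, so
   A_[x,y] = A_y A_x - A_x A_y *)
Definition lbr d (A B : 'M[F]_d) : 'M[F]_d := B *m A - A *m B.

Section Rep.
Variables (n d : nat) (r : grep n d).
Local Notation m := (mdeg n).

Definition Xat (i : nat) : 'M[F]_d :=
  if (i < m.+1)%N then rX r (inord i) else 0.

(* the sl(2)-invariant symplectic form on h_n(m) = V(m) in the basis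
   x_i (with e.x_i = (m-i+1) x_{i-1}, f.x_i = (i+1) x_{i+1}, h.x_i = (m-2i) x_i),
   [x_i, x_j] = omega i j z *)
Definition omega (i j : nat) : F :=
  if (i + j == m)%N then (-1) ^+ i * ('C(m, i))%:R else 0.

Definition is_rep : Prop :=
  [/\ lbr (rE r) (rF r) = rH r,
      lbr (rH r) (rE r) = 2%:R *: rE r,
      lbr (rH r) (rF r) = - (2%:R *: rF r),
      [/\ (forall i : 'I_m.+1, lbr (rE r) (rX r i) =
          (m - i).+1%:R *: (if val i == 0%N then 0 else Xat (val i).-1)),
      (forall i : 'I_m.+1, lbr (rF r) (rX r i) = (val i).+1%:R *: Xat (val i).+1),
      (forall i : 'I_m.+1, lbr (rH r) (rX r i) = (m%:R - (2 * val i)%:R) *: rX r i)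
      & (forall i j : 'I_m.+1, lbr (rX r i) (rX r j) = omega i j *: rZ r)] &
      [/\ lbr (rE r) (rZ r) = 0, lbr (rH r) (rZ r) = 0, lbr (rF r) (rZ r) = 0
      & (forall i, lbr (rX r i) (rZ r) = 0)]].

Definition faithful : Prop :=
  forall (cE cH cF cZ : F) (cX : 'I_m.+1 -> F),
    cE *: rE r + cH *: rH r + cF *: rF r + \sum_i cX i *: rX r i + cZ *: rZ r = 0 ->
    [/\ cE = 0, cH = 0, cF = 0, (forall i, cX i = 0) & cZ = 0].

(* subspaces are row spaces of d x d matrices *)
Definition gstable (W : 'M[F]_d) : Prop :=
  [/\ (W *m rE r <= W)%MS, (W *m rH r <= W)%MS, (W *m rF r <= W)%MS,
      (forall i, (W *m rX r i <= W)%MS) & (W *m rZ r <= W)%MS].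

Definition irr_over (A W : 'M[F]_d) : Prop :=
  [/\ gstable W, (A < W)%MS &
      forall W', gstable W' -> (A <= W')%MS -> (W' <= W)%MS ->
        (W' == A)%MS \/ (W' == W)%MS].

(* S/A = soc(V/A): S is A plus the sum of all submodules W with W/A irreducible *)
Definition soc_over (A S : 'M[F]_d) : Prop :=
  (forall W, irr_over A W -> (W <= S)%MS) /\
  exists s : seq 'M[F]_d,
    (forall W, W \in s -> irr_over A W) /\ ((A + \sum_(W <- s) W)%MS == S)%MS.

Definition is_soc (S : 'M[F]_d) : Prop := soc_over 0 S.

Definition socle_series (T : nat -> 'M[F]_d) : Prop :=
  (T 0%N == (0 : 'M[F]_d))%MS /\ forall i, soc_over (T i) (T i.+1).

Definition comp_series (c : seq 'M[F]_d) : Prop :=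
  [/\ (0 < size c)%N, (nth 0 c 0 == (0 : 'M[F]_d))%MS, (last 0 c == 1%:M)%MS &
      forall i, (i.+1 < size c)%N -> irr_over (nth 0 c i) (nth 0 c i.+1)].

Definition uniserial : Prop :=
  exists c, comp_series c /\
    forall c', comp_series c' ->
      size c' = size c /\ forall i, (i < size c)%N -> (nth 0 c i == nth 0 c' i)%MS.

End Rep.

(* the irreducible sl(2)-module V(k), basis v_0..v_k, row-vector action:
   e.v_i = (k-i+1) v_{i-1}, f.v_i = (i+1) v_{i+1}, h.v_i = (k-2i) v_i *)
Definition VE (k : nat) : 'M[F]_k.+1 :=
  \matrix_(i, j) (if (j.+1 == i :> nat)%N then (k - j)%:R else 0).
Definition VF (k : nat) : 'M[F]_k.+1 :=
  \matrix_(i, j) (if (j == i.+1 :> nat)%N then (i.+1)%:R else 0).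
Definition VH (k : nat) : 'M[F]_k.+1 :=
  \matrix_(i, j) (if (i == j :> nat) then k%:R - (2 * i)%:R else 0).

Section Rep2.
Variables (n d : nat) (r : grep n d).

Definition sl2_iso_V (W : 'M[F]_d) (k : nat) : Prop :=
  exists P : 'M[F]_(k.+1, d),
    [/\ row_free P, (P == W)%MS, VE k *m P = P *m rE r,
        VH k *m P = P *m rH r & VF k *m P = P *m rF r].

Definition sl2_iso_sum (W : 'M[F]_d) (ks : seq nat) : Prop :=
  exists Ws : 'I_(size ks) -> 'M[F]_d,
    [/\ forall i, sl2_iso_V (Ws i) (nth 0%N ks i),
        mxdirect (\sum_i Ws i) & (\sum_i Ws i == W)%MS].

Definition socle_decomp (l : nat) (Vs : nat -> 'M[F]_d) (a : nat -> nat) : Prop :=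
  [/\ forall i, (i <= l)%N -> sl2_iso_V (Vs i) (a i),
      mxdirect (\sum_(i < l.+1) Vs i),
      (\sum_(i < l.+1) Vs i == 1%:M)%MS &
      exists T, socle_series r T /\
        forall i, (i <= l)%N -> (T i.+1 == \sum_(j < i.+1) Vs j)%MS].

Definition isZ (alpha l : nat) : Prop :=
  exists Ws : nat -> 'M[F]_d,
    [/\ forall i, (i <= l)%N -> sl2_iso_V (Ws i) (alpha + i * mdeg n),
        mxdirect (\sum_(i < l.+1) Ws i),
        (\sum_(i < l.+1) Ws i == 1%:M)%MS,
        rZ r = 0 &
        (forall j, Ws 0%N *m rX r j = 0) /\
        (forall i, (0 < i <= l)%N ->
           (forall j, (Ws i *m rX r j <= Ws i.-1)%MS) /\
           exists j, Ws i *m rX r j != 0)].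

End Rep2.

Definition dual_rep n d (r : grep n d) : grep n d :=
  GRep (- (rE r)^T) (- (rH r)^T) (- (rF r)^T) (fun i => - (rX r i)^T) (- (rZ r)^T).

Definition rep_iso n d (r r' : grep n d) : Prop :=
  exists P : 'M[F]_d,
    [/\ P \in unitmx, rE r *m P = P *m rE r', rH r *m P = P *m rH r',
        rF r *m P = P *m rF r' &
        (forall i, rX r i *m P = P *m rX r' i) /\ rZ r *m P = P *m rZ r'].

Definition isZdual n d (r : grep n d) (alpha l : nat) : Prop :=
  exists r' : grep n d, [/\ is_rep r', isZ r' alpha l & rep_iso r (dual_rep r')].

Definition tensact d1 d2 (A : 'M[F]_d1) (B : 'M[F]_d2) : 'M[F]_(d1 * d2) :=
  tensmx A 1%:M + tensmx 1%:M B.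

Definition tens_rep n d1 d2 (r1 : grep n d1) (r2 : grep n d2) : grep n (d1 * d2) :=
  GRep (tensact (rE r1) (rE r2)) (tensact (rH r1) (rH r2)) (tensact (rF r1) (rF r2))
       (fun i => tensact (rX r1 i) (rX r2 i)) (tensact (rZ r1) (rZ r2)).

Definition hinv n d (r : grep n d) : 'M[F]_d :=
  ((\bigcap_i kermx (rX r i)) :&: kermx (rZ r))%MS.

Definition Sterm n d1 d2 (r1 : grep n d1) (r2 : grep n d2)
    (l1 : nat) (V1s : nat -> 'M[F]_d1) (l2 : nat) (V2s : nat -> 'M[F]_d2) (t : nat)
    : 'M[F]_(d1 * d2) :=
  ((\sum_(i < l1.+1) \sum_(j < l2.+1 | (i + j == t)%N) tensmx (V1s i) (V2s j))
     :&: hinv (tens_rep r1 r2))%MS.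

Definition mxdirect2 d (A B : 'M[F]_d) : Prop := mxdirect (A + B).

End Defs.

(* Main.v *)
(* An irreducible submodule of V_1 (x) V_2 is killed by h_n, because h_n lowers
   the layer filtration; so the socle is the space of h_n-invariants. Since z kills
   exactly the first two layers of V_1, and an element of a layer above the socle
   that is killed by h_n(m) vanishes, an invariant has components only in
   V(a_0) (x) V(b_0), V(a_0) (x) V(b_1) and V(a_1) (x) V(b_0); this gives S_0 and
   S_1. As a submodule of a Clebsch-Gordan sum, S_1 is determined by its highest
   weight vectors. For such a vector u it is enough that x_m u = 0, since
   [e, x_s] is a multiple of x_{s-1}, and x_m has a very simple matrix between
   consecutive layers: it shifts the standard basis by a constant amount, with
   binomial coefficients. In the coordinates of u the condition becomes a two-term
   relation between the coefficients of two explicit highest weight vectors, which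
   is solvable for at most one weight. *)
Require Import Defs.
From HB Require Import structures.
From mathcomp Require Import all_boot all_order all_algebra ssrAC.
From mathcomp Require Import mxtens.
From mathcomp Require Import zify ring.
Set Implicit Arguments. Unset Strict Implicit. Unset Printing Implicit Defensive.
Import GRing.Theory.
Local Open Scope ring_scope.

(** * Entries, and the action of sl(2) on V(k) in coordinates *)

(** Complete reducibility of sl(2)-modules is replaced by explicit facts: a Clebsch-Gordan sum is
    semisimple by construction, and semisimplicity passes to submodules. A semisimple space is then
    irreducible if its highest weight vectors fill one line, and zero if it has none; so S_1 only
    requires solving a linear system. On the module side the obstacle is that the hypotheses give a
    socle filtration, not a grading: nothing says directly that h_n(m) maps V(a_i) into V(a_(i-1)).
    For V_2 the grading comes with type Z, and it agrees with the given decomposition because its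
    highest weights are distinct. For V_1 the outer weights coincide, and a parity argument supplies
    the grading instead. The shift produced by x_m is the number [del] with a_0 + m = a_1 + 2 [del].
    It is 0 when a_1 = a_0 + m and m when a_1 = a_0 - m, while FU_(1,m-1,1) has shift 1. Exchanging
    the two tensor factors transposes the system, which identifies the case (m, 0) with the case (0,
    m). *)

Section Entries.
Variable F : fieldType.

(* Matrix entries indexed by natural numbers; the value is 0 outside the matrix. *)
Definition ent p q (U : 'M[F]_(p, q)) (i j : nat) : F :=
  if insub i is Some i' then if insub j is Some j' then U i' j' else 0 else 0.

Lemma entE p q (U : 'M[F]_(p, q)) (i : 'I_p) (j : 'I_q) : ent U i j = U i j.
Proof. by rewrite /ent !valK. Qed.

Lemma ent_outl p q (U : 'M[F]_(p, q)) i j : (p <= i)%N -> ent U i j = 0.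
Proof. by move=> h; rewrite /ent insubF // ltnNge h. Qed.

Lemma ent_outr p q (U : 'M[F]_(p, q)) i j : (q <= j)%N -> ent U i j = 0.
Proof. by move=> h; rewrite /ent; case: insubP => // u _ _; rewrite insubF // ltnNge h. Qed.

Lemma ent_in p q (U : 'M[F]_(p, q)) i j (hi : (i < p)%N) (hj : (j < q)%N) :
  ent U i j = U (Ordinal hi) (Ordinal hj).
Proof. by rewrite -(entE U). Qed.

Lemma ent_tr p q (U : 'M[F]_(p, q)) i j : ent U^T i j = ent U j i.
Proof.
case: (ltnP i q) => hi; last by rewrite ent_outl // ent_outr.
case: (ltnP j p) => hj; last by rewrite ent_outr // ent_outl.
by rewrite !ent_in mxE.
Qed.

Lemma entD p q (U V : 'M[F]_(p, q)) i j : ent (U + V) i j = ent U i j + ent V i j.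
Proof.
case: (ltnP i p) => hi; last by rewrite !ent_outl // addr0.
case: (ltnP j q) => hj; last by rewrite !ent_outr // addr0.
by rewrite !ent_in mxE.
Qed.

Lemma entZ p q c (U : 'M[F]_(p, q)) i j : ent (c *: U) i j = c * ent U i j.
Proof.
case: (ltnP i p) => hi; last by rewrite !ent_outl // mulr0.
case: (ltnP j q) => hj; last by rewrite !ent_outr // mulr0.
by rewrite !ent_in mxE.
Qed.

Lemma ent0 p q i j : ent (0 : 'M[F]_(p, q)) i j = 0.
Proof. by rewrite -(scale0r 0) entZ mul0r. Qed.

Lemma entP p q (U V : 'M[F]_(p, q)) :
  (forall i j, (i < p)%N -> (j < q)%N -> ent U i j = ent V i j) -> U = V.
Proof. by move=> h; apply/matrixP=> i j; rewrite -!entE h. Qed.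

Lemma ent_neq0 p q (U : 'M[F]_(p, q)) : U != 0 ->
  exists i j, [/\ (i < p)%N, (j < q)%N & ent U i j != 0].
Proof.
case/matrix0Pn => i [j h]; exists i, j; split=> //; by rewrite entE.
Qed.

Lemma ent_mulVE p k (U : 'M[F]_(p, k.+1)) i j :
  ent (U *m VE F k) i j = (k - j)%:R * ent U i j.+1.
Proof.
case: (ltnP i p) => hi; last by rewrite !ent_outl // mulr0.
case: (leqP j k) => hj; last by rewrite !ent_outr ?mulr0 // ltnW.
rewrite (ent_in _ hi (hj : (j < k.+1)%N)) mxE.
case: (ltnP j k) => hj'.
  have h1 : (j.+1 < k.+1)%N by [].
  rewrite (bigD1 (Ordinal h1)) //= big1 ?addr0 => [|s hs].
    by rewrite !mxE /= eqxx (ent_in _ hi h1) mulrC.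
  rewrite !mxE /=; case: eqP => e; last by rewrite mulr0.
  by case/eqP: hs; apply: val_inj.
rewrite /= (_ : k - j = 0)%N; last by apply/eqP; rewrite subn_eq0.
rewrite mul0r big1 // => s _; rewrite !mxE /=.
case: eqP => e; last by rewrite mulr0.
by have := ltn_ord s; rewrite -e ltnS ltnNge hj'.
Qed.

Lemma ent_mulVF p k (U : 'M[F]_(p, k.+1)) i j : (j <= k)%N ->
  ent (U *m VF F k) i j = j%:R * ent U i j.-1.
Proof.
move=> hj; case: (ltnP i p) => hi; last by rewrite !ent_outl // mulr0.
rewrite (ent_in _ hi (hj : (j < k.+1)%N)) mxE.
case: j hj => [|j] hj.
  rewrite mul0r big1 // => s _; rewrite !mxE /= mulr0 //.
have h1 : (j < k.+1)%N by apply: leq_trans hj _.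
rewrite (bigD1 (Ordinal h1)) //= big1 ?addr0 => [|s hs].
  by rewrite !mxE /= eqxx (ent_in _ hi h1) mulrC.
rewrite !mxE /=; case: eqP => e; last by rewrite mulr0.
by case/eqP: hs; apply: val_inj; case: e.
Qed.

Lemma ent_mulVH p k (U : 'M[F]_(p, k.+1)) i j :
  ent (U *m VH F k) i j = (k%:R - (2 * j)%:R) * ent U i j.
Proof.
case: (ltnP i p) => hi; last by rewrite !ent_outl // mulr0.
case: (leqP j k) => hj; last by rewrite !ent_outr ?mulr0 // ltnW.
rewrite !(ent_in _ hi (hj : (j < k.+1)%N)) mxE.
rewrite (bigD1 (Ordinal (hj : (j < k.+1)%N))) //= big1 ?addr0 => [|s hs].
  by rewrite !mxE /= eqxx mulrC.
by rewrite !mxE /= (negbTE (_ : s != j :> nat)) ?mulr0.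
Qed.

Lemma ent_VEmul q k (U : 'M[F]_(k.+1, q)) i j :
  ent ((VE F k)^T *m U) i j = (k - i)%:R * ent U i.+1 j.
Proof. by rewrite -[_ *m _]trmxK trmx_mul trmxK ent_tr ent_mulVE ent_tr. Qed.

Lemma ent_VHmul q k (U : 'M[F]_(k.+1, q)) i j :
  ent ((VH F k)^T *m U) i j = (k%:R - (2 * i)%:R) * ent U i j.
Proof. by rewrite -[_ *m _]trmxK trmx_mul trmxK ent_tr ent_mulVH ent_tr. Qed.

Lemma ent1 p i j : (i < p)%N -> ent (1%:M : 'M[F]_p) i j = (i == j)%:R.
Proof.
move=> hi; case: (ltnP j p) => hj; last first.
  rewrite ent_outr //; case: eqP => // e; by rewrite -e leqNgt hi in hj.
by rewrite ent_in mxE.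
Qed.

End Entries.

(** * Irreducible and semisimple sl(2)-modules *)

Section Sl2.
Variable F : fieldType.
Hypothesis charF0 : [pchar F] =i pred0.

Lemma natS_neq0 k : (k.+1)%:R != 0 :> F.
Proof. by rewrite ((pcharf0P F).1 charF0). Qed.

Lemma natF_eq0 k : (k%:R == 0 :> F) = (k == 0)%N.
Proof. exact: (pcharf0P F).1 charF0 k. Qed.

Lemma natF_inj : injective (fun k => k%:R : F).
Proof.
have le i j : (i <= j)%N -> i%:R = j%:R :> F -> i = j.
  move=> hij h; apply/eqP; rewrite eqn_leq hij -subn_eq0 -natF_eq0 natrB //.
  by rewrite h subrr eqxx.
move=> i j h; case/orP: (leq_total i j) => hij; first exact: le.
by rewrite (le j i).
Qed.

(** Raising a nonzero vector of U moves its last nonzero coordinate down to index 0, because the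
    factors k - j do not vanish in characteristic zero. This puts v_0 in U, and lowering v_0 gives
    the other basis vectors. *)
Lemma V_irr p k (U : 'M[F]_(p, k.+1)) :
  (U *m VE F k <= U)%MS -> (U *m VF F k <= U)%MS -> U != 0 -> row_full U.
Proof.
move=> hE hF hU.
have stE u : (u <= U)%MS -> (u *m VE F k <= U)%MS.
  by move=> hu; apply: submx_trans hE; apply: submxMr.
have stF u : (u <= U)%MS -> (u *m VF F k <= U)%MS.
  by move=> hu; apply: submx_trans hF; apply: submxMr.
pose v s : 'rV[F]_k.+1 := \row_j (s == val j)%:R.
have entv s j : (j < k.+1)%N -> ent (v s) 0 j = (s == j)%:R.
  by move=> hj; rewrite (ent_in _ (ltn0Sn 0) hj) mxE.
have top i : forall u : 'rV[F]_k.+1, (u <= U)%MS -> (i < k.+1)%N ->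
    (forall s, (i < s)%N -> ent u 0 s = 0) -> ent u 0 i != 0 -> (v 0 <= U)%MS.
  elim: i => [|i IH] u hu hi h0 hn.
    have -> : v 0%N = (ent u 0 0)^-1 *: u.
      apply: entP => a j; rewrite ltnS leqn0 => /eqP -> hj.
      rewrite entZ entv //; case: j hj => [|j] hj; first by rewrite mulVf.
      by rewrite (h0 j.+1) ?mulr0.
    exact: scalemx_sub.
  apply: (IH (u *m VE F k)); [exact: stE|exact: ltnW| |].
    by move=> s hs; rewrite ent_mulVE h0 ?mulr0.
  rewrite ent_mulVE mulf_neq0 // natF_eq0 subn_eq0 -ltnNge //.
have v0 : (v 0 <= U)%MS.
  case/rowV0Pn: hU => u hu /ent_neq0 [a [j [ha hj hn]]].
  move: ha hn; rewrite ltnS leqn0 => /eqP -> hn.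
  have hex : exists i, (i < k.+1)%N && (ent u 0 i != 0) by exists j; rewrite hj.
  have bnd i : (i < k.+1)%N && (ent u 0 i != 0) -> (i <= k)%N by case/andP.
  case: (ex_maxnP hex bnd) => i /andP[hi hin] hmax.
  apply: (top i u) => // s hs; apply/eqP; apply: contraLR hs => hs.
  rewrite -leqNgt; apply: hmax; rewrite hs andbT ltnNge.
  by apply: contra hs => hs; rewrite ent_outr.
have vs s : (s <= k)%N -> (v s <= U)%MS.
  elim: s => // s IH hs.
  have -> : v s.+1 = s.+1%:R^-1 *: (v s *m VF F k).
    apply: entP => a j; rewrite ltnS leqn0 => /eqP -> hj.
    rewrite entZ ent_mulVF // !entv //; last by apply: leq_ltn_trans hj; case: (j) => /=.
    case: j hj => [|j] hj; first by rewrite mul0r mulr0.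
    rewrite eqSS /=; case: eqP => [->|_]; last by rewrite !mulr0.
    by rewrite mulr1 mulVf // natS_neq0.
  by apply: scalemx_sub; apply: stF; apply: IH; apply: ltnW.
rewrite -sub1mx; apply/row_subP => i.
have -> : row i (1%:M : 'M[F]_k.+1) = v i.
  by apply/rowP => j; rewrite !mxE.
by apply: vs; rewrite -ltnS.
Qed.

(** Row vectors are multiplied from the right, so [VE F k *m VF F k] is the operator fe and the left
    side is the Casimir operator 4fe + h^2 + 2h. Its value k(k + 2) determines k. *)
Lemma V_casimir k :
  4%:R *: (VE F k *m VF F k) + VH F k *m VH F k + 2%:R *: VH F k = (k * k + 2 * k)%:R%:M.
Proof.
apply: entP => i j hi hj.
(* Inserting [1%:M] turns every product into right multiplications, for which the entry formulas are
   available. *)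
rewrite -[VE F k *m _]mul1mx mulmxA -[VH F k *m VH F k]mul1mx mulmxA -[VH F k in X in _ + X]mul1mx.
rewrite !(entD, entZ) ent_mulVF // ent_mulVE !ent_mulVH.
rewrite -[in RHS]scalemx1 entZ !ent1 //.
case: j hj => [|j] hj /=.
    rewrite muln0 !mulr0n; case: (i == 0)%N; rewrite /= ?natrD ?natrM ?mulr0n ?mulr1n; ring.
case: (i == j.+1)%N; last by rewrite !mulr0 !addr0.
have -> : k%:R = j.+1%:R + (k - j.+1)%:R :> F by rewrite -natrD subnKC.
have -> : (k - j)%:R = 1 + (k - j.+1)%:R :> F by rewrite -subnSK // -natr1 addrC.
set t := (k - j.+1)%N; have -> : (k * k + 2 * k)%:R = (j.+1%:R + t%:R) * (j.+1%:R + t%:R) + 2%:R * (j.+1%:R + t%:R) :> F.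
  rewrite -natrD -!natrM -natrD; congr (_%:R); rewrite /t subnKC //.
ring.
Qed.

(** * sl(2)-submodules, the Casimir operator and semisimplicity *)

Section Rep.
Variables (n d : nat) (r : grep F n d).

Definition sstable p (W : 'M[F]_(p, d)) : Prop :=
  [/\ (W *m rE r <= W)%MS, (W *m rH r <= W)%MS & (W *m rF r <= W)%MS].

(** The rows of P are the images of v_0, ..., v_k under a homomorphism from V(k), not assumed
    injective. *)
Definition sl2in k (P : 'M[F]_(k.+1, d)) : Prop :=
  [/\ VE F k *m P = P *m rE r, VH F k *m P = P *m rH r & VF F k *m P = P *m rF r].

Definition sl2comm (g : 'M[F]_d) : Prop :=
  [/\ g *m rE r = rE r *m g, g *m rH r = rH r *m g & g *m rF r = rF r *m g].

Definition casimir : 'M[F]_d :=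
  4%:R *: (rE r *m rF r) + rH r *m rH r + 2%:R *: rH r.

Lemma sl2in_stable k (P : 'M[F]_(k.+1, d)) : sl2in P -> sstable P.
Proof. by case=> h1 h2 h3; split; rewrite -?h1 -?h2 -?h3 submxMl. Qed.

Lemma sstable_eqmx p q (A : 'M[F]_(p, d)) (B : 'M[F]_(q, d)) :
  (A :=: B)%MS -> sstable A -> sstable B.
Proof.
move=> e [h1 h2 h3]; split; rewrite -(eqmxMr _ e) -e //.
Qed.

Lemma iso_stable (W : 'M[F]_d) k : sl2_iso_V r W k -> sstable W.
Proof.
case=> P [_ /eqmxP e h1 h2 h3]; apply: (sstable_eqmx e).
exact: sl2in_stable.
Qed.

Lemma iso_eqmx (W W' : 'M[F]_d) k : (W :=: W')%MS -> sl2_iso_V r W k -> sl2_iso_V r W' k.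
Proof.
move=> e [P [h0 h1 h2 h3 h4]]; exists P; split=> //.
by apply/eqmxP; apply: eqmx_trans (eqmxP h1) e.
Qed.

Lemma iso_rank (W : 'M[F]_d) k : sl2_iso_V r W k -> \rank W = k.+1.
Proof. by case=> P [h0 /eqmxP h1 _ _ _]; rewrite -h1; apply/eqP. Qed.

Lemma iso_neq0 (W : 'M[F]_d) k : sl2_iso_V r W k -> W != 0.
Proof. by move/iso_rank => h; rewrite -mxrank_eq0 h. Qed.

(** U is pulled back along the isomorphism P to a submodule C of V(k), which is full by [V_irr]. *)
Lemma iso_irr (W : 'M[F]_d) k p (U : 'M[F]_(p, d)) :
  sl2_iso_V r W k -> sstable U -> (U <= W)%MS -> U != 0 -> (W <= U)%MS.
Proof.
case=> P [h0 /eqmxP h1 hE hH hF] [sE _ sF]; rewrite -h1 => /submxP[C eC] U0.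
have inj := row_free_inj h0.
have hC M N : M *m P = P *m N -> (U *m N <= U)%MS -> (C *m M <= C)%MS.
  move=> e; rewrite eC -mulmxA -e mulmxA => h.
  by rewrite -(submxMfree _ _ h0).
have : row_full C.
  apply: V_irr; [exact: hC hE sE|exact: hC hF sF|].
  by apply: contraNneq U0 => C0; rewrite eC C0 mul0mx.
rewrite eC -sub1mx -h1 => h; have := submxMr P h; by rewrite mul1mx.
Qed.

Lemma sl2in_iso k (P : 'M[F]_(k.+1, d)) : sl2in P -> P != 0 -> sl2_iso_V r <<P>>%MS k.
Proof.
move=> [hE hH hF] P0; exists P; split=> //; last by apply/eqmxP/eqmx_sym/genmxE.
rewrite -kermx_eq0; apply/negPn/negP => hk.
have hs M N : M *m P = P *m N -> (kermx P *m M <= kermx P)%MS.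
  by move=> e; apply/sub_kermxP; rewrite -mulmxA e mulmxA mulmx_ker mul0mx.
have := V_irr (hs _ _ hE) (hs _ _ hF) hk.
rewrite -sub1mx => /sub_kermxP; rewrite mul1mx => e; by rewrite e eqxx in P0.
Qed.

Lemma iso_casimir (W : 'M[F]_d) k :
  sl2_iso_V r W k -> (W <= eigenspace casimir (k * k + 2 * k)%:R)%MS.
Proof.
case=> P [h0 /eqmxP h1 hE hH hF]; rewrite -h1; apply/eigenspaceP.
have eEF : P *m (rE r *m rF r) = VE F k *m VF F k *m P.
  by rewrite mulmxA -hE -mulmxA -hF mulmxA.
have eHH : P *m (rH r *m rH r) = VH F k *m VH F k *m P.
  by rewrite mulmxA -hH -mulmxA -hH mulmxA.
rewrite /casimir !mulmxDr -!scalemxAr eEF eHH -hH.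
by rewrite -[RHS]mul_scalar_mx -V_casimir !mulmxDl -!scalemxAl.
Qed.

Lemma iso_hw (W : 'M[F]_d) k : sl2_iso_V r W k ->
  exists v : 'rV_d, [/\ v != 0, (v <= W)%MS, v *m rE r = 0 & v *m rH r = k%:R *: v].
Proof.
case=> P [h0 /eqmxP h1 hE hH hF].
pose v : 'rV[F]_k.+1 := delta_mx 0 0.
have entv : forall j, ent v 0 j = (j == 0%N)%:R.
  move=> j.
  case: (ltnP j k.+1) => hj; last by rewrite ent_outr //; case: j hj.
  rewrite (ent_in _ (ltn0Sn 0) hj) mxE; by congr (_%:R); rewrite -!val_eqE.
exists (v *m P); split.
- rewrite mulmx_free_eq0 //; apply/eqP => e; have := entv 0%N.
  by rewrite e ent0 => /esym/eqP; rewrite oner_eq0.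
- by rewrite -h1 submxMl.
- rewrite -mulmxA -hE mulmxA (_ : v *m _ = 0) ?mul0mx //.
  apply: entP => i j; rewrite ltnS leqn0 => /eqP -> hj.
  by rewrite ent_mulVE entv ent0 mulr0.
- rewrite -mulmxA -hH mulmxA scalemxAl; congr (_ *m _).
  apply: entP => i j; rewrite ltnS leqn0 => /eqP -> hj.
  rewrite ent_mulVH entZ entv; case: j hj => [|j] hj; last by rewrite !mulr0.
  by rewrite muln0 subr0.
Qed.

(** The sum need not be direct, so closure under sums is immediate; complements are constructed in
    [semisimple_compl]. *)
Definition semisimple (W : 'M[F]_d) : Prop :=
  exists s : seq 'M[F]_d, (forall X, X \in s -> exists k, sl2_iso_V r X k) /\
    (\sum_(X <- s) X :=: W)%MS.

Lemma sub_seqsum (s : seq 'M[F]_d) X : X \in s -> (X <= \sum_(Y <- s) Y)%MS.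
Proof.
elim: s => // Y s IH; rewrite inE big_cons => /orP[/eqP ->|/IH h].
  exact: addsmxSl.
by apply: submx_trans h _; apply: addsmxSr.
Qed.

Lemma seqsum_sub (s : seq 'M[F]_d) p (W : 'M[F]_(p, d)) :
  (forall X, X \in s -> (X <= W)%MS) -> (\sum_(Y <- s) Y <= W)%MS.
Proof.
elim: s => [|Y s IH] h; first by rewrite big_nil sub0mx.
rewrite big_cons addsmx_sub h ?mem_head //= IH // => X hX.
by apply: h; rewrite inE hX orbT.
Qed.

Lemma semisimple_eqmx (W W' : 'M[F]_d) : (W :=: W')%MS -> semisimple W -> semisimple W'.
Proof. by move=> e [s [h1 h2]]; exists s; split=> //; apply: eqmx_trans h2 e. Qed.

Lemma semisimple_adds (W W' : 'M[F]_d) :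
  semisimple W -> semisimple W' -> semisimple (W + W')%MS.
Proof.
move=> [s [h1 h2]] [t [g1 g2]]; exists (s ++ t); split.
  by move=> X; rewrite mem_cat => /orP[/h1|/g1].
rewrite big_cat /=; exact: adds_eqmx.
Qed.

Lemma sstable_adds p q (A : 'M[F]_(p, d)) (B : 'M[F]_(q, d)) :
  sstable A -> sstable B -> sstable (A + B)%MS.
Proof.
by move=> [h1 h2 h3] [g1 g2 g3]; split; rewrite addsmxMr addsmxS.
Qed.

Lemma sstable_cap p q (A : 'M[F]_(p, d)) (B : 'M[F]_(q, d)) :
  sstable A -> sstable B -> sstable (A :&: B)%MS.
Proof.
move=> [h1 h2 h3] [g1 g2 g3]; split; apply: submx_trans (capmxMr _ _ _) _;
exact: capmxS.
Qed.

Lemma cap_adds_eq0 (A B C : 'M[F]_d) : (A :&: B = 0)%MS -> ((A + B) :&: C = 0)%MS ->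
  (A :&: (B + C) = 0)%MS.
Proof.
move=> h1 h2; apply/eqP; rewrite -submx0; apply/rV_subP => v.
rewrite sub_capmx => /andP[hA /sub_addsmxP[[x y] /= e]].
have hy : (y *m C <= (A + B) :&: C)%MS.
  rewrite sub_capmx submxMl andbT.
  have -> : y *m C = v - x *m B by rewrite e addrAC subrr add0r.
  apply: addmx_sub; first by apply: submx_trans hA (addsmxSl _ _).
  by rewrite eqmx_opp; apply: submx_trans (submxMl _ _) (addsmxSr _ _).
move: hy; rewrite h2 submx0 => /eqP y0; rewrite y0 addr0 in e.
by rewrite -h1 sub_capmx hA e submxMl.
Qed.

(* The complement is built greedily, adding those summands of M that are not yet covered. *)
Lemma semisimple_compl (M W : 'M[F]_d) : semisimple M -> sstable W ->
  exists C : 'M[F]_d, [/\ sstable C, (W :&: C = 0)%MS & (M <= W + C)%MS].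
Proof.
move=> [s [hs eM]] sW.
suff [C [h1 h2 h3]] : exists C : 'M[F]_d, [/\ sstable C, (W :&: C = 0)%MS & (\sum_(X <- s) X <= W + C)%MS].
  by exists C; split=> //; rewrite -eM.
elim: s hs {eM} => [|X s IH] hs.
  exists 0; split; [by split; rewrite mul0mx|exact: capmx0|by rewrite big_nil sub0mx].
have [|C [sC dC hC]] := IH; first by move=> Y hY; apply: hs; rewrite inE hY orbT.
have [k hX] := hs X (mem_head _ _).
have [h|h] := boolP (X <= W + C)%MS.
  by exists C; split=> //; rewrite big_cons addsmx_sub h.
have d0 : ((W + C) :&: X = 0)%MS.
  apply/eqP; apply: contraR h => h0.
  apply: submx_trans (capmxSl (W + C)%MS X); apply: (iso_irr hX) => //; last exact: capmxSr.
  by apply: sstable_cap (iso_stable hX); apply: sstable_adds.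
exists (C + X)%MS; split.
- exact: sstable_adds (iso_stable hX).
- exact: cap_adds_eq0.
- rewrite big_cons addsmx_sub; apply/andP; split.
    by apply: submx_trans (addsmxSr _ _); apply: addsmxSr.
  by apply: submx_trans hC _; rewrite addsmxS // addsmxSl.
Qed.

(** The projection to W along a stable complement commutes with sl(2) on M. So W is the sum of the
    images of the irreducible summands, and each image is zero or isomorphic to its summand. *)
Lemma semisimple_sub (M W : 'M[F]_d) : semisimple M -> sstable W -> (W <= M)%MS -> semisimple W.
Proof.
move=> ssM sW hWM; have [C [sC dC hC]] := semisimple_compl ssM sW.
case: ssM => s [hs eM].
pose pi := proj_mx W C.
(* Zero images are discarded, since [sl2_iso_V] never holds for the zero space. *)
exists [seq Y <- [seq X *m pi | X <- s] | Y != 0]; split.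
  move=> Y; rewrite mem_filter => /andP[Y0 /mapP[X hX eY]].
  have [k [P [fP /eqmxP eP hE hH hF]]] := hs X hX; exists k.
  have hP : (P <= W + C)%MS by rewrite eP; apply: submx_trans hC; rewrite -eM; apply: sub_seqsum.
  have comm (A : 'M[F]_d) (M' : 'M[F]_k.+1) : (W *m A <= W)%MS -> (C *m A <= C)%MS ->
      M' *m P = P *m A -> M' *m (P *m pi) = (P *m pi) *m A.
    move=> hW hC' e; rewrite mulmxA e.
    rewrite -[in LHS](add_proj_mx dC hP) -/pi mulmxDl mulmxDl.
    rewrite (proj_mx_id (W := _ *m A)) //; last first.
      by apply: submx_trans hW; apply: submxMr; apply: proj_mx_sub.
    rewrite (proj_mx_0 (W := _ *m A)) ?addr0 //.
    by apply: submx_trans hC'; apply: submxMr; apply: proj_mx_sub.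
  case: sW sC => [w1 w2 w3] [c1 c2 c3].
  apply: (iso_eqmx (W := <<P *m pi>>%MS)).
    by apply: eqmx_trans (genmxE _) _; rewrite eY; apply: eqmxMr.
  apply: sl2in_iso; first by split; apply: comm.
  by rewrite -mxrank_eq0 (eqmxMr pi eP) -eY mxrank_eq0.
rewrite big_filter big_mkcond (eq_bigr (fun Y => Y)); last by move=> Y _; case: eqP => //.
rewrite big_map; apply/eqmxP/andP; split.
  elim: (s) => [|X t IH]; first by rewrite big_nil sub0mx.
  by rewrite big_cons addsmx_sub proj_mx_sub.
have e : W *m pi = W by apply: proj_mx_id.
rewrite -{1}e; apply: submx_trans (submxMr pi hWM) _; rewrite -(eqmxMr pi eM).
elim: (s) => [|X t IH]; first by rewrite big_nil mul0mx sub0mx.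
by rewrite !big_cons addsmxMr addsmxS.
Qed.

(* Every summand contains a highest weight vector, hence the line of v, so all summands coincide. *)
Lemma semisimple_line (W : 'M[F]_d) c (v : 'rV[F]_d) :
  semisimple W -> (v <= W)%MS -> v != 0 -> v *m rH r = c%:R *: v ->
  (forall (u : 'rV[F]_d) k, (u <= W)%MS -> u *m rE r = 0 -> u *m rH r = k%:R *: u -> (u <= v)%MS) ->
  sl2_iso_V r W c.
Proof.
move=> [s [hs eW]] vW v0 vH hu.
have hX X : X \in s -> sl2_iso_V r X c /\ (v <= X)%MS.
  move=> Xs; have [k hk] := hs X Xs; have [u [u0 uX uE uH]] := iso_hw hk.
  have : (u <= v)%MS by apply: hu uE uH; rewrite -eW; apply: submx_trans uX (sub_seqsum Xs).
  case/sub_rVP => a e.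
  have a0 : a != 0 by apply: contraNneq u0 => a0; rewrite e a0 scale0r.
  have hv : v = a^-1 *: u by rewrite e scalerA mulVf // scale1r.
  split; last by rewrite hv scalemx_sub.
  suff <- : k = c by [].
  apply: natF_inj => /=; have := uH; rewrite e -scalemxAl vH !scalerA => h.
  have : (a * c%:R - k%:R * a) *: v = 0 by rewrite scalerBl h subrr.
  move/eqP; rewrite scaler_eq0 (negbTE v0) orbF mulrC -mulrBl mulf_eq0 (negbTE a0) orbF subr_eq0.
  by move/eqP.
case: s hs eW hX => [|X s] hs eW hX.
  by rewrite big_nil in eW; move: vW; rewrite -eW submx0 (negbTE v0).
have [iX vX] := hX X (mem_head _ _).
apply: iso_eqmx (iX); apply: eqmx_trans eW; apply/eqmxP/andP; split; first by apply: sub_seqsum; rewrite mem_head.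
apply: seqsum_sub => Y /hX[iY vY].
apply: submx_trans (capmxSl X Y); apply: (iso_irr iY); last 1 first.
- apply: contraNneq v0 => h; rewrite -submx0 -h sub_capmx vX vY //.
- apply: sstable_cap; [exact: iso_stable iX|exact: iso_stable iY].
- exact: capmxSr.
Qed.

Lemma semisimple_eq0 (W : 'M[F]_d) :
  semisimple W ->
  (forall (u : 'rV[F]_d) k, (u <= W)%MS -> u *m rE r = 0 -> u *m rH r = k%:R *: u -> u = 0) ->
  W = 0.
Proof.
move=> [s [hs eW]] hu; apply/eqP; rewrite -submx0 -eW; apply: seqsum_sub => X Xs.
have [k hk] := hs X Xs; have [u [u0 uX uE uH]] := iso_hw hk.
by rewrite (hu u k) ?eqxx // in u0; rewrite -eW; apply: submx_trans uX (sub_seqsum Xs).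
Qed.

End Rep.
End Sl2.

(** * Tensor products as spaces of matrices *)

Section Vec.
Variable F : fieldType.

(** A tensor is read as its d1 x d2 coefficient matrix U. By [unvec_tensact], a Lie algebra element
    acting by A and B on the factors sends U to A^T U + U B. *)
Definition unvec d1 d2 (u : 'rV[F]_(d1 * d2)) : 'M[F]_(d1, d2) :=
  \matrix_(i, j) u 0 (mxtens_index (i, j)).
Definition vec d1 d2 (U : 'M[F]_(d1, d2)) : 'rV[F]_(d1 * d2) :=
  \row_k U (mxtens_unindex k).1 (mxtens_unindex k).2.

Lemma vecK d1 d2 : cancel (@vec d1 d2) (@unvec d1 d2).
Proof. by move=> U; apply/matrixP => i j; rewrite !mxE mxtens_indexK. Qed.

Lemma unvecK d1 d2 : cancel (@unvec d1 d2) (@vec d1 d2).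
Proof. by move=> u; apply/rowP => k; rewrite !mxE -surjective_pairing mxtens_unindexK. Qed.

Lemma unvecD d1 d2 (u v : 'rV[F]_(d1 * d2)) : unvec (u + v) = unvec u + unvec v.
Proof. by apply/matrixP => i j; rewrite !mxE. Qed.

Lemma unvecZ d1 d2 c (u : 'rV[F]_(d1 * d2)) : unvec (c *: u) = c *: unvec u.
Proof. by apply/matrixP => i j; rewrite !mxE. Qed.

Lemma unvec0 d1 d2 : unvec (0 : 'rV[F]_(d1 * d2)) = 0.
Proof. by apply/matrixP => i j; rewrite !mxE. Qed.

Lemma unvec_eq0 d1 d2 (u : 'rV[F]_(d1 * d2)) : (unvec u == 0) = (u == 0).
Proof.
apply/eqP/eqP => [h|->]; last exact: unvec0.
by apply: (can_inj (@unvecK d1 d2)); rewrite h unvec0.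
Qed.

Lemma unvec_tens m n p q (u : 'rV[F]_(m * p)) (A : 'M[F]_(m, n)) (B : 'M[F]_(p, q)) :
  unvec (u *m (A *t B)) = A^T *m unvec u *m B.
Proof.
apply/matrixP => i j; rewrite -mulmxA !mxE.
rewrite (reindex (@mxtens_index m p)) /=; last first.
  by exists (@mxtens_unindex m p) => k _; rewrite (mxtens_indexK, mxtens_unindexK).
transitivity (\sum_k \sum_l u 0 (mxtens_index (k, l)) * (A k i * B l j)).
  rewrite pair_big; apply: eq_bigr => -[k l] _ /=; by rewrite tensmxE.
apply: eq_bigr => k _; rewrite !mxE mulr_sumr; apply: eq_bigr => l _.
by rewrite !mxE mulrCA.
Qed.

Lemma tensmxDl m n p q (A A' : 'M[F]_(m, n)) (B : 'M[F]_(p, q)) :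
  (A + A') *t B = A *t B + A' *t B.
Proof. by apply/matrixP => i j; rewrite !mxE mulrDl. Qed.

Lemma tensmxDr m n p q (A : 'M[F]_(m, n)) (B B' : 'M[F]_(p, q)) :
  A *t (B + B') = A *t B + A *t B'.
Proof. by apply/matrixP => i j; rewrite !mxE mulrDr. Qed.

Lemma tensmxZl m n p q c (A : 'M[F]_(m, n)) (B : 'M[F]_(p, q)) :
  (c *: A) *t B = c *: (A *t B).
Proof. by apply/matrixP => i j; rewrite !mxE mulrA. Qed.

Lemma tensmxZr m n p q c (A : 'M[F]_(m, n)) (B : 'M[F]_(p, q)) :
  A *t (c *: B) = c *: (A *t B).
Proof. by apply/matrixP => i j; rewrite !mxE mulrCA. Qed.

Lemma tens1 m n : (1%:M : 'M[F]_m) *t (1%:M : 'M[F]_n) = 1%:M.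
Proof.
apply/matrixP => i j; case: (mxtens_indexP i) => i1 i2; case: (mxtens_indexP j) => j1 j2.
rewrite tensmxE !mxE -natrM mulnb; congr (_%:R); congr nat_of_bool.
by rewrite -xpair_eqE (can_eq (@mxtens_indexK m n)).
Qed.

Lemma tens_row_free m n p q (A : 'M[F]_(m, n)) (B : 'M[F]_(p, q)) :
  row_free A -> row_free B -> row_free (A *t B).
Proof.
move=> /row_freeP[A' hA] /row_freeP[B' hB]; apply/row_freeP; exists (A' *t B').
by rewrite tensmx_mul hA hB tens1.
Qed.

Lemma tensS m m' n p p' q (A : 'M[F]_(m, n)) (B : 'M[F]_(p, q)) (C : 'M[F]_(m', n)) (D : 'M[F]_(p', q)) :
  (A <= C)%MS -> (B <= D)%MS -> (A *t B <= C *t D)%MS.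
Proof. by move=> /submxP[A' ->] /submxP[B' ->]; rewrite -tensmx_mul submxMl. Qed.

Lemma eqmx_tens m m' n p p' q (A : 'M[F]_(m, n)) (B : 'M[F]_(p, q)) (C : 'M[F]_(m', n)) (D : 'M[F]_(p', q)) :
  (A :=: C)%MS -> (B :=: D)%MS -> (A *t B :=: C *t D)%MS.
Proof. by move=> e1 e2; apply/eqmxP/andP; split; apply: tensS; rewrite ?e1 ?e2. Qed.

Lemma unvec_tensact d1 d2 (u : 'rV[F]_(d1 * d2)) (A : 'M[F]_d1) (B : 'M[F]_d2) :
  unvec (u *m tensact A B) = A^T *m unvec u + unvec u *m B.
Proof. by rewrite /tensact mulmxDr unvecD !unvec_tens mulmx1 trmx1 mul1mx. Qed.

Lemma tensact_tens m n d1 d2 (P : 'M[F]_(m, d1)) (Q : 'M[F]_(n, d2)) (A : 'M[F]_d1) (B : 'M[F]_d2) :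
  (P *t Q) *m tensact A B = (P *m A) *t Q + P *t (Q *m B).
Proof. by rewrite /tensact mulmxDr !tensmx_mul !mulmx1. Qed.

Lemma tens_tensact m n d1 d2 (P : 'M[F]_(m, d1)) (Q : 'M[F]_(n, d2)) (A : 'M[F]_m) (B : 'M[F]_n) :
  tensact A B *m (P *t Q) = (A *m P) *t Q + P *t (B *m Q).
Proof. by rewrite /tensact mulmxDl !tensmx_mul !mul1mx. Qed.

Lemma lbr_tensact d1 d2 (A C : 'M[F]_d1) (B D : 'M[F]_d2) :
  lbr (tensact A B) (tensact C D) = tensact (lbr A C) (lbr B D).
Proof.
(* Here y and z stand for the mixed products, which cancel because operators on different factors
   commute. *)
have aux (V : zmodType) (x y z w x' w' : V) :
    (x + y + (z + w)) - (x' + z + (y + w')) = (x - x') + (w - w').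
  by rewrite !opprD !addrA (ACl (1 * 5 * 4 * 8 * 2 * 7 * 3 * 6)%AC) /= !addrK.
rewrite /lbr /tensact !mulmxDl !mulmxDr !tensmx_mul !mulmx1 !mul1mx aux.
by rewrite -!scaleN1r !tensmxDl !tensmxDr !tensmxZl !tensmxZr.
Qed.

End Vec.

(** * Highest weight vectors and the Clebsch-Gordan decomposition *)

Section HighestWeight.
Variable F : fieldType.
Hypothesis charF0 : [pchar F] =i pred0.

(** * The submodule generated by a highest weight vector *)

Section Generate.
Variables (n d : nat) (r : grep F n d).
Hypothesis brEF : lbr (rE r) (rF r) = rH r.
Hypothesis brHF : lbr (rH r) (rF r) = - (2%:R *: rF r).
Variables (v : 'rV[F]_d) (c : nat).
Hypothesis vE : v *m rE r = 0.
Hypothesis vH : v *m rH r = c%:R *: v.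

Let w i := iter i (mulmxr (rF r)) v.

Lemma lowering_H i : w i *m rH r = (c%:R - (2 * i)%:R) *: w i.
Proof.
elim: i => [|i IH]; first by rewrite muln0 subr0.
have e : rF r *m rH r = rH r *m rF r - 2%:R *: rF r.
  by rewrite -brHF /lbr addrCA subrr addr0.
rewrite /= -/(w i) -mulmxA e mulmxBr mulmxA IH -scalemxAl -scalemxAr -scalerBl.
by congr (_ *: _); rewrite mulnS natrD; ring.
Qed.

Lemma lowering_E i : w i.+1 *m rE r = (i.+1%:R * (c%:R - i%:R)) *: w i.
Proof.
have e : rF r *m rE r = rE r *m rF r + rH r.
  by rewrite -brEF /lbr addrCA subrr addr0.
elim: i => [|i IH].
  by rewrite /= -mulmxA e mulmxDr mulmxA vE mul0mx add0r vH subr0 mul1r.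
rewrite {1}[w i.+2]/= -/(w i.+1) -mulmxA e mulmxDr mulmxA IH -scalemxAl.
rewrite -[_ *m rF r]/(w i.+1) lowering_H -scalerDl; congr (_ *: _).
by rewrite -(@natr1 F i.+1) -(@natr1 F i) natrM -(@natr1 F i); ring.
Qed.

(** Let M be the least exponent with f^M v = 0. If M > c + 1, the identity e f^M v = M (c - M + 1)
    f^(M-1) v contradicts minimality. Hence f^(c+1) v = 0 and the string closes up as V(c). *)
Lemma hw_generate N : w N = 0 -> exists P : 'M[F]_(c.+1, d),
  sl2in r P /\ row 0 P = v.
Proof.
move=> wN.
have wc : w c.+1 = 0.
  have hex : exists N, w N == 0 by exists N; rewrite wN.
  case: (ex_minnP hex) => M /eqP wM hmin.
  case: (leqP M c.+1) => hM.
    by rewrite -(subnKC hM) addnC /w iterD -/(w M) wM; elim: (_ - _)%N => //= t ->; rewrite mul0mx.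
  case: M wM hmin hM => // M wM hmin hM.
  have := lowering_E M; rewrite wM mul0mx => /esym/eqP.
  rewrite scaler_eq0 mulf_eq0 (negbTE (natS_neq0 charF0 _)) /=.
  case/orP => [|/hmin]; last by rewrite ltnn.
  by rewrite subr_eq0 => /eqP/(natF_inj charF0) e; rewrite e ltnn in hM.
have fN i : (i`!)%:R != 0 :> F by rewrite natF_eq0 // -lt0n fact_gt0.
(* Division by i! matches the normalisation f.v_i = (i+1) v_(i+1) of V(c). *)
pose P : 'M[F]_(c.+1, d) := \matrix_i ((i`!)%:R^-1 *: w i).
exists P; split; last by rewrite rowK fact0 invr1 scale1r.
split; apply/row_matrixP => i; rewrite !row_mul rowK mulmx_sum_row -scalemxAl.
- case: i => -[|i] hi /=.
    rewrite -/(w 0) vE scaler0 big1 // => j _; rewrite !mxE /=.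
    by rewrite scale0r.
  rewrite -/(w i.+1) lowering_E.
  have hi' : (i < c.+1)%N by apply: ltnW.
  rewrite (bigD1 (Ordinal hi')) //= big1 ?addr0 => [|j hj].
    rewrite !mxE /= eqxx rowK !scalerA; congr (_ *: _) => /=.
    rewrite factS natrM natrB; last by rewrite -ltnS.
    by field; rewrite fN addrC natr1 natS_neq0.
  rewrite !mxE /=; case: eqP => [e|]; last by rewrite scale0r.
  by case/eqP: hj; apply: val_inj; case: e.
- rewrite lowering_H (bigD1 i) //= big1 ?addr0 => [|j hj].
    by rewrite !mxE eqxx rowK !scalerA mulrC.
  by rewrite !mxE eq_sym (negbTE (_ : j != i :> nat)) ?scale0r.
- rewrite -[_ *m rF r]/(w i.+1).
  case: (ltnP i.+1 c.+1) => hi.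
    rewrite (bigD1 (Ordinal hi)) //= big1 ?addr0 => [|j hj].
      rewrite !mxE /= eqxx rowK !scalerA; congr (_ *: _) => /=.
      by rewrite factS natrM; field; rewrite fN addrC natr1 natS_neq0.
    by rewrite !mxE (negbTE (_ : j != i.+1 :> nat)) ?scale0r.
  have -> : i.+1 = c.+1 by apply/eqP; rewrite eqn_leq hi andbT.
  rewrite wc scaler0 big1 // => j _; rewrite !mxE.
  rewrite (_ : (j == i.+1 :> nat) = false) ?scale0r //.
  by apply/negbTE; rewrite neq_ltn (leq_trans (ltn_ord j) hi).
Qed.

End Generate.

(** * Highest weight vectors of V(a) (x) V(b) in coordinates *)

Section HwEntries.
Variables (a b : nat).

Definition tens_hw (c : 'M[F]_(a.+1, b.+1)) (k : F) : Prop :=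
  (VE F a)^T *m c + c *m VE F b = 0 /\ (VH F a)^T *m c + c *m VH F b = k *: c.

Lemma hw_rel c k i j : tens_hw c k ->
  (a - i)%:R * ent c i.+1 j + (b - j)%:R * ent c i j.+1 = 0.
Proof. by case=> h _; rewrite -ent_VEmul -ent_mulVE -entD h ent0. Qed.

Lemma hw_supp c k i j : tens_hw c k%:R -> ent c i j != 0 -> (a + b = k + 2 * (i + j))%N.
Proof.
case=> _ h hn; apply: (natF_inj charF0) => /=.
have : ent ((VH F a)^T *m c + c *m VH F b) i j = k%:R * ent c i j by rewrite h entZ.
rewrite entD ent_VHmul ent_mulVH -mulrDl => /(mulIf hn) e.
rewrite natrD (natrD _ k) -e mulnDr natrD; ring.
Qed.

(** The coefficients solve the recursion [hw_rel] along the antidiagonal i + j = k. For k at most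
    min(a, b) this is the highest weight vector of the summand V(a + b - 2k). *)
Definition hwvec k : 'M[F]_(a.+1, b.+1) :=
  \matrix_(i, j) (if (i + j == k)%N then (-1) ^+ i * ((a - i)`! * (b - j)`!)%:R else 0).

Lemma ent_hwvec k i j : (i <= a)%N -> (j <= b)%N -> ent (hwvec k) i j =
  if (i + j == k)%N then (-1) ^+ i * ((a - i)`! * (b - j)`!)%:R else 0.
Proof. by move=> hi hj; rewrite (ent_in _ (hi : (i < a.+1)%N) (hj : (j < b.+1)%N)) mxE. Qed.

Lemma hwvec_hw k : (k <= a)%N -> (k <= b)%N -> tens_hw (hwvec k) (a + b - 2 * k)%:R.
Proof.
move=> ka kb; split; apply: entP => i j hi hj.
  rewrite ent0 entD ent_VEmul ent_mulVE.
  case: (leqP a i) => hai.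
    rewrite (_ : a - i = 0)%N; last by apply/eqP; rewrite subn_eq0.
    rewrite mul0r add0r; case: (leqP b j) => hbj; last first.
      by rewrite ent_hwvec // (_ : _ == k = false) ?mulr0 //; apply/negbTE; lia.
    by rewrite (_ : b - j = 0)%N ?mul0r //; apply/eqP; rewrite subn_eq0.
  case: (leqP b j) => hbj.
    rewrite (_ : b - j = 0)%N ?mul0r ?addr0; last by apply/eqP; rewrite subn_eq0.
    by rewrite ent_hwvec // (_ : _ == k = false) ?mulr0 //; apply/negbTE; lia.
  rewrite !ent_hwvec //; rewrite (_ : i.+1 + j = i + j.+1)%N ?addnS //.
  case: eqP => _; last by rewrite !mulr0 addr0.
  rewrite -(subnSK hai) -(subnSK hbj) !factS !natrM exprS; ring.
rewrite entD ent_VHmul ent_mulVH entZ -mulrDl ent_hwvec //.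
case: eqP => [e|_]; last by rewrite !mulr0.
congr (_ * _).
have -> : (a + b - 2 * k)%:R = (a + b)%:R - (2 * k)%:R :> F by rewrite natrB //; lia.
rewrite -e natrD mulnDr natrD; ring.
Qed.

Lemma hwvec_neq0 k i j : (i <= a)%N -> (j <= b)%N -> (i + j = k)%N -> ent (hwvec k) i j != 0.
Proof.
move=> hi hj e; rewrite ent_hwvec // e eqxx mulf_neq0 ?signr_eq0 //.
by rewrite natF_eq0 // muln_eq0 negb_or -!lt0n !fact_gt0.
Qed.

(** By [hw_rel], row i determines row i + 1, because a - i is nonzero for i < a. So a highest weight
    vector is known from its row 0. *)
Lemma hw_border c k : tens_hw c k -> (forall j, ent c 0 j = 0) -> c = 0.
Proof.
move=> hc h0; apply: entP => i j hi _; rewrite ent0; move: hi j.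
elim: i => [|i IH] hi j; first exact: h0.
have := hw_rel i j hc; rewrite (IH (ltnW hi)) mulr0 addr0 => /eqP.
rewrite mulf_eq0 natF_eq0 // => /orP[|/eqP //].
by rewrite subn_eq0 leqNgt (_ : (i < a)%N).
Qed.

(** The weight confines c to one antidiagonal. There the recursion carries nonvanishing from the
    entry (0, s) to all others. Entries outside the matrix count as 0, so those at (0, s) and (s, 0)
    yield the two bounds on s. *)
Lemma hw_nonzero c k s : tens_hw c k%:R -> c != 0 -> (a + b = k + 2 * s)%N ->
  [/\ (s <= a)%N, (s <= b)%N & forall i j, (i + j = s)%N -> ent c i j != 0].
Proof.
move=> hc c0 es.
have supp i j : ent c i j != 0 -> (i + j = s)%N by move/(hw_supp hc); lia.
have h0 : ent c 0 s != 0.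
  apply: contraNneq c0 => h; apply/eqP/(hw_border hc) => j.
  apply/eqP; apply: contraT => hj; by have := supp _ _ hj; rewrite add0n => ej; rewrite ej h eqxx in hj.
have sb : (s <= b)%N by rewrite leqNgt; apply: contra h0 => h; rewrite ent_outr.
have all i : (i <= s)%N -> ent c i (s - i) != 0.
  elim: i => [|i IH] hi; first by rewrite subn0.
  have := hw_rel i (s - i.+1) hc; rewrite (_ : (s - i.+1).+1 = s - i)%N; last by lia.
  move=> e; apply/eqP => ez; move: e; rewrite ez mulr0 add0r => /eqP.
  by rewrite mulf_eq0 (negbTE (IH (ltnW hi))) orbF natF_eq0 //; lia.
split=> //.
  rewrite leqNgt; apply: contra (all s (leqnn s)) => h.
  by rewrite ent_outl.
move=> i j e; have -> : j = (s - i)%N by lia.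
apply: all; lia.
Qed.

End HwEntries.

Lemma brV_EF k : lbr (VE F k) (VF F k) = VH F k.
Proof.
apply: entP => i j hi hj; rewrite /lbr -scaleN1r entD entZ.
rewrite -[VF F k *m _]mul1mx -[VE F k *m _]mul1mx -[VH F k]mul1mx !mulmxA.
rewrite ent_mulVE (ent_mulVF (1%:M *m _)) // ent_mulVE ent_mulVH.
case: (ltnP j k) => hjk; last first.
  have -> : j = k by lia.
  rewrite subnn mul0r add0r; case: k {hi hj hjk} => [|k] /=; first by rewrite muln0; ring.
  by rewrite subSnn natrM; ring.
rewrite ent_mulVF //=.
case: j hj hjk => [|j] hj hjk; first by rewrite muln0 subn0; ring.
rewrite /= -(subnSK (ltnW hjk)) -(subnSK hjk).
have -> : k%:R = (k - j.+2)%:R + j.+2%:R :> F by rewrite -natrD subnK.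
by rewrite natrM -!natr1; ring.
Qed.

Lemma brV_HF k : lbr (VH F k) (VF F k) = - (2%:R *: VF F k).
Proof.
apply: entP => i j hi hj; rewrite /lbr -!scaleN1r entD !entZ.
rewrite -[VF F k *m _]mul1mx -[VH F k *m _]mul1mx -[VF F k in RHS]mul1mx !mulmxA.
rewrite ent_mulVH !ent_mulVF // ent_mulVH.
case: j hj => [|j] hj; first by ring.
by rewrite /= natrM -natr1 natrM; ring.
Qed.

(** At t = min(a, b) + 1 the value is (a + 1)(b + 1), the dimension of V(a) (x) V(b). The formula
    for smaller t serves the induction. *)
Lemma sum_CG a b t : (t <= (minn a b).+1)%N ->
  (\sum_(k < t) (a + b - 2 * k).+1 = t * (a + b + 2 - t))%N.
Proof.
elim: t => [|t IH] ht; first by rewrite big_ord0.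
rewrite big_ord_recr IH /=; last exact: ltnW.
have h1 : (t <= a)%N by lia.
have h2 : (t <= b)%N by lia.
rewrite -(subnKC h1) -(subnKC h2); move: (a - t)%N (b - t)%N => x y.
rewrite (_ : _ - 2 * t = x + y)%N; last by lia.
rewrite (_ : _ + 2 - t = x + y + t + 2)%N; last by lia.
rewrite (_ : _ + 2 - t.+1 = x + y + t + 1)%N; last by lia.
nia.
Qed.

Section ClebschGordan.
Variables (n d : nat) (r : grep F n d) (a b : nat) (R : 'M[F]_(a.+1 * b.+1, d)).
Hypothesis freeR : row_free R.
Hypothesis RE : tensact (VE F a) (VE F b) *m R = R *m rE r.
Hypothesis RH : tensact (VH F a) (VH F b) *m R = R *m rH r.
Hypothesis RF : tensact (VF F a) (VF F b) *m R = R *m rF r.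

Definition Vtens : grep F n (a.+1 * b.+1) :=
  GRep (tensact (VE F a) (VE F b)) (tensact (VH F a) (VH F b)) (tensact (VF F a) (VF F b))
    (fun=> 0) 0.

Lemma CG_summand k : (k <= a)%N -> (k <= b)%N ->
  exists W, sl2_iso_V r W (a + b - 2 * k) /\ (W <= R)%MS.
Proof.
move=> ka kb; pose v := vec (hwvec a b k).
have v0 : v != 0.
  rewrite -unvec_eq0 vecK; apply/eqP => e.
  by have := @hwvec_neq0 a b k k 0%N ka (leq0n b) (addn0 k); rewrite e ent0 eqxx.
have [hE hH] := hwvec_hw ka kb.
have vE : v *m rE Vtens = 0.
  by apply: (can_inj (@unvecK F _ _)); rewrite unvec_tensact vecK hE unvec0.
have vH : v *m rH Vtens = (a + b - 2 * k)%:R *: v.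
  by apply: (can_inj (@unvecK F _ _)); rewrite unvec_tensact unvecZ vecK hH.
have brEF : lbr (rE Vtens) (rF Vtens) = rH Vtens by rewrite lbr_tensact !brV_EF.
have brHF : lbr (rH Vtens) (rF Vtens) = - (2%:R *: rF Vtens).
  rewrite lbr_tensact !brV_HF /= /tensact -!scaleN1r !tensmxZl !tensmxZr !scalerDr //.
(* Applying f this often pushes the weight below -(a + b), the lowest weight of V(a) (x) V(b), so
   the result is 0. *)
pose N := (a + b).+1.*2.
have wN : iter N (mulmxr (rF Vtens)) v = 0.
  set w := iter _ _ _; apply/eqP; rewrite -unvec_eq0; apply: contraT => hw.
  have [i [j [hi hj hn]]] := ent_neq0 hw.
  have := lowering_H brHF vH N; rewrite -/w => /(congr1 (@unvec F _ _)).
  rewrite unvec_tensact unvecZ => /(congr1 (fun M => ent M i j)).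
  rewrite entD entZ ent_VHmul ent_mulVH -mulrDl => /(mulIf hn) e.
  have : (a + b + 2 * N)%:R = (a + b - 2 * k + 2 * i + 2 * j)%:R :> F.
    rewrite !natrD.
    have -> : a%:R = (a%:R - (2 * i)%:R) + (b%:R - (2 * j)%:R) - b%:R + (2 * i)%:R + (2 * j)%:R :> F by ring.
    rewrite e; ring.
  by move/(natF_inj charF0); rewrite /N; lia.
have [P [sP rP]] := hw_generate brEF brHF vE vH wN.
exists <<P *m R>>%MS; split; last by rewrite genmxE submxMl.
apply: sl2in_iso => //.
  case: sP => h1 h2 h3; split; rewrite mulmxA.
  - by rewrite h1 -!mulmxA RE.
  - by rewrite h2 -!mulmxA RH.
  - by rewrite h3 -!mulmxA RF.
rewrite mulmx_free_eq0 //; apply: contraNneq v0 => e; rewrite -rP e; by rewrite row0.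
Qed.

(* The summands lie in distinct Casimir eigenspaces, so their sum is direct; it is everything by a dimension count. *)
Lemma clebsch_gordan (W : 'M[F]_d) : (W :=: R)%MS ->
  sl2_iso_sum r W [seq (a + b - 2 * k)%N | k <- iota 0 (minn a b).+1].
Proof.
move=> eW; set ks := map _ _.
have sz : size ks = (minn a b).+1 by rewrite size_map size_iota.
have nk (i : 'I_(size ks)) : nth 0%N ks i = (a + b - 2 * i)%N.
  by have := ltn_ord i; rewrite {2}sz => hi; rewrite (nth_map 0%N) ?size_iota // nth_iota.
have bd (i : 'I_(size ks)) : (i <= a)%N /\ (i <= b)%N.
  by have := ltn_ord i; rewrite {2}sz ltnS leq_min => /andP.
have ex (i : 'I_(size ks)) : exists Wi, sl2_iso_V r Wi (nth 0%N ks i) /\ (Wi <= R)%MS.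
  have [h1 h2] := bd i; rewrite nk; exact: CG_summand.
have {ex} [Ws hWs] := fin_all_exists ex.
exists Ws.
have dx : mxdirect (\sum_i Ws i).
  pose lam (i : 'I_(size ks)) : F := (nth 0%N ks i * nth 0%N ks i + 2 * nth 0%N ks i)%:R.
  have : mxdirect (\sum_i eigenspace (casimir r) (lam i)).
    apply: mxdirect_sum_eigenspace => i j _ _ /(natF_inj charF0); rewrite !nk.
    have [i1 i2] := bd i; have [j1 j2] := bd j => h.
    apply: val_inj => /=.
    have : (a + b - 2 * i = a + b - 2 * j)%N by move: h; set x := (_ - _)%N; set y := (a + b - _)%N; nia.
    move: i1 i2 j1 j2; move: (nat_of_ord i) (nat_of_ord j) => p q; lia.
  move/mxdirect_sumsP => h; apply/mxdirect_sumsP => i _; apply/eqP.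
  have sub j : (Ws j <= eigenspace (casimir r) (lam j))%MS.
    by apply: iso_casimir (proj1 (hWs j)).
  rewrite -submx0.
  have := capmxS (sub i) (sumsmxS (P := fun j => true && (j != i)) (fun j _ => sub j)).
  by rewrite (h i isT).
split=> //; first by move=> i; apply: (proj1 (hWs i)).
have sub : (\sum_i Ws i <= R)%MS by apply/sumsmx_subP => i _; apply: (proj2 (hWs i)).
have sub' : (\sum_i Ws i <= W)%MS by rewrite eW.
rewrite -(geq_leqif (mxrank_leqif_eq sub')) eW.
rewrite (eqP freeR) (mxdirectP dx) /=.
rewrite (eq_bigr (fun i : 'I_(size ks) => (a + b - 2 * i).+1)); last first.
  by move=> i _; rewrite (iso_rank (proj1 (hWs i))) nk.
have -> : (\sum_(i < size ks) (a + b - 2 * i).+1 = \sum_(i < (minn a b).+1) (a + b - 2 * i).+1)%N by rewrite sz.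
rewrite sum_CG //; case: (leqP a b) => h; nia.
Qed.

Lemma tens_semisimple (W : 'M[F]_d) : (W :=: R)%MS -> semisimple r W.
Proof.
move/clebsch_gordan => [Ws [h1 _ /eqmxP h2]]; exists [seq Ws i | i <- enum 'I_(size [seq (a + b - 2 * k)%N | k <- iota 0 (minn a b).+1])].
split; first by move=> X /mapP[i _ ->]; eexists; exact: h1.
by apply: eqmx_trans h2; rewrite big_map big_enum.
Qed.

End ClebschGordan.
End HighestWeight.

(** * Layers of a uniserial module *)

Section Layers.
Variable F : fieldType.
Hypothesis charF0 : [pchar F] =i pred0.

Section Idempotents.
Variables (d L : nat) (Ws : nat -> 'M[F]_d).
Hypothesis dx : mxdirect (\sum_(i < L.+1) Ws i).
Hypothesis full : (\sum_(i < L.+1) Ws i == 1%:M)%MS.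

(** Projections turn statements about layers into matrix identities. Extending e by 0 beyond L lets
    formulas with index i + 1 hold at the top layer as well. *)
Lemma direct_idempotents : exists e : nat -> 'M[F]_d,
  [/\ forall i j, e i *m e j = if i == j then e i else 0,
      \sum_(i < L.+1) e i = 1%:M,
      forall i, (L < i)%N -> e i = 0 &
      forall i, (i <= L)%N -> (e i :=: Ws i)%MS].
Proof.
pose e i := if (i <= L)%N then proj_mx (Ws i) (\sum_(j < L.+1 | j != i :> nat) Ws j)%MS else 0.
exists e.
have cap (i : 'I_L.+1) : (Ws i :&: \sum_(j < L.+1 | j != i :> nat) Ws j = 0)%MS.
  by have /mxdirect_sumsP h := dx; have := h i isT; rewrite /=.
have e_id i p (w : 'M_(p, d)) : (i <= L)%N -> (w <= Ws i)%MS -> w *m e i = w.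
  by move=> hi hw; rewrite /e hi; apply: proj_mx_id => //; apply: (cap (Ordinal (hi : (i < L.+1)%N))).
have e_0 i j p (w : 'M_(p, d)) : (i <= L)%N -> i != j -> (w <= Ws i)%MS -> w *m e j = 0.
  move=> hi hij hw; rewrite /e; case: ifP => hj; last by rewrite mulmx0.
  apply: proj_mx_0; first by apply: (cap (Ordinal (hj : (j < L.+1)%N))).
  by apply: submx_trans hw _; apply: (sumsmx_sup (Ordinal (hi : (i < L.+1)%N))).
have e_sub i : (i <= L)%N -> (e i <= Ws i)%MS.
  by move=> hi; rewrite /e hi -[proj_mx _ _]mul1mx proj_mx_sub.
split.
- move=> i j; case: (leqP i L) => hi; last first.
    have -> : e i = 0 by rewrite /e leqNgt hi.
    by rewrite mul0mx if_same.
  case: eqP => [<-|/eqP hij]; first by apply: e_id => //; apply: e_sub.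
  by apply: e_0 hi hij (e_sub _ hi).
- have /sub_sumsmxP[B hB] : (1%:M <= \sum_(i < L.+1) Ws i)%MS by rewrite (eqmxP full).
  rewrite -[LHS]mul1mx {1}hB [RHS]hB mulmx_suml; apply: eq_bigr => i _.
  rewrite mulmx_sumr (bigD1 i) //= big1 ?addr0 => [|j hj].
    by apply: e_id; rewrite ?submxMl // -ltnS.
  by apply: (e_0 i); rewrite ?submxMl // 1?eq_sym // -ltnS.
- by move=> i hi; rewrite /e leqNgt hi.
- move=> i hi; apply/eqmxP; rewrite e_sub //=.
  by rewrite -{1}(e_id i _ (Ws i) hi (submx_refl _)) submxMl.
Qed.

End Idempotents.

Section IdemLemmas.
Variables (d L : nat) (e : nat -> 'M[F]_d).
Hypothesis eM : forall i j, e i *m e j = if i == j then e i else 0.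
Hypothesis esum : \sum_(i < L.+1) e i = 1%:M.
Hypothesis eout : forall i, (L < i)%N -> e i = 0.

Lemma idem_sub p (w : 'M[F]_(p, d)) i : (w <= e i)%MS -> w *m e i = w.
Proof. by move=> /submxP[c ->]; rewrite -mulmxA eM eqxx. Qed.

Lemma idem_sub0 p (w : 'M[F]_(p, d)) i j : (w <= e i)%MS -> i != j -> w *m e j = 0.
Proof. by move=> /submxP[c ->] h; rewrite -mulmxA eM (negbTE h) mulmx0. Qed.

Lemma idem_comm (A : 'M[F]_d) : (forall i, (i <= L)%N -> (e i *m A <= e i)%MS) ->
  forall i, e i *m A = A *m e i.
Proof.
move=> h i; case: (leqP i L) => hi; last by rewrite eout // mul0mx mulmx0.
rewrite -(idem_sub (h i hi)) -[A in RHS]mul1mx -esum !mulmx_suml.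
rewrite (bigD1 (Ordinal (hi : (i < L.+1)%N))) //= big1 ?addr0 // => j hj.
by apply: (idem_sub0 (h j _)); rewrite // -ltnS.
Qed.

Lemma idem_shift (A : 'M[F]_d) : e 0%N *m A = 0 ->
  (forall i, (i < L)%N -> (e i.+1 *m A <= e i)%MS) ->
  forall i, A *m e i = e i.+1 *m A.
Proof.
move=> h0 h i; case: (ltnP L i) => hi.
  by rewrite !eout ?mul0mx ?mulmx0 // ltnW.
rewrite -[A in LHS]mul1mx -esum !mulmx_suml.
rewrite big_ord_recl /= h0 mul0mx add0r.
case: (ltnP i L) => hi'.
  rewrite (bigD1 (Ordinal hi')) //= big1 ?addr0 => [|j hj].
    by rewrite /bump /= add1n; apply: idem_sub; apply: h.
  by rewrite /bump /= add1n; apply: (idem_sub0 (h j _)).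
rewrite (eout (i := i.+1)) // mul0mx big1 // => j _.
rewrite /bump /= add1n; apply: (idem_sub0 (h j _)) => //.
by rewrite neq_ltn (leq_trans (ltn_ord j) hi').
Qed.

Lemma idem_decomp p (w : 'M[F]_(p, d)) : w = \sum_(i < L.+1) w *m e i.
Proof. by rewrite -mulmx_sumr esum mulmx1. Qed.

End IdemLemmas.

Section Modules.
Variables (n d : nat) (r : grep F n d).

(* A module graded by idempotents e 0, ..., e L with e i the projection onto the
   i-th layer V(a i); matrices act on row vectors, so lay_X says that h_n(m)
   maps layer i+1 to layer i. *)
Record layered (L : nat) (e : nat -> 'M[F]_d) (a : nat -> nat) : Prop := Layered {
  lay_mul : forall i j, e i *m e j = if i == j then e i else 0;
  lay_sum : \sum_(i < L.+1) e i = 1%:M;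
  lay_out : forall i, (L < i)%N -> e i = 0;
  lay_comm : forall i, sl2comm r (e i);
  lay_iso : forall i, (i <= L)%N -> sl2_iso_V r (e i) (a i);
  lay_X0 : forall s, e 0%N *m rX r s = 0;
  lay_X : forall i s, rX r s *m e i = e i.+1 *m rX r s;
  lay_X1 : forall i, (i < L)%N -> exists s, e i.+1 *m rX r s != 0 }.

Hypothesis rep : is_rep r.
Local Notation m := (mdeg n).

Definition kerX : 'M[F]_d := (\bigcap_s kermx (rX r s))%MS.

Lemma sub_kerX p (w : 'M[F]_(p, d)) : reflect (forall s, w *m rX r s = 0) (w <= kerX)%MS.
Proof.
apply: (iffP sub_bigcapmxP) => h s; last by move=> _; apply/sub_kermxP.
by apply/sub_kermxP; apply: h.
Qed.

Lemma kerX_Xat p (w : 'M[F]_(p, d)) i : (w <= kerX)%MS -> w *m Xat r i = 0.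
Proof. by move/sub_kerX => h; rewrite /Xat; case: ifP => _; rewrite ?mulmx0. Qed.

Lemma rep_EX s : rE r *m rX r s =
  rX r s *m rE r - (m - s).+1%:R *: (if val s == 0%N then 0 else Xat r (val s).-1).
Proof. by case: rep => _ _ _ [<- _ _ _] _; rewrite /lbr subKr. Qed.

Lemma rep_FX s : rF r *m rX r s = rX r s *m rF r - (val s).+1%:R *: Xat r (val s).+1.
Proof. by case: rep => _ _ _ [_ <- _ _] _; rewrite /lbr subKr. Qed.

Lemma rep_HX s : rH r *m rX r s = rX r s *m rH r - (m%:R - (2 * val s)%:R) *: rX r s.
Proof. by case: rep => _ _ _ [_ _ <- _] _; rewrite /lbr subKr. Qed.

Lemma kerX_stable : sstable r kerX.
Proof.
have h s : kerX *m rX r s = 0 by apply/sub_kerX.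
have hat s : kerX *m Xat r s = 0 by apply: kerX_Xat.
split; apply/sub_kerX => s; rewrite -mulmxA.
- rewrite rep_EX mulmxBr mulmxA h mul0mx -scalemxAr; case: ifP => _.
    by rewrite mulmx0 scaler0 subr0.
  by rewrite hat scaler0 subr0.
- by rewrite rep_HX mulmxBr mulmxA h mul0mx -scalemxAr h scaler0 subr0.
- by rewrite rep_FX mulmxBr mulmxA h mul0mx -scalemxAr hat scaler0 subr0.
Qed.

Lemma rep_ZX : rZ r = lbr (rX r ord0) (rX r ord_max).
Proof.
case: rep => _ _ _ [_ _ _ ->] _; rewrite /omega /= add0n eqxx expr0 bin0 mulr1.
by rewrite scale1r.
Qed.

Lemma kerZ_stable : sstable r (kermx (rZ r)).
Proof.
case: rep => _ _ _ _ [h1 h2 h3 _].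
have e A : lbr A (rZ r) = 0 -> (kermx (rZ r) *m A <= kermx (rZ r))%MS.
  move/eqP; rewrite /lbr subr_eq0 => /eqP e.
  by apply/sub_kermxP; rewrite -mulmxA -e mulmxA mulmx_ker mul0mx.
by split; apply: e.
Qed.

Lemma iso_inj (W : 'M[F]_d) k (K : 'M[F]_d) p (w : 'M[F]_(p, d)) :
  sl2_iso_V r W k -> sstable r K -> ~~ (W <= K)%MS -> (w <= W)%MS -> (w <= K)%MS -> w = 0.
Proof.
move=> iW sK hn wW wK; apply/eqP; rewrite -submx0.
have c0 : (W :&: K = 0)%MS.
  apply/eqP; apply: contraR hn => hn; apply: submx_trans (capmxSr W K).
  apply: (iso_irr charF0 iW) => //; last exact: capmxSl.
  by apply: sstable_cap => //; apply: iso_stable iW.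
by rewrite -c0 sub_capmx wW.
Qed.

Section Lay.
Variables (L : nat) (e : nat -> 'M[F]_d) (a : nat -> nat).
Hypothesis lay : layered L e a.

(** The common kernel of the x_s is sl(2)-stable and does not contain layer i + 1, which is
    irreducible; so it meets that layer in 0. *)
Lemma lay_Xinj i p (w : 'M[F]_(p, d)) : (i < L)%N ->
  (forall s, w *m e i.+1 *m rX r s = 0) -> w *m e i.+1 = 0.
Proof.
move=> hi h; have iso := lay_iso lay (hi : (i.+1 <= L)%N).
apply: (iso_inj iso kerX_stable); last by apply/sub_kerX.
  have [s hs] := lay_X1 lay hi; apply: contra hs => /sub_kerX h'.
  by rewrite h'.
exact: submxMl.
Qed.

Lemma lay_id i p (w : 'M[F]_(p, d)) : (w <= e i)%MS -> w *m e i = w.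
Proof. exact: (idem_sub (lay_mul lay)). Qed.

Lemma lay_casimir i : e i *m casimir r = casimir r *m e i.
Proof.
have [h1 h2 h3] := lay_comm lay i.
have eEF : e i *m (rE r *m rF r) = rE r *m rF r *m e i.
  by rewrite mulmxA h1 -mulmxA h3 mulmxA.
have eHH : e i *m (rH r *m rH r) = rH r *m rH r *m e i.
  by rewrite mulmxA h2 -mulmxA h2 mulmxA.
by rewrite /casimir !mulmxDr !mulmxDl -!scalemxAr -!scalemxAl eEF eHH h2.
Qed.

Lemma lay_neq0 i : (i <= L)%N -> e i != 0.
Proof. by move=> hi; apply: iso_neq0 (lay_iso lay hi). Qed.

Lemma lay_sstable i : sstable r (e i).
Proof.
by have [h1 h2 h3] := lay_comm lay i; split; rewrite ?h1 ?h2 ?h3 submxMl.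
Qed.

Hypothesis Z0 : rZ r = 0.

Lemma lay_partial_gstable i : gstable r (\sum_(j < i) e j)%MS.
Proof.
have st A : (forall j, (e j *m A <= e j)%MS) -> ((\sum_(j < i) e j)%MS *m A <= \sum_(j < i) e j)%MS.
  move=> h; rewrite sumsmxMr; apply/sumsmx_subP => j _.
  by apply: submx_trans (h _) _; apply: (sumsmx_sup j).
split; try by apply: st => j; have [h1 h2 h3] := lay_sstable j.
  move=> s; rewrite sumsmxMr; apply/sumsmx_subP => -[[|j] hj] _ /=.
    by rewrite (lay_X0 lay) sub0mx.
  rewrite -(lay_X lay); apply: submx_trans (submxMl _ _) _.
  by apply: (sumsmx_sup (Ordinal (ltnW hj))).
by rewrite Z0 mulmx0 sub0mx.
Qed.

Lemma partial_sum_mul i j : (i <= j)%N -> (\sum_(k < i) e k)%MS *m e j = 0.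
Proof.
move=> h; apply/eqP; rewrite -submx0 sumsmxMr; apply/sumsmx_subP => k _.
rewrite (idem_sub0 (lay_mul lay) (submx_refl _)) ?sub0mx //.
by rewrite neq_ltn (leq_trans (ltn_ord k) h).
Qed.

(** An intermediate submodule either meets layer i in 0, and then equals the smaller sum, or
    contains layer i, which is irreducible already under sl(2). *)
Lemma lay_partial_irr i (T : 'M[F]_d) : (i <= L)%N -> (T :=: \sum_(j < i) e j)%MS ->
  irr_over r T (\sum_(j < i.+1) e j)%MS.
Proof.
move=> hi eT.
have sub : (\sum_(j < i) e j <= \sum_(j < i.+1) e j)%MS.
  apply/sumsmx_subP => j _.
  by apply: (sumsmx_sup (widen_ord (leqnSn i) j)).
have ei : (e i <= \sum_(j < i.+1) e j)%MS by apply: (sumsmx_sup ord_max).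
have nei : ~~ (e i <= \sum_(j < i) e j)%MS.
  apply: contra (lay_neq0 hi) => h; rewrite -(lay_id (submx_refl (e i))).
  by rewrite -submx0; apply: submx_trans (submxMr _ h) _; rewrite partial_sum_mul.
split; first exact: lay_partial_gstable.
  rewrite /ltmx !eT sub /=; apply: contra nei => h; exact: submx_trans ei h.
move=> W' [sE sH sF _ _] hT hW.
have sW : sstable r W' by split.
have [c0|cn] := eqVneq (W' :&: e i)%MS 0.
  left; apply/andP; split=> //.
  apply/rV_subP => v vW.
  have sum : (v <= \sum_(j < i) e j + e i)%MS.
    by apply: submx_trans vW _; apply: submx_trans hW _; rewrite big_ord_recr.
  case/sub_addsmxP: sum => -[x y] /= ev.
  have hx : (x *m (\sum_(j < i) e j)%MS <= W')%MS.
    by apply: submx_trans (submxMl _ _) _; rewrite -eT.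
  have : (y *m e i <= W' :&: e i)%MS.
    rewrite sub_capmx submxMl andbT.
    have -> : y *m e i = v - x *m (\sum_(j < i) e j)%MS by rewrite ev addrC addKr.
    by apply: addmx_sub => //; rewrite eqmx_opp.
  rewrite c0 submx0 => /eqP y0; rewrite ev y0 addr0 eT; exact: submxMl.
right; apply/andP; split=> //.
rewrite big_ord_recr /= addsmx_sub -eT hT /=.
apply: submx_trans (capmxSl W' (e i)).
apply: (iso_irr charF0 (lay_iso lay hi)) => //; last exact: capmxSr.
exact: sstable_cap (lay_sstable _).
Qed.

(** The layer projections commute with the Casimir operator, whose eigenvalues on different layers
    differ when the highest weights do. *)
Lemma iso_in_layer (W : 'M[F]_d) k : sl2_iso_V r W k ->
  (forall i j, (i <= L)%N -> (j <= L)%N -> a i = a j -> i = j) ->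
  exists2 j, (j <= L)%N & k = a j /\ (W <= e j)%MS.
Proof.
move=> iW inj.
have hk j : (j <= L)%N -> W *m e j != 0 -> k = a j.
  move=> hj hn.
  have /eigenspaceP h1 := iso_casimir iW.
  have /eigenspaceP h2 : (W *m e j <= eigenspace (casimir r) (a j * a j + 2 * a j)%:R)%MS.
    by apply: submx_trans (submxMl _ _) (iso_casimir (lay_iso lay hj)).
  move: h2; rewrite -mulmxA lay_casimir mulmxA h1 -scalemxAl => /eqP.
  rewrite -subr_eq0 -scalerBl scaler_eq0 (negbTE hn) orbF subr_eq0 => /eqP/(natF_inj charF0).
  by move: (a j) => x; nia.
case: (pickP (fun j : 'I_L.+1 => W *m e j != 0)) => [j hj|h0].
  have jL : (j <= L)%N by rewrite -ltnS.
  exists j => //; split; first exact: hk.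
  rewrite {1}[W](idem_decomp (lay_sum lay)) (bigD1 j) //= big1 ?addr0 ?submxMl // => i hi.
  apply/eqP; apply: contraT => hn; have iL : (i <= L)%N by rewrite -ltnS.
  by case/eqP: hi; apply: val_inj; apply: inj => //; rewrite -(hk _ iL hn) (hk _ jL hj).
have := iso_neq0 iW; rewrite [W](idem_decomp (lay_sum lay)) big1 ?eqxx // => i _.
by apply/eqP/negPn; rewrite h0.
Qed.

(** By induction T i is the sum of the first i layers, so layer i lies in T (i+1) = T i + Vs i. As
    Vs i equals a single layer, projecting to layer i shows that it is this one. Only one inclusion
    for the socle of the quotient is needed, so that socle is never computed. *)
Lemma lay_socle (Vs : nat -> 'M[F]_d) b : socle_decomp r L Vs b ->
  (forall i j, (i <= L)%N -> (j <= L)%N -> a i = a j -> i = j) ->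
  forall i, (i <= L)%N -> b i = a i /\ (Vs i :=: e i)%MS.
Proof.
move=> [isoV _ _ [T [[T0 Tsoc] TV]]] inj.
have ihT i : (i <= L.+1)%N -> (T i :=: \sum_(j < i) e j)%MS /\
    (forall j, (j < i)%N -> b j = a j /\ (Vs j :=: e j)%MS).
  elim: i => [_|i IH hi].
    by split=> //; rewrite big_ord0; apply/eqmxP.
  have [eT IHV] := IH (ltnW hi).
  have irr := lay_partial_irr (hi : (i <= L)%N) eT.
  have sub : (\sum_(j < i.+1) e j <= T i.+1)%MS by apply: (proj1 (Tsoc i)).
  have eT' : (T i.+1 :=: T i + Vs i)%MS.
    apply: eqmx_trans (eqmxP (TV i hi)) _; rewrite big_ord_recr /=.
    apply: adds_eqmx => //; apply: eqmx_trans _ (eqmx_sym eT).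
    apply/eqmxP/andP; split; apply/sumsmx_subP => j _; rewrite (sumsmx_sup j) //;
    by case: (IHV j (ltn_ord j)) => _ ->.
  have iV := isoV i hi.
  have nei : ~~ (e i <= T i)%MS.
    apply: contra (lay_neq0 (hi : (i <= L)%N)) => h; rewrite -(lay_id (submx_refl (e i))).
    rewrite eT in h.
    by rewrite -submx0; apply: submx_trans (submxMr _ h) _; rewrite partial_sum_mul.
  have ei : (e i <= T i + Vs i)%MS.
    by rewrite -eT'; apply: submx_trans sub; apply: (sumsmx_sup ord_max).
  have [j jL [bj Vj]] := iso_in_layer iV inj.
  have ej : (e j <= Vs i)%MS.
    by apply: (iso_irr charF0 (lay_iso lay jL)) => //; [exact: iso_stable iV|exact: iso_neq0 iV].
  have eVj : (Vs i :=: e j)%MS by apply/eqmxP; rewrite Vj.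
  have ij : j = i.
    apply/eqP; apply: contraT => hij.
    have := submxMr (e i) ei; rewrite (lay_id (submx_refl (e i))) addsmxMr.
    have -> : T i *m e i = 0.
      apply/eqP; rewrite -submx0 (eqmxMr _ eT) partial_sum_mul ?sub0mx //.
    have -> : Vs i *m e i = 0.
      apply/eqP; rewrite -submx0; apply: submx_trans (submxMr _ Vj) _.
      by rewrite (lay_mul lay) (negbTE hij) sub0mx.
    by rewrite adds0mx submx0 (negbTE (lay_neq0 _)).
  subst j; split.
    apply: eqmx_trans eT' _; rewrite big_ord_recr /=; exact: adds_eqmx.
  by move=> j; rewrite ltnS leq_eqVlt => /orP[/eqP ->|/IHV].
by move=> i hi; apply: (proj2 (ihT i.+1 hi)).
Qed.

End Lay.
End Modules.
End Layers.

(** * Layers of modules of type Z, of their duals and of faithful modules *)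

Section LayerExistence.
Variable F : fieldType.
Hypothesis charF0 : [pchar F] =i pred0.

Lemma ent_lmulVE q k (U : 'M[F]_(k.+1, q)) i j : (i <= k)%N ->
  ent (VE F k *m U) i j = if i is i'.+1 then (k - i')%:R * ent U i' j else 0.
Proof.
move=> hi; case: (ltnP j q) => hj; last by rewrite ent_outr //; case: i {hi} => [|i]; rewrite ?ent_outr ?mulr0.
rewrite (ent_in _ (hi : (i < k.+1)%N) hj) mxE.
case: i hi => [|i] hi; first by rewrite big1 // => s _; rewrite !mxE /= mul0r.
have h1 : (i < k.+1)%N by apply: leq_trans hi _.
rewrite (bigD1 (Ordinal h1)) //= big1 ?addr0 => [|s hs].
  by rewrite !mxE /= eqxx (ent_in _ h1 hj).
rewrite !mxE /=; case: eqP => e; last by rewrite mul0r.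
by case/eqP: hs; apply: val_inj; case: e.
Qed.

Lemma ent_lmulVF q k (U : 'M[F]_(k.+1, q)) i j : (i <= k)%N ->
  ent (VF F k *m U) i j = i.+1%:R * ent U i.+1 j.
Proof.
move=> hi; case: (ltnP j q) => hj; last by rewrite !ent_outr // mulr0.
rewrite (ent_in _ (hi : (i < k.+1)%N) hj) mxE.
case: (ltnP i k) => hi'; last first.
  rewrite ent_outl // mulr0 big1 // => s _; rewrite !mxE /=; case: eqP => e; last by rewrite mul0r.
  by have := ltn_ord s; rewrite e ltnS ltnNge hi'.
rewrite (bigD1 (Ordinal (hi' : (i.+1 < k.+1)%N))) //= big1 ?addr0 => [|s hs].
  by rewrite !mxE /= eqxx (ent_in _ (hi' : (i.+1 < k.+1)%N) hj).
by rewrite !mxE /= (negbTE (_ : s != i.+1 :> nat)) ?mul0r.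
Qed.

Lemma VH_tr k : (VH F k)^T = VH F k.
Proof.
apply/matrixP => i j; rewrite !mxE eq_sym; case: eqP => // e; congr (_ - _).
by rewrite -(val_inj e).
Qed.

Lemma ent_lmulVH q k (U : 'M[F]_(k.+1, q)) i j :
  ent (VH F k *m U) i j = (k%:R - (2 * i)%:R) * ent U i j.
Proof. by rewrite -VH_tr ent_VHmul. Qed.

(* The invariant bilinear form of V(k), i.e. the isomorphism of V(k) with its dual. *)
Definition Vform k : 'M[F]_k.+1 :=
  \matrix_(i, j) (if (i + j == k)%N then (-1) ^+ i * 'C(k, i)%:R else 0).

Lemma ent_Vform k i j : (i <= k)%N -> (j <= k)%N ->
  ent (Vform k) i j = if (i + j == k)%N then (-1) ^+ i * 'C(k, i)%:R else 0.
Proof. by move=> hi hj; rewrite (ent_in _ (hi : (i < k.+1)%N) (hj : (j < k.+1)%N)) mxE. Qed.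

Lemma Vform_dual k : [/\ VE F k *m Vform k = - (Vform k *m (VE F k)^T),
  VH F k *m Vform k = - (Vform k *m (VH F k)^T) &
  VF F k *m Vform k = - (Vform k *m (VF F k)^T)].
Proof.
have tr (A : 'M[F]_k.+1) i j : ent (Vform k *m A^T) i j = ent (A *m (Vform k)^T) j i.
  by rewrite -ent_tr trmx_mul trmxK.
have hb i : (i.+1 <= k)%N -> i.+1%:R * 'C(k, i.+1)%:R = (k - i)%:R * 'C(k, i)%:R :> F.
  by move=> hi; rewrite -!natrM mul_bin_left.
split; apply: entP => i j hi hj; rewrite -scaleN1r entZ tr.
- rewrite !ent_lmulVE //; case: i j hi hj => [|i] [|j] hi hj; rewrite ?mulr0 // ?ent_tr.
  + by rewrite ent_Vform //; [case: eqP => e; rewrite ?mulr0 //; lia|lia].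
  + by rewrite ent_Vform //; [case: eqP => e; rewrite ?mulr0 //; lia|lia].
  rewrite !ent_Vform ?addnS //; try lia.
  rewrite addSn; case: eqP => e; last by rewrite !mulr0.
  rewrite (_ : k - j = i.+1)%N; last by lia.
  by rewrite mulrCA -hb ?exprS; [ring|lia].
- rewrite !ent_lmulVH ent_tr ent_Vform //; case: eqP => e; last by rewrite !mulr0.
  have ek : k%:R = i%:R + j%:R :> F by rewrite -natrD e.
  by rewrite ek !natrM; ring.
- rewrite !ent_lmulVF // ent_tr.
  case: (ltnP i k) => hik; last first.
    rewrite ent_outl // mulr0; case: (ltnP j k) => hjk; last by rewrite ent_outr ?mulr0.
    by rewrite ent_Vform //; case: eqP => e; rewrite ?mulr0 //; lia.
  case: (ltnP j k) => hjk; last first.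
    rewrite [ent _ i j.+1]ent_outr // !mulr0 ent_Vform //.
    by case: eqP => e; rewrite ?mulr0 //; lia.
  rewrite !ent_Vform // addSn addnS; case: eqP => e; last by rewrite !mulr0.
  rewrite (_ : j.+1 = k - i)%N; last by lia.
  by rewrite mulrCA hb // exprS; ring.
Qed.

Lemma Vform_neq0 k : Vform k != 0.
Proof.
apply/eqP => h; have := @ent_Vform k 0 k (leq0n _) (leqnn _).
rewrite h ent0 add0n eqxx expr0 bin0 mul1r => /esym/eqP; by rewrite oner_eq0.
Qed.

(** * Dual modules, and the grading of modules of type Z *)

Section Dual.
Variables (n d : nat).

(** Write g = R P with P R = 1. The rows of R^T are the basis dual to the rows of P, they span the
    image of g^T, and [Vform] converts them into a standard basis of V(k). *)
Lemma iso_dual (r : grep F n d) (g : 'M[F]_d) k :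
  g *m g = g -> sl2comm r g -> sl2_iso_V r g k -> sl2_iso_V (dual_rep r) g^T k.
Proof.
move=> gg [gE gH gF] [P [fP /eqmxP eP hE hH hF]].
have /submxP[R hR] : (g <= P)%MS by rewrite eP.
have Pg : P *m g = P by apply/esym; have /submxP[c ->] : (P <= g)%MS; rewrite ?eP // -mulmxA gg.
have PR : P *m R = 1%:M.
  by apply: (row_free_inj fP); rewrite mul1mx -mulmxA -hR.
have RA A B : A *m P = P *m B -> g *m B = B *m g -> R *m A = B *m R.
  by move=> h1 h2; apply: (row_free_inj fP); rewrite -!mulmxA h1 -hR mulmxA -hR h2.
have [sE sH sF] := Vform_dual k.
pose Q := Vform k *m R^T.
have RP : R^T *m P^T = 1%:M by rewrite -trmx_mul PR trmx1.
have Q0 : Q != 0.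
  apply: contraNneq (Vform_neq0 k) => h.
  by rewrite -[Vform k]mulmx1 -RP mulmxA -/Q h mul0mx.
have sQ : sl2in (dual_rep r) Q.
  have gen A B : R *m A = B *m R -> A *m Vform k = - (Vform k *m A^T) -> A *m Q = Q *m - B^T.
    by move=> h1 h2; rewrite /Q mulmxA h2 mulNmx mulmxN -!mulmxA -!trmx_mul h1.
  by split; apply: gen => //; apply: RA.
have iQ := sl2in_iso charF0 sQ Q0.
have := iso_rank iQ; rewrite genmxE => rQ.
apply: iso_eqmx iQ; apply: eqmx_trans (genmxE _) _.
have eR : (R^T :=: g^T)%MS.
  apply/eqmxP/andP; split; last by rewrite hR trmx_mul submxMl.
  by rewrite -[R^T]mul1mx -RP -mulmxA -trmx_mul -hR submxMl.
apply: eqmx_trans _ eR; apply/eqmxP; rewrite submxMl /=.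
have le : (Q <= R^T)%MS by apply: submxMl.
by rewrite -(geq_leqif (mxrank_leqif_sup le)) rQ rank_leq_row.
Qed.

(** Transposition reverses the order of the layers. The explicit 0 beyond L is required because
    truncated subtraction would return layer 0 again. *)
Lemma layered_dual (r : grep F n d) L e a : layered r L e a ->
  layered (dual_rep r) L (fun i => if (i <= L)%N then (e (L - i)%N)^T else 0)
    (fun i => a (L - i)%N).
Proof.
move=> lay; split.
- move=> i j; case: (leqP i L) => hi; last by rewrite mul0mx if_same.
  case: (leqP j L) => hj.
    rewrite -trmx_mul (lay_mul lay) (_ : (L - j == L - i)%N = (i == j)); last by lia.
    by case: eqP => [->|] //; rewrite trmx0.
  by rewrite mulmx0 (_ : (i == j) = false) //; apply/negbTE; lia.
- rewrite -[RHS]trmx1 -(lay_sum lay) linear_sum /= (reindex_inj rev_ord_inj) /=.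
  apply: eq_bigr => i _; have hi : (i <= L)%N by rewrite -ltnS.
  by rewrite subSS leq_subr subKn.
- by move=> i hi; rewrite leqNgt hi.
- move=> i; case: ifP => hi; last by split; rewrite mul0mx mulmx0.
  have [h1 h2 h3] := lay_comm lay (L - i).
  by split; rewrite /= mulmxN mulNmx -!trmx_mul ?h1 ?h2 ?h3.
- move=> i hi; rewrite hi; apply: iso_dual; last by apply: (lay_iso lay); lia.
    by rewrite (lay_mul lay) eqxx.
  exact: (lay_comm lay).
- by move=> s /=; rewrite subn0 mulmxN -trmx_mul (lay_X lay) (lay_out lay) // mul0mx trmx0 oppr0.
- move=> i s /=; case: (ltnP i L) => hi.
    rewrite (ltnW hi) mulNmx mulmxN -!trmx_mul (lay_X lay) -subSn //.
  rewrite [X in _ = X]mul0mx; case: ifP => hi'; last by rewrite mulmx0.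
  by rewrite (_ : L - i = 0)%N ?mulNmx -?trmx_mul ?(lay_X0 lay) ?trmx0 ?oppr0 //; lia.
- move=> i hi; have hi' : (L - i.+1 < L)%N by lia.
  have [s hs] := lay_X1 lay hi'; exists s.
  by rewrite hi /= mulmxN -trmx_mul (lay_X lay) oppr_eq0 trmx_eq0.
Qed.

Lemma layered_iso (r r' : grep F n d) L e a : rep_iso r r' -> layered r' L e a ->
  exists f, layered r L f a.
Proof.
move=> [P [uP hE hH hF [hX _]]] lay.
pose f i := P *m e i *m invmx P; exists f.
have conj A A' : A *m P = P *m A' -> A = P *m A' *m invmx P.
  by move=> h; rewrite -h mulmxK.
have fM A B : P *m A *m invmx P *m (P *m B *m invmx P) = P *m (A *m B) *m invmx P.
  by rewrite !mulmxA mulmxKV.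
have inj A : P *m A *m invmx P = 0 -> A = 0.
  move=> h; have := congr1 (fun M => invmx P *m M *m P) h.
  by rewrite !mulmxA mulVmx // mul1mx mulmxKV // mulmx0 mul0mx.
have f0 : P *m 0 *m invmx P = 0 by rewrite mulmx0 mul0mx.
have comm i : sl2comm r (f i).
  have [h1 h2 h3] := lay_comm lay i.
  by split; [rewrite (conj _ _ hE)|rewrite (conj _ _ hH)|rewrite (conj _ _ hF)]; rewrite !fM ?h1 ?h2 ?h3.
split=> //.
- by move=> i j; rewrite fM (lay_mul lay); case: eqP.
- by rewrite -mulmx_suml -mulmx_sumr (lay_sum lay) mulmx1 mulmxV.
- by move=> i hi; rewrite /f (lay_out lay) // f0.
- move=> i hi; have [Q [fQ /eqmxP eQ qE qH qF]] := lay_iso lay hi.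
  exists (Q *m invmx P); split.
  + apply/row_freeP; have /row_freeP[Q' hQ'] := fQ; exists (P *m Q').
    by rewrite mulmxA mulmxKV.
  + apply/eqmxP; apply: eqmx_trans (eqmxMr _ eQ) _; apply: eqmxMr.
    apply: eqmx_sym; apply: eqmxMfull; by rewrite row_full_unit.
  + by rewrite mulmxA qE (conj _ _ hE) !mulmxA mulmxKV.
  + by rewrite mulmxA qH (conj _ _ hH) !mulmxA mulmxKV.
  + by rewrite mulmxA qF (conj _ _ hF) !mulmxA mulmxKV.
- by move=> s; rewrite (conj _ _ (hX s)) fM (lay_X0 lay) f0.
- by move=> i s; rewrite (conj _ _ (hX s)) !fM (lay_X lay).
- move=> i hi; have [s hs] := lay_X1 lay hi; exists s.
  by apply: contraNneq hs; rewrite (conj _ _ (hX s)) fM => /inj ->.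
Qed.

Lemma isZ_layered (r : grep F n d) al L : isZ r al L ->
  exists e, layered r L e (fun i => al + i * mdeg n)%N.
Proof.
move=> [Ws [isoW dx full Z0 [X0 X1]]].
have [e [eM esum eout eW]] := direct_idempotents dx full.
have isoe i : (i <= L)%N -> sl2_iso_V r (e i) (al + i * mdeg n).
  by move=> hi; apply: iso_eqmx (eqmx_sym (eW i hi)) (isoW i hi).
have e0 s : e 0%N *m rX r s = 0.
  by apply/eqP; rewrite -submx0 (eqmxMr _ (eW 0%N _)) // X0 sub0mx.
exists e; split=> //.
- move=> i; have comm A : (forall j, (j <= L)%N -> (e j *m A <= e j)%MS) -> e i *m A = A *m e i.
    by move=> h; apply: (idem_comm eM esum eout h).
  by split; apply: comm => j hj; have [h1 h2 h3] := iso_stable (isoe j hj).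
- move=> i s; apply: (idem_shift eM esum eout) => // j hj.
  rewrite (eqmxMr _ (eW _ hj)) (eW _ (ltnW hj)).
  by have [h _] := X1 j.+1 hj; apply: h.
- move=> i hi; have [_ [s hs]] := X1 i.+1 hi; exists s.
  by apply: contraNneq hs => h; rewrite -submx0 -(eqmxMr _ (eW i.+1 hi)) h.
Qed.

Lemma isZdual_layered (r : grep F n d) al L : isZdual r al L ->
  exists e, layered r L e (fun i => al + (L - i) * mdeg n)%N.
Proof.
move=> [r' [_ /isZ_layered[e lay] iso]].
exact: layered_iso iso (layered_dual lay).
Qed.

Lemma isZ_Z0 (r : grep F n d) al L : isZ r al L -> rZ r = 0.
Proof. by case=> Ws []. Qed.

Lemma isZdual_Z0 (r : grep F n d) al L : isZdual r al L -> rZ r = 0.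
Proof.
move=> [r' [_ [Ws [_ _ _ Z0 _]] [P [uP _ _ _ [_ hZ]]]]].
by rewrite -[rZ r](mulmxK uP) hZ /= Z0 trmx0 oppr0 mulmx0 mul0mx.
Qed.

End Dual.

(** * Weights and parity constraints on the action of h_n(m) *)

Section Weights.
Variables (n d : nat) (r : grep F n d).
Hypothesis rep : is_rep r.
Local Notation m := (mdeg n).

(** x_s has weight m - 2s, so a nonzero entry needs (k - 2i) + (m - 2s) = c - 2j; the equation is
    stated without subtraction. In the uses, A is a layer projection or the identity. *)
Lemma coord_weight k c (P : 'M[F]_(k.+1, d)) (Q : 'M[F]_(c.+1, d)) (N : 'M[F]_(k.+1, c.+1)) A s :
  sl2in r P -> sl2in r Q -> row_free Q -> A *m rH r = rH r *m A ->
  P *m rX r s *m A = N *m Q -> forall i j, ent N i j != 0 -> (k + 2 * j + m = c + 2 * i + 2 * s)%N.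
Proof.
move=> [_ PH _] [_ QH _] fQ cA eN i j hn.
have hi : (i < k.+1)%N by rewrite ltnNge; apply: contra hn => h; rewrite ent_outl.
apply: (natF_inj charF0) => /=.
have e : VH F k *m N = N *m VH F c - (m%:R - (2 * s)%:R) *: N.
  apply: (row_free_inj fQ); rewrite mulmxBl -scalemxAl -!mulmxA -eN QH.
  rewrite (mulmxA N) -eN !mulmxA PH -(mulmxA P) (rep_HX rep) mulmxBr mulmxBl.
  by rewrite -scalemxAr -scalemxAl -!mulmxA cA.
have := congr1 (fun M => ent M i j) e.
rewrite /= -!scaleN1r !(entD, entZ) ent_lmulVH ent_mulVH.
rewrite mulrA -mulrDl => /(mulIf hn) e'.
rewrite !natrD -[k%:R](subrK (2 * i)%:R) e' !natrM; ring.
Qed.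

Lemma parity (V W : 'M[F]_d) k c A s :
  sl2_iso_V r V k -> sl2_iso_V r W c -> A *m rH r = rH r *m A ->
  (V *m rX r s *m A <= W)%MS -> V *m rX r s *m A != 0 -> ~~ odd (k + c + m).
Proof.
move=> [P [fP /eqmxP eP PE PH PF]] [Q [fQ /eqmxP eQ QE QH QF]] cA.
rewrite -eQ => hsub hn.
have : (P *m rX r s *m A <= Q)%MS.
  by apply: submx_trans hsub; rewrite -!mulmxA; apply: submxMr; rewrite eP.
case/submxP => N hN.
have N0 : N != 0.
  apply: contraNneq hn => N0; rewrite -mxrank_eq0 -mulmxA -(eqmxMr _ eP) mulmxA hN N0 mul0mx.
  by rewrite mxrank0.
have [i [j [_ _ hij]]] := ent_neq0 N0.
have := @coord_weight k c P Q N A s _ _ fQ cA hN i j hij.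
move=> h; have {h} := h (And3 PE PH PF) (And3 QE QH QF); lia.
Qed.

End Weights.

Section Faithful.
Variables (n d : nat) (r : grep F n d).
Hypothesis n_gt0 : (0 < n)%N.
Hypothesis rep : is_rep r.
Hypothesis faith : faithful r.

Lemma mdeg_odd : odd (mdeg n).
Proof. by rewrite /mdeg; case: (n) n_gt0 => // k _; rewrite doubleS /= odd_double. Qed.

Lemma faithful_Z : rZ r != 0.
Proof.
apply/eqP => h; have := faith (cE := 0) (cH := 0) (cF := 0) (cX := fun=> 0) (cZ := 1).
rewrite !scale0r h scaler0 big1 ?addr0 => [h'|i _]; last by rewrite scale0r.
by have [_ _ _ _ /eqP] := h' erefl; rewrite oner_eq0.
Qed.

Lemma gstable_adds (A B : 'M[F]_d) : gstable r A -> gstable r B -> gstable r (A + B)%MS.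
Proof.
move=> [h1 h2 h3 h4 h5] [g1 g2 g3 g4 g5]; split; try (move=> s); by rewrite addsmxMr addsmxS.
Qed.

Lemma gstable_eqmx (A B : 'M[F]_d) : (A :=: B)%MS -> gstable r A -> gstable r B.
Proof.
move=> e [h1 h2 h3 h4 h5]; split; try (move=> s); by rewrite -(eqmxMr _ e) -e.
Qed.

Lemma socle_gstable T : socle_series r T -> forall i, gstable r (T i).
Proof.
move=> [T0 Ts]; elim=> [|i IH].
  apply: (gstable_eqmx (A := 0)); first by apply/eqmx_sym/eqmxP.
  by split; try (move=> s); rewrite mul0mx.
have [_ [s [hs /eqmxP es]]] := Ts i; apply: gstable_eqmx es _.
apply: gstable_adds => //.
elim: s hs => [|W s IHs] hs; first by rewrite big_nil; split; try (move=> t); rewrite mul0mx.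
rewrite big_cons; apply: gstable_adds => //; first by have [] := hs W (mem_head _ _).
by apply: IHs => X hX; apply: hs; rewrite inE hX orbT.
Qed.

(* m is odd, so h_n(m) reverses the parity of weights; as [h_n(m), h_n(m)] = Fz
   acts nontrivially, the parities of the three layers must alternate. *)
Lemma faithful_layered Vs a : socle_decomp r 2 Vs a -> exists e,
  [/\ layered r 2 e a, forall i, (i <= 2)%N -> (Vs i :=: e i)%MS,
      e 0%N *m rZ r = 0, e 1%N *m rZ r = 0 & ~~ (e 2%N <= kermx (rZ r))%MS].
Proof.
move=> [isoV dx full [T [sT TV]]].
have [e [eM esum eout eV]] := direct_idempotents dx full.
have isoe i : (i <= 2)%N -> sl2_iso_V r (e i) (a i).
  by move=> hi; apply: iso_eqmx (eqmx_sym (eV i hi)) (isoV i hi).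
have comm i : sl2comm r (e i).
  have comm A : (forall j, (j <= 2)%N -> (e j *m A <= e j)%MS) -> e i *m A = A *m e i.
    by move=> h; apply: (idem_comm eM esum eout h).
  by split; apply: comm => j hj; have [h1 h2 h3] := iso_stable (isoe j hj).
have decomp p (w : 'M_(p, d)) : w = w *m e 0%N + w *m e 1%N + w *m e 2%N.
  by rewrite {1}[w](idem_decomp esum) !big_ord_recr big_ord0 /= add0r.
have par i j s : (i <= 2)%N -> (j <= 2)%N -> e i *m rX r s *m e j != 0 -> ~~ odd (a i + a j + mdeg n).
  move=> hi hj hn; apply: (parity rep (isoe i hi) (isoe j hj)) hn; last exact: submxMl.
  by have [_ h _] := comm j.
(* A component from a layer to itself would require 2 a_i + m to be even. *)
have par0 i s : (i <= 2)%N -> e i *m rX r s *m e i = 0.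
  by move=> hi; apply/eqP; apply: contraT => /(par i i s hi hi); rewrite oddD addnn odd_double mdeg_odd.
(* The socle filtration consists of submodules, so x_s never maps a layer to a higher one. *)
have Tsub i j k s : (i <= j)%N -> (j <= 2)%N -> (j < k)%N -> (e i *m rX r s) *m e k = 0.
  move=> ij hj jk.
  have hT : (T j.+1 :=: \sum_(l < j.+1) e l)%MS.
    apply: eqmx_trans (eqmxP (TV j hj)) _; apply/eqmxP/andP; split; apply/sumsmx_subP => l _;
    rewrite (sumsmx_sup l) // ?eV //; exact: leq_trans (ltn_ord l : (l <= j)%N) hj.
  have [_ _ _ hX _] := socle_gstable sT j.+1.
  have h1 : (e i *m rX r s <= \sum_(l < j.+1) e l)%MS.
    rewrite -hT; apply: submx_trans (hX s); apply: submxMr; rewrite hT.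
    by apply: (sumsmx_sup (Ordinal (ij : (i < j.+1)%N))).
  apply/eqP; rewrite -submx0; apply: submx_trans (submxMr _ h1) _.
  rewrite sumsmxMr; apply/sumsmx_subP => l _.
  rewrite (idem_sub0 eM (submx_refl _)) ?sub0mx //.
  by rewrite neq_ltn (leq_trans (ltn_ord l) jk).
have X0 s : e 0%N *m rX r s = 0.
  by rewrite [LHS]decomp par0 // (Tsub 0%N 0%N 1%N) // (Tsub 0%N 0%N 2%N) // !addr0.
have X1 s : e 1%N *m rX r s = e 1%N *m rX r s *m e 0%N.
  by rewrite {1}[LHS]decomp par0 // (Tsub 1%N 1%N 2%N) // !addr0.
have lbrZ A : A *m rZ r = A *m rX r ord_max *m rX r ord0 - A *m rX r ord0 *m rX r ord_max.
  by rewrite (rep_ZX rep) /lbr mulmxBr !mulmxA.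
have Z0 : e 0%N *m rZ r = 0 by rewrite lbrZ !X0 !mul0mx subrr.
have Z1 : e 1%N *m rZ r = 0.
  by rewrite lbrZ (X1 ord_max) (X1 ord0) -!mulmxA !X0 !mulmx0 subrr.
have Z2 : e 2%N *m rZ r != 0.
  apply: contraNneq faithful_Z => Z2; rewrite -[rZ r]mul1mx -esum !mulmx_suml.
  by rewrite !big_ord_recr big_ord0 /= Z0 Z1 Z2 !addr0.
(* As z is a commutator of elements of h_n(m), some product of two of them is nonzero on layer 2. It
   must pass through layer 1, because layer 0 is killed. *)
have [s [t st]] : exists s t, e 2%N *m rX r s *m rX r t != 0.
  move: Z2; rewrite lbrZ.
  have [-> |h] := eqVneq (e 2%N *m rX r ord_max *m rX r ord0) 0.
    by rewrite sub0r oppr_eq0 => h; exists ord0, ord_max.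
  by exists ord_max, ord0.
have h21 : e 2%N *m rX r s *m e 1%N *m rX r t != 0.
  apply: contraNneq st => h; rewrite [e 2%N *m rX r s]decomp par0 // addr0 mulmxDl h addr0.
  by rewrite -mulmxA X0 mulmx0.
have n21 : e 2%N *m rX r s *m e 1%N != 0 by apply: contraNneq h21 => ->; rewrite mul0mx.
have n1 : e 1%N *m rX r t != 0.
  by apply: contraNneq h21 => h; rewrite -mulmxA h mulmx0.
have o21 : ~~ odd (a 2%N + a 1%N + mdeg n) by apply: par n21.
have o10 : ~~ odd (a 1%N + a 0%N + mdeg n) by apply: (par 1%N 0%N t) => //; rewrite -X1.
have X2 u : e 2%N *m rX r u = e 2%N *m rX r u *m e 1%N.
  rewrite {1}[LHS]decomp par0 // addr0.
  suff -> : e 2%N *m rX r u *m e 0%N = 0 by rewrite add0r.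
  apply/eqP; apply: contraT => /(par 2%N 0%N u isT isT).
  by move: o21 o10; rewrite !oddD mdeg_odd; do 3!case: (odd _).
exists e; split=> //.
- split=> //.
  + move=> i u; apply: (idem_shift eM esum eout) => // -[|[|j]] // _.
      by rewrite X1 submxMl.
    by rewrite X2 submxMl.
  + move=> [|[|j]] // _; first by exists t.
    by exists s; rewrite X2.
- by move=> i hi; apply: eqmx_sym; apply: eV.
- by apply: contra Z2 => /sub_kermxP ->.
Qed.

End Faithful.
End LayerExistence.

(** * The linear equations for highest weight vectors of S_1 *)

Section Solutions.
Variable F : fieldType.
Hypothesis charF0 : [pchar F] =i pred0.

(** The first hypothesis expresses that x_m, the lowest weight vector of h_n(m), commutes with f. It
    gives (i+1) M(i+1, i+1+del) = (i+1+del) M(i, i+del), whose solutions are multiples of binomial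
    coefficients. *)
Lemma shift_coef k c (M : 'M[F]_(k.+1, c.+1)) del :
  VF F k *m M = M *m VF F c -> M != 0 ->
  (forall i j, ent M i j != 0 -> j = (i + del)%N) ->
  [/\ (del <= c)%N, ent M 0 del != 0 &
      forall i, (i <= k)%N -> (i + del <= c)%N ->
        ent M i (i + del) = ent M 0 del * 'C(i + del, del)%:R].
Proof.
move=> hF M0 supp.
have rel i : (i <= k)%N -> (i + del <= c)%N ->
    ent M i (i + del) = ent M 0 del * 'C(i + del, del)%:R.
  elim: i => [|i IH] hi hc; first by rewrite add0n binn mulr1.
  have := congr1 (fun A => ent A i (i.+1 + del)) hF.
  rewrite ent_lmulVF ?ent_mulVF ?(ltnW hi) // addSn /= (IH (ltnW hi) (ltnW hc)) => e.
  apply: (mulfI (natS_neq0 charF0 i)); rewrite e mulrCA [RHS]mulrCA; congr (_ * _).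
  rewrite -!natrM; congr (_%:R).
  have sym t : 'C(t + del, del) = 'C(t + del, t).
    by rewrite -[RHS]bin_sub ?leq_addr // addKn.
  by rewrite -!addSn !sym -mul_bin_diag addSn.
have h0 : ent M 0 del != 0.
  apply: contraNneq M0 => h; apply/eqP/entP => i j hi hj; rewrite ent0.
  apply/eqP; apply: contraT => hn; have e := supp _ _ hn; subst j.
  by rewrite rel ?h ?mul0r ?eqxx in hn.
split=> //; rewrite -ltnS ltnNge; apply: contra h0 => h; by rewrite ent_outr.
Qed.

Lemma shift_mulr p k c (M : 'M[F]_(k.+1, c.+1)) del (A : 'M[F]_(p, k.+1)) i j :
  (forall i j, ent M i j != 0 -> j = (i + del)%N) ->
  ent (A *m M) i j = if (del <= j)%N then ent M (j - del) j * ent A i (j - del) else 0.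
Proof.
move=> supp; case: (ltnP i p) => hi; last by rewrite (ent_outl _ _ hi) (ent_outl A _ hi) mulr0 if_same.
case: (ltnP j c.+1) => hj; last first.
  by rewrite ent_outr //; case: ifP => // _; rewrite ent_outr ?mul0r.
rewrite (ent_in _ hi hj) mxE.
have z (s : 'I_k.+1) : j <> (s + del)%N -> A (Ordinal hi) s * M s (Ordinal hj) = 0.
  move=> h; rewrite -(entE M) /=; case: (eqVneq (ent M s j) 0) => [->|/supp//].
  by rewrite mulr0.
case: (leqP del j) => hd; last by rewrite big1 // => s _; apply: z; lia.
case: (ltnP (j - del) k.+1) => hs.
  rewrite (bigD1 (Ordinal hs)) //= big1 ?addr0 => [|s hne].
    by rewrite (ent_in _ hs hj) (ent_in _ hi hs) mulrC.
  apply: z => e; case/eqP: hne; apply: val_inj => /=; lia.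
rewrite ent_outl // mul0r big1 // => s _; apply: z => e.
by have := ltn_ord s; rewrite ltnNge; case/negP; lia.
Qed.

(* For i in {1, 2} the operator x_m maps the s-th basis vector of the second layer
   of V_i to mu 'C(s + del, del) times the (s + del)-th basis vector of its socle
   (nu and del' for i = 2). The pair (c, d) stands for an element of
   V(a0) (x) V(b1) + V(a1) (x) V(b0); the last condition says that x_m kills it. *)
Definition hw_solution (a0 a1 b0 b1 del del' : nat) (mu nu : F)
    (c : 'M[F]_(a0.+1, b1.+1)) (d : 'M[F]_(a1.+1, b0.+1)) (k : nat) : Prop :=
  [/\ tens_hw c k%:R, tens_hw d k%:R &
    forall i j, (i <= a0)%N -> (j <= b0)%N ->
      (if (del <= i)%N then mu * 'C(i, del)%:R * ent d (i - del) j else 0) +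
      (if (del' <= j)%N then nu * 'C(j, del')%:R * ent c i (j - del') else 0) = 0].

Lemma tens_hw_tr a b (c : 'M[F]_(a.+1, b.+1)) k : tens_hw c k -> tens_hw c^T k.
Proof.
move=> [h1 h2]; split; rewrite addrC.
  by rewrite -[c^T *m _]trmxK -[(VE F b)^T *m _]trmxK -linearD /= !trmx_mul !trmxK h1 trmx0.
rewrite -[c^T *m _]trmxK -[(VH F b)^T *m _]trmxK -linearD /= !trmx_mul !trmxK h2.
by rewrite linearZ.
Qed.

Section Arith.
Variables (a0 a1 b0 b1 del del' : nat) (mu nu : F).
Hypotheses (mu0 : mu != 0) (nu0 : nu != 0).
Local Notation sol := (@hw_solution a0 a1 b0 b1 del del' mu nu).

(** Transposing coefficient matrices exchanges the two tensor factors. *)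
Lemma sol_swap c d k : sol c d k -> @hw_solution b0 b1 a0 a1 del' del nu mu d^T c^T k.
Proof.
move=> [hc hd h]; split; try exact: tens_hw_tr.
by move=> i j hi hj; rewrite !ent_tr addrC; apply: h.
Qed.

(** In row i = del the binomial coefficient is 1, so the equations with c = 0 kill row 0 of d. *)
Lemma sol_c0 c d k : (del <= a0)%N -> sol c d k -> c = 0 -> d = 0.
Proof.
move=> ha [hc hd h] c0; apply: (hw_border charF0 hd) => j.
case: (leqP j b0) => hj; last by rewrite ent_outr.
have := h del j ha hj; rewrite leqnn c0 ent0 mulr0 if_same addr0 binn mulr1 subnn => /eqP.
by rewrite mulf_eq0 (negbTE mu0) => /eqP.
Qed.

End Arith.

Section Cases.
Variables (a0 a1 b0 b1 m : nat) (mu nu : F).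
Hypotheses (mu0 : mu != 0) (nu0 : nu != 0) (m_gt0 : (0 < m)%N).

Lemma bin_neq0 i j : (j <= i)%N -> 'C(i, j)%:R != 0 :> F.
Proof. by move=> h; rewrite natF_eq0 // -lt0n bin_gt0. Qed.

Lemma sol_d_neq0 del del' c d k : (del' <= b0)%N ->
  @hw_solution a0 a1 b0 b1 del del' mu nu c d k -> c != 0 -> d != 0.
Proof.
move=> hb hs; apply: contraNneq => d0.
have := sol_c0 nu0 hb (sol_swap hs); rewrite d0 trmx0 => /(_ erefl) h.
by rewrite -[c]trmxK h trmx0.
Qed.

(** Each of c and d lives on one antidiagonal, s and s'. Both have weight k, and comparing a0 + b1
    with a1 + b0 gives s - s' = del - del'. *)
Lemma sol_level del del' c d k : (a0 + m = a1 + 2 * del)%N -> (b0 + m = b1 + 2 * del')%N ->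
  (del' <= b0)%N ->
  @hw_solution a0 a1 b0 b1 del del' mu nu c d k -> c != 0 ->
  exists s s', [/\ (a0 + b1 = k + 2 * s)%N, (s + del' = s' + del)%N,
    [/\ (s <= a0)%N, (s <= b1)%N & forall i j, (i + j = s)%N -> ent c i j != 0] &
    [/\ (s' <= a1)%N, (s' <= b0)%N & forall i j, (i + j = s')%N -> ent d i j != 0]].
Proof.
move=> ea eb hb hs c0; have d0 := sol_d_neq0 hb hs c0.
case: (hs) => hc hd _.
have [i [j [_ _ hij]]] := ent_neq0 c0; have es := hw_supp charF0 hc hij.
have [i' [j' [_ _ hij']]] := ent_neq0 d0; have es' := hw_supp charF0 hd hij'.
exists (i + j)%N, (i' + j')%N; split=> //; first by lia.
  exact: (hw_nonzero charF0 hc c0 es).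
exact: (hw_nonzero charF0 hd d0 es').
Qed.

(* "up" and "down" tell whether the highest weight of the second layer is that of
   the socle plus m or minus m, for V_1 and V_2 respectively. *)
Lemma sol_up_up c d k : a1 = (a0 + m)%N -> b1 = (b0 + m)%N ->
  @hw_solution a0 a1 b0 b1 0 0 mu nu c d k -> c != 0 -> k = (a0 + b0 + m)%N.
Proof.
move=> ea eb hs c0.
have [|||s [s' [es ess [sa sb hcn] [sa' sb' hdn]]]] := sol_level _ _ _ hs c0; try lia.
have s's : s' = s by lia.
subst s'; case: s => [|s] in es ess sa sb hcn sa' sb' hdn *; first by lia.
case: hs => hc hd h; exfalso.
(* Two neighbouring equations force the ratios b1 - s : a0 and b0 - s : a1 to agree. *)
have h0 := h 0%N s.+1 isT sb'; have h1 := h 1%N s (leq_trans (ltn0Sn s) sa) (ltnW sb').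
rewrite /= !subn0 !bin0 !mulr1 in h0 h1.
have rc := hw_rel 0 s hc; have rd := hw_rel 0 s hd; rewrite !subn0 in rc rd.
have n0 := hcn 0%N s.+1 (add0n _).
have e : (a1%:R * (b1 - s)%:R - a0%:R * (b0 - s)%:R) * ent c 0 s.+1 = 0.
  have d0 : ent d 0 s.+1 = - (nu / mu) * ent c 0 s.+1.
    apply: (mulfI mu0); apply/eqP; rewrite -subr_eq0 -h0; apply/eqP; by field.
  have d1 : ent d 1 s = - (nu / mu) * ent c 1 s.
    apply: (mulfI mu0); apply/eqP; rewrite -subr_eq0 -h1; apply/eqP; by field.
  rewrite d0 d1 in rd.
  have rd' : a1%:R * ent c 1 s + (b0 - s)%:R * ent c 0 s.+1 = 0.
    have hq : - (nu / mu) != 0 by rewrite oppr_eq0 mulf_neq0 ?invr_neq0.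
    by apply: (mulfI hq); rewrite mulr0 -rd; ring.
  transitivity (a1%:R * (a0%:R * ent c 1 s + (b1 - s)%:R * ent c 0 s.+1) -
     a0%:R * (a1%:R * ent c 1 s + (b0 - s)%:R * ent c 0 s.+1)); first by ring.
  by rewrite rc rd' !mulr0 subrr.
move/eqP: e; rewrite mulf_eq0 (negbTE n0) orbF subr_eq0 -!natrM => /eqP/(natF_inj charF0).
(* The two products to be compared are (a0 + m)(m + (b0 - s)) and a0 (b0 - s); the first is strictly
   larger. *)
rewrite ea (_ : b1 - s = m + (b0 - s))%N; last by lia.
by move=> e; have : (0 < m * (b0 - s))%N; [rewrite muln_gt0 m_gt0; lia|nia].
Qed.

Lemma sol_up_up_ex : a1 = (a0 + m)%N -> b1 = (b0 + m)%N ->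
  exists c d, @hw_solution a0 a1 b0 b1 0 0 mu nu c d (a0 + b0 + m) /\ c != 0.
Proof.
move=> ea eb.
have hc := hwvec_hw F (leq0n a0) (leq0n b1).
have hd := hwvec_hw F (leq0n a1) (leq0n b0).
have c00 := @hwvec_neq0 F charF0 a0 b1 0 0 0 isT isT erefl.
have d00 := @hwvec_neq0 F charF0 a1 b0 0 0 0 isT isT erefl.
set c := hwvec F a0 b1 0 in hc c00; set d := hwvec F a1 b0 0 in hd d00.
(* Both vectors are supported at (0, 0), so only that equation has nonzero terms, and it fixes t. *)
pose t := - (mu * ent d 0 0) / (nu * ent c 0 0).
have ht : t != 0 by rewrite mulf_neq0 ?oppr_eq0 ?invr_neq0 ?mulf_neq0.
exists (t *: c), d; split; last first.
  by rewrite scaler_eq0 negb_or ht /=; apply: contraNneq c00 => ->; rewrite ent0.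
have scal a b (x : 'M[F]_(a.+1, b.+1)) k : tens_hw x k -> tens_hw (t *: x) k.
  move=> [h1 h2]; split; rewrite -!scalemxAl -!scalemxAr -!scalerDr ?h1 ?h2 ?scaler0 //.
  by rewrite !scalerA mulrC.
split.
- by rewrite (_ : a0 + b0 + m = a0 + b1 - 2 * 0)%N; [apply: scal|lia].
- by rewrite (_ : a0 + b0 + m = a1 + b0 - 2 * 0)%N; [|lia].
move=> i j hi hj; rewrite /= !subn0 !bin0 !mulr1 entZ.
case: i j hi hj => [|i] [|j] hi hj; try by
  rewrite !ent_hwvec //= ?mulr0 ?addr0 //; lia.
by rewrite /t; field; rewrite nu0 c00.
Qed.

(** Here s' = s + m. The equation at (s + 1, m - 1) has no c-term, while its d-entry lies on
    antidiagonal s' and is nonzero. So this position must be outside the range of the equations,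
    which means s = a0. *)
Lemma sol_up_down c d k : a1 = (a0 + m)%N -> b0 = (b1 + m)%N ->
  @hw_solution a0 a1 b0 b1 0 m mu nu c d k -> c != 0 ->
  (a0 <= b1)%N /\ k = (b1 - a0)%N.
Proof.
move=> ea eb hs c0.
have [|||s [s' [es ess [sa sb hcn] [sa' sb' hdn]]]] := sol_level _ _ _ hs c0; try lia.
suff sE : s = a0 by lia.
apply/eqP; rewrite eqn_leq sa /= leqNgt; apply/negP => hsa.
case: hs => hc hd h.
have hj : (m.-1 <= b0)%N by lia.
have := h s.+1 m.-1 hsa hj; rewrite /= (_ : m <= m.-1 = false)%N; last by lia.
rewrite addr0 bin0 mulr1 subn0 => /eqP; rewrite mulf_eq0 (negbTE mu0) /=.
by apply/negP; apply: hdn; lia.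
Qed.

Lemma sol_up_down_ex : a1 = (a0 + m)%N -> b0 = (b1 + m)%N -> (a0 <= b1)%N ->
  exists c d, [/\ @hw_solution a0 a1 b0 b1 0 m mu nu c d (b1 - a0), c != 0 & d != 0].
Proof.
move=> ea eb hab.
have ha1 : (a0 + m <= a1)%N by lia.
have hb0 : (a0 + m <= b0)%N by lia.
have hc := hwvec_hw F (leqnn a0) hab.
have hd := hwvec_hw F ha1 hb0.
have c00 := @hwvec_neq0 F charF0 a0 b1 a0 a0 0 (leqnn _) (leq0n _) (addn0 _).
have d00 := @hwvec_neq0 F charF0 a1 b0 (a0 + m) 0 (a0 + m) (leq0n _) hb0 (add0n _).
set c := hwvec F a0 b1 a0 in hc c00; set d := hwvec F a1 b0 (a0 + m) in hd d00.
have fm : (m`!)%:R != 0 :> F by rewrite natF_eq0 // -lt0n fact_gt0.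
(* On i + j = a0 + m the entries of d and c differ only by the factors j! and (j - m)!. Since j! =
   m! (j - m)! 'C(j, m), one scalar t satisfies all the equations. For j < m both terms vanish,
   because i is at most a0. *)
pose t := - (mu * (m`!)%:R) / nu.
have ht : t != 0 by rewrite mulf_neq0 ?oppr_eq0 ?invr_neq0 ?mulf_neq0.
exists (t *: c), d; split; last 2 first.
- by rewrite scaler_eq0 negb_or ht /=; apply: contraNneq c00 => ->; rewrite ent0.
- by apply: contraNneq d00 => ->; rewrite ent0.
split.
- rewrite (_ : b1 - a0 = a0 + b1 - 2 * a0)%N; last by lia.
  case: hc => h1 h2; split; rewrite -!scalemxAl -!scalemxAr -!scalerDr ?h1 ?h2 ?scaler0 //.
  by rewrite !scalerA mulrC.
- by rewrite (_ : b1 - a0 = a1 + b0 - 2 * (a0 + m))%N; [|lia].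
move=> i j hi hj; rewrite /= !subn0 !bin0 !mulr1 entZ.
rewrite ent_hwvec; [|lia|lia].
case: (leqP m j) => hmj; last first.
  by rewrite (_ : (i + j == a0 + m) = false)%N ?mulr0 ?addr0 //; apply/negbTE; lia.
rewrite ent_hwvec; [|lia|lia].
rewrite (_ : (i + (j - m) == a0) = (i + j == a0 + m))%N; last by apply/eqP/eqP; lia.
case: eqP => e; last by rewrite !mulr0 addr0.
rewrite (_ : a1 - i = j)%N; last by lia.
rewrite (_ : a0 - i = j - m)%N; last by lia.
rewrite (_ : b1 - (j - m) = b0 - j)%N; last by lia.
rewrite -(bin_fact hmj) !natrM /t; field; exact: nu0.
Qed.

(** At (0, s + m) the d-term is absent since del > 0, so the equation contradicts the nonvanishing
    of the entry (0, s) of c. *)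
Lemma sol_down del c d k : (0 < del)%N -> b0 = (b1 + m)%N ->
  (a0 + m = a1 + 2 * del)%N ->
  @hw_solution a0 a1 b0 b1 del m mu nu c d k -> c = 0.
Proof.
move=> hdel eb ea hs; apply/eqP; apply: contraT => c0.
have [|||s [s' [es ess [sa sb hcn] [sa' sb' hdn]]]] := sol_level _ _ _ hs c0; try lia.
case: hs => hc hd h.
have hj : (s + m <= b0)%N by lia.
have := h 0%N (s + m)%N isT hj.
rewrite leqNgt hdel add0r leq_addl addnK => /eqP.
by rewrite !mulf_eq0 (negbTE nu0) (negbTE (bin_neq0 (leq_addl _ _))) (negbTE (hcn 0%N s _)).
Qed.

End Cases.

Section CaseOne.
Variables (a1 b0 b1 : nat) (mu nu : F).
Hypotheses (mu0 : mu != 0) (nu0 : nu != 0).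

(** From s = s' + 1 and s at most a0 = 1 follow s = 1 and s' = 0. If b0 > 0, the equation at (0, 1)
    contains only the nonzero c-term. *)
Lemma sol_one c d k : b1 = (b0 + a1.+1)%N ->
  @hw_solution 1 a1 b0 b1 1 0 mu nu c d k -> c != 0 -> b0 = 0%N /\ k = a1.
Proof.
move=> eb hs c0.
have [|||s [s' [es ess [sa sb hcn] [sa' sb' hdn]]]] := @sol_level 1 a1 b0 b1 a1.+1 mu nu mu0 nu0 (ltn0Sn _) 1 0 c d k _ _ _ hs c0; try lia.
have s1 : s = 1%N by lia.
have b00 : b0 = 0%N.
  apply/eqP; rewrite -leqn0 leqNgt; apply/negP => hb.
  case: hs => hc hd h; have := h 0%N 1%N isT hb; rewrite /= add0r bin0 mulr1 => /eqP.
  by rewrite mulf_eq0 (negbTE nu0) (negbTE (hcn 0%N 1%N _)).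
by split=> //; lia.
Qed.

Lemma sol_one_ex : b1 = a1.+1 ->
  exists c d, @hw_solution 1 a1 0 b1 1 0 mu nu c d a1 /\ c != 0.
Proof.
move=> eb; have hb : (0 < b1)%N by lia.
have hc := hwvec_hw F (leqnn 1) hb.
have hd := hwvec_hw F (leq0n a1) (leq0n 0).
have c00 := @hwvec_neq0 F charF0 1 b1 1 1 0 (leqnn _) (leq0n _) (addn0 _).
have d00 := @hwvec_neq0 F charF0 a1 0 0 0 0 isT isT erefl.
set c := hwvec F 1 b1 1 in hc c00; set d := hwvec F a1 0 0 in hd d00.
(* With b0 = 0 there are only two equations. The one at (0, 0) is trivial since c is supported on i
   + j = 1, and the one at (1, 0) fixes t. *)
pose t := - (mu * ent d 0 0) / (nu * ent c 1 0).
have ht : t != 0 by rewrite mulf_neq0 ?oppr_eq0 ?invr_neq0 ?mulf_neq0.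
exists (t *: c), d; split; last first.
  by rewrite scaler_eq0 negb_or ht /=; apply: contraNneq c00 => ->; rewrite ent0.
split.
- have e : (1 + b1 - 2 * 1 = a1)%N by lia.
  rewrite e in hc; case: hc => h1 h2; split; rewrite -!scalemxAl -!scalemxAr -!scalerDr ?h1 ?h2 ?scaler0 //.
  by rewrite !scalerA mulrC.
- have e : (a1 + 0 - 2 * 0 = a1)%N by lia.
  by rewrite e in hd.
move=> [|[|i]] [|j] // _ _; rewrite /= entZ ?subnn ?bin0 ?binn ?mulr1.
  by rewrite add0r ent_hwvec //= !mulr0.
by rewrite /t; field; rewrite nu0 c00.
Qed.

End CaseOne.
End Solutions.

(** * The socle of the tensor product *)

Section Tensor.
Variable F : fieldType.
Hypothesis charF0 : [pchar F] =i pred0.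

Lemma tensactZ d1 d2 c (A : 'M[F]_d1) (B : 'M[F]_d2) :
  tensact (c *: A) (c *: B) = c *: tensact A B.
Proof. by rewrite /tensact tensmxZl tensmxZr scalerDr. Qed.

Lemma tensact0 d1 d2 : tensact (0 : 'M[F]_d1) (0 : 'M[F]_d2) = 0.
Proof. by rewrite /tensact tens0mx tensmx0 addr0. Qed.

Lemma tensactN d1 d2 (A : 'M[F]_d1) (B : 'M[F]_d2) : tensact (- A) (- B) = - tensact A B.
Proof. by rewrite -!scaleN1r tensactZ. Qed.

Variables (n d1 d2 : nat) (r1 : grep F n d1) (r2 : grep F n d2).
Hypothesis rep1 : is_rep r1.
Hypothesis rep2 : is_rep r2.
Local Notation m := (mdeg n).
Local Notation T := (tens_rep r1 r2).

Lemma Xat_tens i : Xat T i = tensact (Xat r1 i) (Xat r2 i).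
Proof. by rewrite /Xat; case: ifP => _ //; rewrite tensact0. Qed.

Lemma tens_is_rep : is_rep T.
Proof.
case: rep1 => a1 a2 a3 [a4 a5 a6 a7] [a8 a9 a10 a11].
case: rep2 => b1 b2 b3 [b4 b5 b6 b7] [b8 b9 b10 b11].
split; rewrite /= ?lbr_tensact.
- by rewrite a1 b1.
- by rewrite a2 b2 tensactZ.
- by rewrite a3 b3 tensactN tensactZ.
- split=> [i|i|i|i j]; rewrite /= ?lbr_tensact ?a4 ?b4 ?a5 ?b5 ?a6 ?b6 ?a7 ?b7 tensactZ ?Xat_tens //.
  by case: ifP; rewrite ?tensact0.
- split=> [|||i]; rewrite /= ?lbr_tensact ?a8 ?b8 ?a9 ?b9 ?a10 ?b10 ?a11 ?b11 ?tensact0 //.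
Qed.

Let repT := tens_is_rep.

Lemma kerX_kerZ n' d (r : grep F n' d) : is_rep r -> (kerX r <= kermx (rZ r))%MS.
Proof.
move=> rep; have h s : kerX r *m rX r s = 0 by move: s; apply/sub_kerX.
by apply/sub_kermxP; rewrite (rep_ZX rep) /lbr mulmxBr !mulmxA !h !mul0mx subrr.
Qed.

Lemma hinv_kerX : (hinv T :=: kerX T)%MS.
Proof.
apply/eqmxP/andP; split; first exact: capmxSl.
by rewrite sub_capmx submx_refl kerX_kerZ.
Qed.

Lemma hinvP p (w : 'M[F]_(p, d1 * d2)) :
  reflect (forall s, w *m tensact (rX r1 s) (rX r2 s) = 0) (w <= hinv T)%MS.
Proof. by rewrite hinv_kerX; apply: (iffP (sub_kerX _ _)). Qed.

Lemma hinv_sstable : sstable T (hinv T).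
Proof. exact: sstable_eqmx (eqmx_sym hinv_kerX) (kerX_stable repT). Qed.

Lemma hinv_X s : hinv T *m rX T s = 0.
Proof. by move: s; apply/hinvP. Qed.

Lemma hinv_Z : hinv T *m rZ T = 0.
Proof. by apply/sub_kermxP; rewrite hinv_kerX kerX_kerZ. Qed.

Lemma gstable_hinv W : sstable T W -> (W <= hinv T)%MS -> gstable T W.
Proof.
move=> [h1 h2 h3] hW; split=> //.
  move=> s; have /submxP[c ->] := hW; by rewrite -mulmxA hinv_X mulmx0 sub0mx.
have /submxP[c ->] := hW; by rewrite -mulmxA hinv_Z mulmx0 sub0mx.
Qed.

Lemma iso_irr_hinv W k : sl2_iso_V T W k -> (W <= hinv T)%MS -> irr_over T 0 W.
Proof.
move=> iW hW; split; first exact: gstable_hinv (iso_stable iW) hW.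
  by rewrite lt0mx; apply: iso_neq0 iW.
move=> W' [h1 h2 h3 _ _] _ hW'; have [->|n0] := eqVneq W' 0.
  by left; apply/eqmxP.
right; apply/andP; split=> //.
by apply: (iso_irr charF0 iW) n0.
Qed.

(** * Invariants of h_n and the socle, for graded factors *)

Section Decomp.
Variables (e : nat -> 'M[F]_d1) (a : nat -> nat).
Hypothesis lay1 : layered r1 2 e a.
Hypothesis eZ0 : e 0%N *m rZ r1 = 0.
Hypothesis eZ1 : e 1%N *m rZ r1 = 0.
Hypothesis eZ2 : ~~ (e 2%N <= kermx (rZ r1))%MS.
Variables (L : nat) (f : nat -> 'M[F]_d2) (b : nat -> nat).
Hypothesis L_gt0 : (0 < L)%N.
Hypothesis lay2 : layered r2 L f b.
Hypothesis Z2 : rZ r2 = 0.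

Definition mixed : 'M[F]_(d1 * d2) := (e 0%N *t f 1%N + e 1%N *t f 0%N)%MS.
(** This is S_1 expressed by the layer idempotents; see [Sterm1]. *)
Definition soc1 : 'M[F]_(d1 * d2) := (mixed :&: hinv T)%MS.

Lemma bottom_hinv : (e 0%N *t f 0%N <= hinv T)%MS.
Proof.
by apply/hinvP => s; rewrite tensact_tens (lay_X0 lay1) (lay_X0 lay2) tens0mx tensmx0 addr0.
Qed.

Lemma row_components (U : 'M[F]_(d1, d2)) :
  U = \sum_(i < 3) \sum_(j < L.+1) (e i)^T *m U *m f j.
Proof.
have tr1 : \sum_(i < 3) (e i)^T = 1%:M by rewrite -trmx1 -(lay_sum lay1) linear_sum.
rewrite -{1}[U]mul1mx -{1}[1%:M *m U]mulmx1 -{1}tr1 !mulmx_suml.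
by apply: eq_bigr => i _; rewrite -mulmx_sumr (lay_sum lay2).
Qed.

Lemma hinv_components (u : 'rV[F]_(d1 * d2)) : (u <= hinv T)%MS ->
  u = u *m (e 0%N *t f 0%N) + (u *m (e 0%N *t f 1%N) + u *m (e 1%N *t f 0%N)).
Proof.
move=> hu; apply: (can_inj (@unvecK F _ _)); rewrite !unvecD !unvec_tens.
set U := unvec u.
have hX s : (rX r1 s)^T *m U + U *m rX r2 s = 0.
  by move/hinvP: hu => /(_ s) h; rewrite -unvec_tensact h unvec0.
have hZ : (rZ r1)^T *m U = 0.
  have : u *m rZ T = 0 by have /submxP[c ->] := hu; rewrite -mulmxA hinv_Z mulmx0.
  by move/(congr1 (@unvec F _ _)); rewrite unvec_tensact Z2 mulmx0 addr0 unvec0.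
(* z acts trivially on V_2, so it must kill u through the first factor, where it is injective on
   layer 2. *)
have U2 : (e 2%N)^T *m U = 0.
  have Ze : rZ r1 = e 2%N *m rZ r1.
    rewrite -{1}[rZ r1]mul1mx -(lay_sum lay1) !big_ord_recr big_ord0 /= !mulmxDl eZ0 eZ1.
    by rewrite mul0mx !add0r.
  apply: trmx_inj; rewrite trmx0 trmx_mul trmxK.
  apply: (iso_inj charF0 (lay_iso lay1 (leqnn 2)) (kerZ_stable rep1) eZ2 (submxMl _ _)).
  apply/sub_kermxP; rewrite -mulmxA -Ze -[rZ r1]trmxK -trmx_mul hZ trmx0 //.
(* As x_s lowers the layer by one in either factor, the (i, j) component of x_s u = 0 involves only
   the components (i+1, j) and (i, j+1) of u. *)
have rel i j s : (rX r1 s)^T *m ((e i.+1)^T *m U *m f j) + (e i)^T *m U *m f j.+1 *m rX r2 s = 0.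
  have := congr1 (fun M => (e i)^T *m M *m f j) (hX s).
  rewrite mulmx0 mul0mx mulmxDr mulmxDl => <-; congr (_ + _).
    by rewrite !mulmxA -!trmx_mul (lay_X lay1).
  by rewrite -!mulmxA (lay_X lay2).
(* Once component (i+1, j) is known to vanish, component (i, j+1) is killed by h_n(m) on the second
   factor and vanishes too. For i = 0 this starts at j = 1, since component (1, 0) may survive. *)
have U1 j : (j < L)%N -> (e 1%N)^T *m U *m f j.+1 = 0.
  move=> hj; apply: (lay_Xinj charF0 rep2 lay2 hj) => s.
  by have := rel 1%N j s; rewrite U2 mul0mx mulmx0 add0r.
have U0 j : (0 < j < L)%N -> (e 0%N)^T *m U *m f j.+1 = 0.
  case: j => // j /= hj; apply: (lay_Xinj charF0 rep2 lay2 hj) => s.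
  by have := rel 0%N j.+1 s; rewrite U1 ?mulmx0 ?add0r // ltnW.
pose G i := \sum_(j < L.+1) (e i)^T *m U *m f j.
have GE : U = G 0%N + G 1%N + G 2%N.
  rewrite {1}[U]row_components (eq_bigr (fun i : 'I_3 => G i)) //.
  by rewrite !big_ord_recr big_ord0 /= add0r.
have G2 : G 2%N = 0 by rewrite /G big1 // => j _; rewrite U2 mul0mx.
have G1 : G 1%N = (e 1%N)^T *m U *m f 0%N.
  by rewrite /G big_ord_recl big1 ?addr0 // => j _; exact: (U1 j (ltn_ord j)).
have G0 : G 0%N = (e 0%N)^T *m U *m f 0%N + (e 0%N)^T *m U *m f 1%N.
  rewrite /G; case: L L_gt0 U0 => // L' _ U0.
  by rewrite !big_ord_recl big1 ?addr0 // => j _; exact: (U0 j.+1 (ltn_ord j)).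
by rewrite {1}GE G2 G1 G0 addr0 addrA.
Qed.

Lemma hinv_decomp : (hinv T :=: e 0%N *t f 0%N + soc1)%MS.
Proof.
apply/eqmxP/andP; split; last by rewrite addsmx_sub bottom_hinv capmxSr.
apply/rV_subP => u hu; rewrite (hinv_components hu).
apply: addmx_sub_adds; first exact: submxMl.
rewrite /soc1 sub_capmx /mixed addmx_sub_adds ?submxMl //=.
have -> : u *m (e 0%N *t f 1%N) + u *m (e 1%N *t f 0%N) = u - u *m (e 0%N *t f 0%N).
  apply/esym/eqP; rewrite subr_eq [X in _ == X]addrC; apply/eqP.
  exact: hinv_components.
apply: addmx_sub => //; rewrite eqmx_opp; apply: submx_trans bottom_hinv; exact: submxMl.
Qed.

Lemma bottom_soc1_direct : (e 0%N *t f 0%N :&: soc1 = 0)%MS.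
Proof.
apply/eqP; rewrite -submx0; apply/rV_subP => u.
rewrite sub_capmx => /andP[/submxP[x ex]]; rewrite sub_capmx => /andP[hm _].
have hz : mixed *m (e 0%N *t f 0%N) = 0.
  apply/eqP; rewrite -submx0 addsmxMr addsmx_sub !tensmx_mul !(lay_mul lay1) !(lay_mul lay2) /=.
  by rewrite tens0mx tensmx0 sub0mx.
have : u *m (e 0%N *t f 0%N) = 0.
  by move: hm => /submxP[y ->]; rewrite -mulmxA hz mulmx0.
by rewrite ex -mulmxA tensmx_mul (lay_mul lay1) (lay_mul lay2) /= => ->; rewrite sub0mx.
Qed.

Definition filt t : 'M[F]_(d1 * d2) :=
  (\sum_(i < 3) \sum_(j < L.+1 | (i + j < t)%N) e i *t f j)%MS.

Lemma filt_X t s : (filt t.+1 *m rX T s <= filt t)%MS.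
Proof.
rewrite sumsmxMr; apply/sumsmx_subP => i _; rewrite sumsmxMr; apply/sumsmx_subP => j hij.
have sub i' j' : (i' < 3)%N -> (j' < L.+1)%N -> (i' + j' < t)%N -> (e i' *t f j' <= filt t)%MS.
  move=> hi hj ht; apply: (sumsmx_sup (Ordinal hi)) => //.
  by apply: (sumsmx_sup (Ordinal hj)).
rewrite tensact_tens; apply: addmx_sub.
  case: i hij => -[|i] hi /= hij; first by rewrite (lay_X0 lay1) tens0mx sub0mx.
  rewrite -(lay_X lay1); apply: submx_trans (sub i j _ _ _); rewrite ?ltn_ord ?(ltnW hi) //.
  by apply: tensS; rewrite ?submxMl.
case: j hij => -[|j] hj /= hij; first by rewrite (lay_X0 lay2) tensmx0 sub0mx.
rewrite -(lay_X lay2); apply: submx_trans (sub i j _ _ _); rewrite ?ltn_ord ?(ltnW hj) //.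
  by apply: tensS; rewrite ?submxMl.
by move: hij; rewrite addnS ltnS.
Qed.

(** An Engel-type argument: if W meets [filt] in degree t + 1 in noninvariant vectors, some x_s
    produces nonzero vectors of W in degree t. *)
Lemma cap_hinv_neq0 (W : 'M[F]_(d1 * d2)) : gstable T W -> W != 0 -> (W :&: hinv T)%MS != 0.
Proof.
move=> [_ _ _ hX _] W0.
suff step t : (W :&: filt t)%MS != 0 -> (W :&: hinv T)%MS != 0.
  (* The total degree i + j is at most L + 2, so this term of the filtration is the whole space. *)
  apply: (step (L + 3)%N); apply: contraNneq W0 => h.
  rewrite -submx0 -h sub_capmx submx_refl /=; apply/rV_subP => u _.
  rewrite -[u]unvecK (row_components (unvec u)).
  have vD (I : Type) (r : seq I) (G : I -> 'M[F]_(d1, d2)) :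
    (forall i, (vec (G i) <= filt (L + 3))%MS) -> (vec (\sum_(i <- r) G i) <= filt (L + 3))%MS.
    move=> hG; elim: r => [|i r IH].
      by rewrite big_nil -(unvec0 F) unvecK sub0mx.
    rewrite big_cons (_ : vec _ = vec (G i) + vec (\sum_(i <- r) G i)); last first.
      by apply/rowP => j; rewrite !mxE.
    exact: addmx_sub.
  apply: (vD) => i; apply: (vD) => j.
  rewrite -unvec_tens unvecK; apply: submx_trans (submxMl _ _) _.
  apply: (sumsmx_sup i) => //; apply: (sumsmx_sup j) => //.
  have := ltn_ord i; have := ltn_ord j; move: (nat_of_ord i) (nat_of_ord j) => p q; lia.
elim: t => [|t IH] ht.
  by move: ht; rewrite /filt big1 ?capmx0 ?eqxx // => i _; rewrite big1.
have [h|/hinvP h] := boolP ((W :&: filt t.+1)%MS <= hinv T)%MS.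
  apply: contraNneq ht => h0; rewrite -submx0 -h0 sub_capmx capmxSl h //.
have {h} [s hs] : exists s, (W :&: filt t.+1)%MS *m rX T s != 0.
  case: (pickP (fun s => (W :&: filt t.+1)%MS *m rX T s != 0)) => [s hs|h0]; first by exists s.
  by case: h => s; apply/eqP/negPn; rewrite h0.
apply: IH; apply: contraNneq hs => h0; rewrite -submx0 -h0 sub_capmx.
rewrite (submx_trans (submxMr _ (capmxSl _ _)) (hX s)) /=.
exact: submx_trans (submxMr _ (capmxSr _ _)) (filt_X t s).
Qed.

Lemma irr_sub_hinv W : irr_over T 0 W -> (W <= hinv T)%MS.
Proof.
move=> [gW W0 irr]; rewrite lt0mx in W0.
have sW : sstable T (W :&: hinv T)%MS.
  by apply: sstable_cap hinv_sstable; case: gW.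
have gW' := gstable_hinv sW (capmxSr _ _).
case: (irr _ gW' (sub0mx _ _) (capmxSl _ _)) => /eqmxP h.
  by have := cap_hinv_neq0 gW W0; rewrite -mxrank_eq0 h mxrank0 eqxx.
by rewrite -h capmxSr.
Qed.

Lemma tens_ef_semisimple i j : (i <= 2)%N -> (j <= L)%N -> semisimple T (e i *t f j).
Proof.
move=> hi hj; have [P [fP /eqmxP eP PE PH PF]] := lay_iso lay1 hi.
have [Q [fQ /eqmxP eQ QE QH QF]] := lay_iso lay2 hj.
apply: (@tens_semisimple F charF0 n _ T (a i) (b j) (P *t Q)).
- exact: tens_row_free.
- by rewrite tens_tensact PE QE tensact_tens.
- by rewrite tens_tensact PH QH tensact_tens.
- by rewrite tens_tensact PF QF tensact_tens.
- by apply: eqmx_tens; apply: eqmx_sym.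
Qed.

Lemma bottom_iso_sum (W : 'M[F]_(d1 * d2)) : (W :=: e 0%N *t f 0%N)%MS ->
  sl2_iso_sum T W [seq (a 0 + b 0 - 2 * k)%N | k <- iota 0 (minn (a 0%N) (b 0%N)).+1].
Proof.
move=> eW; have [P [fP /eqmxP eP PE PH PF]] := lay_iso lay1 (leq0n 2).
have [Q [fQ /eqmxP eQ QE QH QF]] := lay_iso lay2 (leq0n L).
apply: (@clebsch_gordan F charF0 n _ T (a 0%N) (b 0%N) (P *t Q)).
- exact: tens_row_free.
- by rewrite tens_tensact PE QE tensact_tens.
- by rewrite tens_tensact PH QH tensact_tens.
- by rewrite tens_tensact PF QF tensact_tens.
- by apply: eqmx_trans eW _; apply: eqmx_tens; apply: eqmx_sym.
Qed.

Lemma tens_ef_comm i j : sl2comm T (e i *t f j).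
Proof.
have [h1 h2 h3] := lay_comm lay1 i; have [g1 g2 g3] := lay_comm lay2 j.
by split; rewrite tensact_tens tens_tensact ?h1 ?h2 ?h3 ?g1 ?g2 ?g3.
Qed.

Lemma mixed_sstable : sstable T mixed.
Proof.
have h i j : sstable T (e i *t f j).
  by have [h1 h2 h3] := tens_ef_comm i j; split; rewrite ?h1 ?h2 ?h3 submxMl.
exact: sstable_adds.
Qed.

Lemma soc1_sstable : sstable T soc1.
Proof. exact: sstable_cap mixed_sstable hinv_sstable. Qed.

Lemma soc1_semisimple : semisimple T soc1.
Proof.
apply: (semisimple_sub charF0 (M := mixed)) soc1_sstable (capmxSl _ _).
by apply: semisimple_adds; apply: tens_ef_semisimple.
Qed.

Lemma hinv_is_soc (S : 'M[F]_(d1 * d2)) : (S :=: hinv T)%MS -> is_soc T S.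
Proof.
move=> eS; split; first by move=> W /irr_sub_hinv; rewrite eS.
have [s [hs es]] : semisimple T (hinv T).
  apply: semisimple_eqmx (eqmx_sym hinv_decomp) _.
  by apply: semisimple_adds soc1_semisimple; apply: tens_ef_semisimple.
exists s; split.
  move=> W hW; have [k iW] := hs W hW; apply: iso_irr_hinv iW _.
  by rewrite -es; apply: sub_seqsum.
by apply/eqmxP; apply: eqmx_trans (adds0mx _ _) _; apply: eqmx_trans es _; exact: eqmx_sym.
Qed.

End Decomp.
End Tensor.

(** * Coordinates on S_1 *)

Section SecondLayer.
Variable F : fieldType.
Hypothesis charF0 : [pchar F] =i pred0.

(* [e, x_s] is a nonzero multiple of x_{s-1}. *)
Lemma X_descend n d (r : grep F n d) p (w : 'M[F]_(p, d)) C : is_rep r ->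
  w *m rE r = C *m w -> w *m rX r ord_max = 0 -> forall s, w *m rX r s = 0.
Proof.
move=> rep wE wX.
(* The matrix C allows two uses: a highest weight vector with C = 0, and the basis of a whole layer
   with C = [VE]. *)
have h t : (t <= mdeg n)%N -> w *m rX r (inord (mdeg n - t)) = 0.
  elim: t => [|t IH] ht.
    by rewrite subn0 (_ : inord _ = ord_max) //; apply: val_inj; rewrite /= inordK.
  have := congr1 (mulmx w) (rep_EX rep (inord (mdeg n - t))).
  rewrite mulmxA wE -mulmxA IH ?mulmx0; last exact: ltnW.
  rewrite mulmxBr mulmxA IH ?mul0mx ?sub0r; last exact: ltnW.
  rewrite /= inordK ?ltnS ?leq_subr // (_ : (mdeg n - t == 0)%N = false); last by lia.
  rewrite -scalemxAr => /esym/eqP; rewrite oppr_eq0 scaler_eq0 (negbTE (natS_neq0 charF0 _)) /=.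
  rewrite /Xat (_ : ((mdeg n - t).-1 < (mdeg n).+1)%N); last by lia.
  by rewrite (_ : (mdeg n - t).-1 = mdeg n - t.+1)%N; [move/eqP|lia].
move=> s; have := h (mdeg n - s)%N (leq_subr _ _).
rewrite subKn; last by rewrite -ltnS.
by rewrite inord_val.
Qed.

Definition shift_matrix k c (M : 'M[F]_(k.+1, c.+1)) (del : nat) (mu : F) : Prop :=
  (forall i j, ent M i j != 0 -> j = (i + del)%N) /\
  (forall i, (i <= k)%N -> (i + del <= c)%N -> ent M i (i + del) = mu * 'C(i + del, del)%:R).

Lemma shift_matrix_mul p k c (M : 'M[F]_(k.+1, c.+1)) del mu (A : 'M[F]_(p, k.+1)) i j :
  shift_matrix M del mu -> (j <= c)%N ->
  ent (A *m M) i j = if (del <= j)%N then mu * 'C(j, del)%:R * ent A i (j - del) else 0.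
Proof.
move=> [supp coef] hj; rewrite (shift_mulr _ _ _ supp).
case: (leqP del j) => // hd; case: (leqP (j - del) k) => hk.
  by congr (_ * _); have := coef (j - del)%N hk; rewrite subnK // => ->.
by rewrite (ent_outr A) // !mulr0.
Qed.

(** If x_m killed layer 1, all x_s would by [X_descend], contrary to [lay_X1]. Weights locate the
    nonzero entries and [shift_coef] computes them. *)
Lemma layer_shift n d (r : grep F n d) L e a (P0 : 'M[F]_((a 0%N).+1, d)) (P1 : 'M[F]_((a 1%N).+1, d)) del :
  is_rep r -> layered r L e a -> (0 < L)%N ->
  row_free P0 -> (P0 :=: e 0%N)%MS -> sl2in r P0 -> (P1 :=: e 1%N)%MS -> sl2in r P1 ->
  (a 0 + mdeg n = a 1 + 2 * del)%N ->
  exists M mu, [/\ P1 *m rX r ord_max = M *m P0, mu != 0, (del <= a 0)%N & shift_matrix M del mu].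
Proof.
move=> rep lay L0 fP0 eP0 sP0 eP1 sP1 edel.
have /submxP[M hM] : (P1 *m rX r ord_max <= P0)%MS.
  rewrite eP0; apply: submx_trans (submxMr _ (_ : P1 <= e 1%N)%MS) _; first by rewrite eP1.
  by rewrite -(lay_X lay) submxMl.
have M0 : M != 0.
  have [s hs] := lay_X1 lay L0; apply: contraNneq hs => hM0.
  have [hE _ _] := sP1.
  have := X_descend rep (esym hE) _ s; rewrite hM hM0 mul0mx => /(_ erefl) h.
  by rewrite -submx0 -(eqmxMr _ eP1) h sub0mx.
have hF : VF F (a 1%N) *m M = M *m VF F (a 0%N).
  have [_ _ h1] := sP1; have [_ _ h0] := sP0.
  apply: (row_free_inj fP0); rewrite -!mulmxA -hM h0 mulmxA h1 -mulmxA (rep_FX rep).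
  (* The default value 0 of [Xat] past index m encodes [f, x_m] = 0. *)
  have -> : Xat r (@ord_max (mdeg n)).+1 = 0 by rewrite /Xat ltnn.
  by rewrite scaler0 subr0 !mulmxA hM.
have supp i j : ent M i j != 0 -> j = (i + del)%N.
  have hM' : P1 *m rX r ord_max *m 1%:M = M *m P0 by rewrite mulmx1.
  have c1 : 1%:M *m rH r = rH r *m 1%:M by rewrite mul1mx mulmx1.
  move=> hn; have := coord_weight charF0 rep sP1 sP0 fP0 c1 hM' hn; rewrite /=; lia.
have [hd mu0 coef] := shift_coef charF0 hF M0 supp.
by exists M, (ent M 0 del).
Qed.

Lemma hw_solution_sub a0 a1 b0 b1 del del' mu nu c d c' d' k t :
  @hw_solution F a0 a1 b0 b1 del del' mu nu c d k ->
  @hw_solution F a0 a1 b0 b1 del del' mu nu c' d' k ->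
  @hw_solution F a0 a1 b0 b1 del del' mu nu (c - t *: c') (d - t *: d') k.
Proof.
have hw a b (x y : 'M[F]_(a.+1, b.+1)) l : tens_hw x l -> tens_hw y l -> tens_hw (x - t *: y) l.
  move=> [h1 h2] [g1 g2]; split.
    rewrite mulmxBr mulmxBl addrACA h1 -opprD -scalemxAr -scalemxAl -scalerDr g1.
    by rewrite scaler0 subr0.
  rewrite mulmxBr mulmxBl addrACA h2 -opprD -scalemxAr -scalemxAl -scalerDr g2.
  by rewrite scalerBr !scalerA mulrC.
move=> [h1 h2 h3] [g1 g2 g3]; split; try exact: hw.
move=> i j hi hj; have e3 := h3 i j hi hj; have e3' := g3 i j hi hj.
rewrite -!scaleN1r !entD !entZ.
have := congr2 (fun x y => x - t * y) e3 e3'; rewrite /= mulr0 subr0 => key.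
apply: etrans key.
by case: ifP => _; case: ifP => _; ring.
Qed.

Variables (n d1 d2 : nat) (r1 : grep F n d1) (r2 : grep F n d2).
Hypothesis rep1 : is_rep r1.
Hypothesis rep2 : is_rep r2.
Local Notation m := (mdeg n).
Local Notation T := (tens_rep r1 r2).
Variables (e : nat -> 'M[F]_d1) (a : nat -> nat).
Hypothesis lay1 : layered r1 2 e a.
Variables (L : nat) (f : nat -> 'M[F]_d2) (b : nat -> nat).
Hypothesis L_gt0 : (0 < L)%N.
Hypothesis lay2 : layered r2 L f b.
Variables (del del' : nat).
Hypothesis edel : (a 0 + m = a 1 + 2 * del)%N.
Hypothesis edel' : (b 0 + m = b 1 + 2 * del')%N.

(* emb identifies the solutions (c, d) with the highest weight vectors of S_1. *)
Definition realizes (mu nu : F) (emb : 'M[F]_((a 0).+1, (b 1).+1) -> 'M[F]_((a 1).+1, (b 0).+1) -> 'rV[F]_(d1 * d2)) : Prop :=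
  [/\ mu != 0, nu != 0, (del <= a 0)%N, (del' <= b 0)%N &
   [/\ forall c d, emb c d = 0 -> c = 0,
     forall t c d, emb (t *: c) (t *: d) = t *: emb c d,
     forall u k, (u <= soc1 r1 r2 e f)%MS -> u *m rE T = 0 -> u *m rH T = k%:R *: u ->
       exists c d, u = emb c d /\ @hw_solution F (a 0) (a 1) (b 0) (b 1) del del' mu nu c d k &
     forall c d k, @hw_solution F (a 0) (a 1) (b 0) (b 1) del del' mu nu c d k ->
       (emb c d <= soc1 r1 r2 e f)%MS /\ emb c d *m rH T = k%:R *: emb c d]].

Lemma soc1_coordinates : exists mu nu emb, realizes mu nu emb.
Proof.
have [P0 [fP0 /eqmxP eP0 P0E P0H P0F]] := lay_iso lay1 (leq0n 2).
have [P1 [fP1 /eqmxP eP1 P1E P1H P1F]] := lay_iso lay1 (isT : 1 <= 2)%N.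
have [Q0 [fQ0 /eqmxP eQ0 Q0E Q0H Q0F]] := lay_iso lay2 (leq0n L).
have [Q1 [fQ1 /eqmxP eQ1 Q1E Q1H Q1F]] := lay_iso lay2 L_gt0.
have [M [mu [hM mu0 hd shM]]] := layer_shift rep1 lay1 isT fP0 eP0 (And3 P0E P0H P0F) eP1 (And3 P1E P1H P1F) edel.
have [N [nu [hN nu0 hd' shN]]] := layer_shift rep2 lay2 L_gt0 fQ0 eQ0 (And3 Q0E Q0H Q0F) eQ1 (And3 Q1E Q1H Q1F) edel'.
(* P0, P1 and Q0, Q1 are standard bases of the two lowest layers, so c and d are coordinates in
   V(a_0) (x) V(b_1) and V(a_1) (x) V(b_0). *)
pose emb (c : 'M[F]_((a 0%N).+1, (b 1%N).+1)) (d : 'M[F]_((a 1%N).+1, (b 0%N).+1)) :=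
  vec c *m (P0 *t Q1) + vec d *m (P1 *t Q0).
exists mu, nu, emb.
have P0e : P0 *m e 0%N = P0 by apply: (lay_id lay1); rewrite eP0.
have P1e : P1 *m e 1%N = P1 by apply: (lay_id lay1); rewrite eP1.
have Q0f : Q0 *m f 0%N = Q0 by apply: (lay_id lay2); rewrite eQ0.
have Q1f : Q1 *m f 1%N = Q1 by apply: (lay_id lay2); rewrite eQ1.
have P1e0 : P1 *m e 0%N = 0 by rewrite -P1e -mulmxA (lay_mul lay1) mulmx0.
have P0e1 : P0 *m e 1%N = 0 by rewrite -P0e -mulmxA (lay_mul lay1) mulmx0.
have sep x y : x *m (P0 *t Q1) + y *m (P1 *t Q0) = 0 -> x = 0 /\ y = 0.
  move=> h; split.
    have := congr1 (mulmxr (e 0%N *t f 1%N)) h.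
    rewrite /= mul0mx mulmxDl -!mulmxA !tensmx_mul P0e Q1f P1e0 tens0mx mulmx0 addr0 => h0.
    by apply: (row_free_inj (tens_row_free fP0 fQ1)); rewrite mul0mx.
  have := congr1 (mulmxr (e 1%N *t f 0%N)) h.
  rewrite /= mul0mx mulmxDl -!mulmxA !tensmx_mul P1e Q0f P0e1 tens0mx mulmx0 add0r => h0.
  by apply: (row_free_inj (tens_row_free fP1 fQ0)); rewrite mul0mx.
have inter (x : 'rV_((a 0%N).+1 * (b 1%N).+1)) (y : 'rV_((a 1%N).+1 * (b 0%N).+1)) A0 A1 B0 B1 A B :
    A0 *m P0 = P0 *m A -> A1 *m P1 = P1 *m A -> B0 *m Q0 = Q0 *m B -> B1 *m Q1 = Q1 *m B ->
    (x *m (P0 *t Q1) + y *m (P1 *t Q0)) *m tensact A B =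
    (x *m tensact A0 B1) *m (P0 *t Q1) + (y *m tensact A1 B0) *m (P1 *t Q0).
  move=> h1 h2 h3 h4; rewrite mulmxDl -!mulmxA !tens_tensact h1 h2 h3 h4.
  by rewrite !tensact_tens.
have PX0 s : P0 *m rX r1 s = 0 by rewrite -P0e -mulmxA (lay_X0 lay1) mulmx0.
have QX0 s : Q0 *m rX r2 s = 0 by rewrite -Q0f -mulmxA (lay_X0 lay2) mulmx0.
(* x_m sends both summands to V(a_0) (x) V(b_0), where P0 (x) Q0 is injective; so being killed by
   x_m is an identity of coefficient matrices. *)
have interX x y : (x *m (P0 *t Q1) + y *m (P1 *t Q0)) *m tensact (rX r1 ord_max) (rX r2 ord_max) =
    (x *m (1%:M *t N) + y *m (M *t 1%:M)) *m (P0 *t Q0).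
  rewrite !mulmxDl -!mulmxA !tensact_tens !tensmx_mul !mul1mx PX0 QX0 hM hN.
  by rewrite tens0mx tensmx0 addr0 add0r.
have eqX c d : reflect (forall i j, (i <= a 0)%N -> (j <= b 0)%N ->
      (if (del <= i)%N then mu * 'C(i, del)%:R * ent d (i - del) j else 0) +
      (if (del' <= j)%N then nu * 'C(j, del')%:R * ent c i (j - del') else 0) = 0)
    (emb c d *m tensact (rX r1 ord_max) (rX r2 ord_max) == 0).
  rewrite /emb interX mulmx_free_eq0 ?tens_row_free //.
  rewrite -unvec_eq0 unvecD !unvec_tens !vecK trmx1 mul1mx mulmx1.
  have entX i j : (i <= a 0)%N -> (j <= b 0)%N -> ent (c *m N + M^T *m d) i j =
      (if (del <= i)%N then mu * 'C(i, del)%:R * ent d (i - del) j else 0) +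
      (if (del' <= j)%N then nu * 'C(j, del')%:R * ent c i (j - del') else 0).
    move=> hi hj; rewrite entD (shift_matrix_mul _ _ shN hj) addrC; congr (_ + _).
    rewrite -[M^T *m d]trmxK trmx_mul trmxK ent_tr (shift_matrix_mul _ _ shM hi).
    by case: ifP => // _; rewrite ent_tr.
  apply: (iffP eqP) => [h i j hi hj|h].
    by rewrite -entX // h ent0.
  by apply: entP => i j hi hj; rewrite ent0 entX ?h.
split=> //; split.
- by move=> c d /sep[h _]; rewrite -[c]vecK h unvec0.
- have vZ t p q (z : 'M[F]_(p, q)) : vec (t *: z) = t *: vec z.
    by apply/rowP => i; rewrite !mxE.
  by move=> t c d; rewrite /emb scalerDr !scalemxAl !vZ.
- move=> u k; rewrite sub_capmx => /andP[/sub_addsmxP[[x y] /= eu] /hinvP hX] uE uH.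
  have [x' ex] : exists x', x *m (e 0%N *t f 1%N) = x' *m (P0 *t Q1).
    by apply/submxP; rewrite (eqmx_tens eP0 eQ1) submxMl.
  have [y' ey] : exists y', y *m (e 1%N *t f 0%N) = y' *m (P1 *t Q0).
    by apply/submxP; rewrite (eqmx_tens eP1 eQ0) submxMl.
  rewrite ex ey in eu; exists (unvec x'), (unvec y').
  have eemb : u = emb (unvec x') (unvec y') by rewrite /emb !unvecK.
  split=> //.
  have [hE1 hE2] : x' *m tensact (VE F _) (VE F _) = 0 /\ y' *m tensact (VE F _) (VE F _) = 0.
    by apply: sep; rewrite -(inter _ _ _ _ _ _ _ _ P0E P1E Q0E Q1E) -eu.
  have [hH1 hH2] : x' *m tensact (VH F _) (VH F _) - k%:R *: x' = 0 /\
                   y' *m tensact (VH F _) (VH F _) - k%:R *: y' = 0.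
    apply: sep; rewrite !mulmxBl addrACA -(inter _ _ _ _ _ _ _ _ P0H P1H Q0H Q1H) -eu.
    by rewrite -opprD -!scalemxAl -scalerDr -eu [X in X - _]uH subrr.
  split.
  + split; rewrite -unvec_tensact; first by rewrite hE1 unvec0.
    by move/eqP: hH1; rewrite subr_eq0 => /eqP ->; rewrite unvecZ.
  + split; rewrite -unvec_tensact; first by rewrite hE2 unvec0.
    by move/eqP: hH2; rewrite subr_eq0 => /eqP ->; rewrite unvecZ.
  + by apply/eqX; rewrite -eemb hX.
move=> c d k [[hE1 hH1] [hE2 hH2] hX].
have tE a' b' (z : 'M[F]_(a'.+1, b'.+1)) : (VE F a')^T *m z + z *m VE F b' = 0 ->
    vec z *m tensact (VE F a') (VE F b') = 0.
  by move=> h; apply: (can_inj (@unvecK F _ _)); rewrite unvec_tensact vecK unvec0.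
have tH a' b' (z : 'M[F]_(a'.+1, b'.+1)) : (VH F a')^T *m z + z *m VH F b' = k%:R *: z ->
    vec z *m tensact (VH F a') (VH F b') = k%:R *: vec z.
  by move=> h; apply: (can_inj (@unvecK F _ _)); rewrite unvec_tensact unvecZ vecK.
split; last first.
  rewrite /emb (inter _ _ _ _ _ _ _ _ P0H P1H Q0H Q1H) (tH _ _ _ hH1) (tH _ _ _ hH2).
  by rewrite -!scalemxAl -scalerDr.
rewrite sub_capmx; apply/andP; split.
  by apply: addmx_sub_adds; apply: submx_trans (submxMl _ _) _; apply: tensS; rewrite ?eP0 ?eP1 ?eQ0 ?eQ1.
(* The system controls x_m only; since e kills the vector, [X_descend] yields the other x_s. *)
have hE : emb c d *m rE T = 0 *m emb c d.
  rewrite mul0mx /emb (inter _ _ _ _ _ _ _ _ P0E P1E Q0E Q1E) (tE _ _ _ hE1) (tE _ _ _ hE2).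
  by rewrite !mul0mx addr0.
have hX0 : emb c d *m rX T ord_max = 0 by apply/eqP/eqX.
have h := X_descend (tens_is_rep rep1 rep2) hE hX0.
by apply/(hinvP rep1 rep2).
Qed.

(** Solutions of weight k0 are proportional: subtract the multiple of one that clears row 0 of c,
    then [hw_border] kills c and [sol_c0] kills d. So the highest weight vectors form one line. *)
Lemma soc1_iso mu nu emb k0 : realizes mu nu emb ->
  (forall c d k, @hw_solution F (a 0) (a 1) (b 0) (b 1) del del' mu nu c d k -> c != 0 -> k = k0) ->
  (exists c d, @hw_solution F (a 0) (a 1) (b 0) (b 1) del del' mu nu c d k0 /\ c != 0) ->
  sl2_iso_V T (soc1 r1 r2 e f) k0.
Proof.
move=> [mu0 nu0 hd hd' [inj lin fw bw]] uniq [c0 [d0 [sol0 c00]]].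
have [v1 v2] := bw _ _ _ sol0.
apply: (semisimple_line charF0 (v := emb c0 d0)) => //.
- exact: (soc1_semisimple charF0 rep1 rep2 lay1 L_gt0 lay2).
- by apply: contraNneq c00 => /inj ->.
move=> u k hu uE uH; have [c [d [eu sol]]] := fw u k hu uE uH.
suff [t [ec ed]] : exists t, c = t *: c0 /\ d = t *: d0.
  by rewrite eu ec ed lin scalemx_sub.
have [cz|cn] := eqVneq c 0.
  by exists 0; rewrite !scale0r cz (sol_c0 charF0 mu0 hd sol cz).
have ek := uniq _ _ _ sol cn; subst k.
have [hc _ _] := sol; have [hc0 _ _] := sol0.
have [i [j [_ _ hij]]] := ent_neq0 c00; have es := hw_supp charF0 hc0 hij.
have [_ _ n0] := hw_nonzero charF0 hc0 c00 es.
(* In row 0 only column i + j can be nonzero, by weight. *)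
pose t := ent c 0 (i + j) / ent c0 0 (i + j); exists t.
have sol' := hw_solution_sub t sol sol0.
have ec : c - t *: c0 = 0.
  have [hcc _ _] := sol'; apply: (hw_border charF0 hcc) => q.
  rewrite -scaleN1r !entD !entZ; have [->|qn] := eqVneq q (i + j)%N.
    by rewrite /t mulfVK ?n0 // mulN1r subrr.
  have z (x : 'M[F]_((a 0%N).+1, (b 1%N).+1)) : tens_hw x k0%:R -> ent x 0 q = 0.
    move=> hx; apply/eqP; apply: contraT => /(hw_supp charF0 hx) h.
    by case/eqP: qn; move: h es; clear; lia.
  by rewrite !z // !mulr0 addr0.
have ed := sol_c0 charF0 mu0 hd sol' ec.
by split; apply/eqP; rewrite -subr_eq0 ?ec ?ed.
Qed.

Lemma soc1_eq0 mu nu emb : realizes mu nu emb ->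
  (forall c d k, @hw_solution F (a 0) (a 1) (b 0) (b 1) del del' mu nu c d k -> c = 0) ->
  soc1 r1 r2 e f = 0.
Proof.
move=> [mu0 nu0 hd hd' [inj lin fw bw]] uniq.
apply: (semisimple_eq0 (r := T)); first exact: (soc1_semisimple charF0 rep1 rep2 lay1 L_gt0 lay2).
move=> u k hu uE uH; have [c [d [eu sol]]] := fw u k hu uE uH.
have cz := uniq _ _ _ sol; have dz := sol_c0 charF0 mu0 hd sol cz.
by have := lin 0 c d; rewrite !scale0r eu cz dz.
Qed.

End SecondLayer.

(** * Matching the given decompositions, and the individual cases *)

Section Assembly.
Variable F : fieldType.
Hypothesis charF0 : [pchar F] =i pred0.

Lemma layered_eq n d (r : grep F n d) L e a b : (forall i, (i <= L)%N -> b i = a i) ->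
  layered r L e a -> layered r L e b.
Proof.
move=> h [h1 h2 h3 h4 h5 h6 h7 h8]; split=> // i hi; rewrite h //; exact: h5.
Qed.

Section TypeZ.
Variables (n d : nat) (r : grep F n d) (L : nat) (Vs : nat -> 'M[F]_d) (b : nat -> nat).
Hypothesis n_gt0 : (0 < n)%N.
Hypothesis dec : socle_decomp r L Vs b.

Let m_gt0 : (0 < mdeg n)%N.
Proof. by rewrite /mdeg; case: (n) n_gt0 => // k _; rewrite doubleS. Qed.

Lemma isZ_socle al : isZ r al L -> exists f,
  [/\ layered r L f b, forall i, (i <= L)%N -> (Vs i :=: f i)%MS &
      forall i, (i <= L)%N -> b i = (al + i * mdeg n)%N].
Proof.
move=> hZ; have [f lay] := isZ_layered hZ.
have soc := lay_socle charF0 lay (isZ_Z0 hZ) dec.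
have {}soc i : (i <= L)%N -> b i = (al + i * mdeg n)%N /\ (Vs i :=: f i)%MS.
  by apply: soc => p q _ _ /addnI/eqP; rewrite eqn_pmul2r // => /eqP.
exists f; split; try by move=> i /soc[].
by apply: layered_eq lay => i /soc[].
Qed.

Lemma isZdual_socle al : isZdual r al L -> exists f,
  [/\ layered r L f b, forall i, (i <= L)%N -> (Vs i :=: f i)%MS &
      forall i, (i <= L)%N -> b i = (al + (L - i) * mdeg n)%N].
Proof.
move=> hZ; have [f lay] := isZdual_layered charF0 hZ.
have soc := lay_socle charF0 lay (isZdual_Z0 hZ) dec.
have {}soc i : (i <= L)%N -> b i = (al + (L - i) * mdeg n)%N /\ (Vs i :=: f i)%MS.
  by apply: soc => p q hp hq /addnI/eqP; rewrite eqn_pmul2r // => /eqP; lia.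
exists f; split; try by move=> i /soc[].
by apply: layered_eq lay => i /soc[].
Qed.

Lemma isZ_step al : (0 < L)%N -> isZ r al L -> b 1%N = (b 0%N + mdeg n)%N.
Proof.
by move=> L0 /isZ_socle[f [_ _ hb]]; rewrite !hb // mul0n mul1n addn0.
Qed.

Lemma isZdual_step al : (0 < L)%N -> isZdual r al L -> b 0%N = (b 1%N + mdeg n)%N.
Proof.
move=> L0 /isZdual_socle[f [_ _ hb]]; rewrite !hb // subn0 -addnA -mulSnr.
by rewrite (_ : (L - 1).+1 = L) //; lia.
Qed.

End TypeZ.

Section Terms.
Variables (n d1 d2 : nat) (r1 : grep F n d1) (r2 : grep F n d2).
Variables (l1 l2 : nat) (V1s : nat -> 'M[F]_d1) (V2s : nat -> 'M[F]_d2).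
Variables (e : nat -> 'M[F]_d1) (f : nat -> 'M[F]_d2).
Hypothesis V1e : forall i, (i <= l1)%N -> (V1s i :=: e i)%MS.
Hypothesis V2f : forall i, (i <= l2)%N -> (V2s i :=: f i)%MS.

Lemma Sterm0 : (e 0%N *t f 0%N <= hinv (tens_rep r1 r2))%MS ->
  (Sterm r1 r2 l1 V1s l2 V2s 0 :=: e 0%N *t f 0%N)%MS.
Proof.
move=> hb; have e0 := eqmx_tens (V1e (leq0n _)) (V2f (leq0n _)).
apply/eqmxP/andP; split.
  apply: submx_trans (capmxSl _ _) _; apply/sumsmx_subP => -[[|i] hi] _; apply/sumsmx_subP => -[[|j] hj] //=.
  by rewrite e0.
rewrite sub_capmx hb andbT -e0.
by apply: (sumsmx_sup ord0) => //; apply: (sumsmx_sup ord0).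
Qed.

Lemma Sterm1 : (0 < l1)%N -> (0 < l2)%N ->
  (Sterm r1 r2 l1 V1s l2 V2s 1 :=: soc1 r1 r2 e f)%MS.
Proof.
move=> l1_gt0 l2_gt0; have e01 := eqmx_tens (V1e (leq0n _)) (V2f l2_gt0).
have e10 := eqmx_tens (V1e l1_gt0) (V2f (leq0n _)).
apply: cap_eqmx => //; apply/eqmxP/andP; split.
  apply/sumsmx_subP => -[[|[|i]] hi] _; apply/sumsmx_subP => -[[|[|j]] hj] //= _.
    by rewrite e01 addsmxSl.
  by rewrite e10 addsmxSr.
rewrite addsmx_sub -e01 -e10; apply/andP; split.
  apply: (sumsmx_sup ord0) => //.
  by apply: (sumsmx_sup (Ordinal (l2_gt0 : (1 < l2.+1)%N))).
apply: (sumsmx_sup (Ordinal (l1_gt0 : (1 < l1.+1)%N))) => //.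
by apply: (sumsmx_sup ord0).
Qed.

End Terms.

Section SecondTerm.
Variables (n d1 d2 : nat) (r1 : grep F n d1) (r2 : grep F n d2).
Hypothesis n_gt0 : (0 < n)%N.
Hypothesis rep1 : is_rep r1.
Hypothesis rep2 : is_rep r2.
Variables (e : nat -> 'M[F]_d1) (a : nat -> nat).
Hypothesis lay1 : layered r1 2 e a.
Variables (L : nat) (f : nat -> 'M[F]_d2) (b : nat -> nat).
Hypothesis L_gt0 : (0 < L)%N.
Hypothesis lay2 : layered r2 L f b.
Local Notation m := (mdeg n).
Local Notation T := (tens_rep r1 r2).
Local Notation S1 := (soc1 r1 r2 e f).

Let coords := soc1_coordinates charF0 rep1 rep2 lay1 L_gt0 lay2.

Let m_gt0 : (0 < m)%N.
Proof. by rewrite /mdeg; case: (n) n_gt0 => // k _; rewrite doubleS. Qed.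

Lemma soc1_up_up : a 1%N = (a 0 + m)%N -> b 1%N = (b 0 + m)%N ->
  sl2_iso_V T S1 (a 0 + b 0 + m).
Proof.
move=> ea eb.
have ha : (a 0 + m = a 1 + 2 * 0)%N by lia.
have hb : (b 0 + m = b 1 + 2 * 0)%N by lia.
have [mu [nu [emb R]]] := coords ha hb; have [mu0 nu0 _ _ _] := R.
apply: (soc1_iso charF0 rep1 rep2 lay1 L_gt0 lay2 R).
  by move=> c d k; apply: sol_up_up.
exact: sol_up_up_ex.
Qed.

Lemma soc1_up_down : a 1%N = (a 0 + m)%N -> b 0%N = (b 1 + m)%N ->
  ((a 0 <= b 1)%N -> sl2_iso_V T S1 (b 1 - a 0)) /\ ((b 1 < a 0)%N -> S1 = 0).
Proof.
move=> ea eb.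
have ha : (a 0 + m = a 1 + 2 * 0)%N by lia.
have hb : (b 0 + m = b 1 + 2 * m)%N by lia.
have [mu [nu [emb R]]] := coords ha hb; have [mu0 nu0 _ _ _] := R.
split=> hab.
  apply: (soc1_iso charF0 rep1 rep2 lay1 L_gt0 lay2 R).
    by move=> c d k hs c0; case: (sol_up_down charF0 mu0 nu0 m_gt0 ea eb hs c0).
  have [c [d [h1 h2 _]]] := sol_up_down_ex charF0 mu0 nu0 m_gt0 ea eb hab.
  by exists c, d.
apply: (soc1_eq0 charF0 rep1 rep2 lay1 L_gt0 lay2 R) => c d k hs.
apply/eqP; apply: contraT => c0.
have [h _] := sol_up_down charF0 mu0 nu0 m_gt0 ea eb hs c0.
by rewrite leqNgt hab in h.
Qed.

(** The up-down case with the factors exchanged; the answer a_1 - b_0 equals a_0 - b_1 because both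
    differences change by m. *)
Lemma soc1_down_up : a 0%N = (a 1 + m)%N -> b 1%N = (b 0 + m)%N ->
  ((b 1 <= a 0)%N -> sl2_iso_V T S1 (a 0 - b 1)) /\ ((a 0 < b 1)%N -> S1 = 0).
Proof.
move=> ea eb.
have ha : (a 0 + m = a 1 + 2 * m)%N by lia.
have hb : (b 0 + m = b 1 + 2 * 0)%N by lia.
have [mu [nu [emb R]]] := coords ha hb; have [mu0 nu0 _ _ _] := R.
have key c d k : @hw_solution F (a 0) (a 1) (b 0) (b 1) m 0 mu nu c d k -> c != 0 ->
    (b 0 <= a 1)%N /\ k = (a 1 - b 0)%N.
  move=> hs c0; have d0 := sol_d_neq0 charF0 nu0 (leq0n _) hs c0.
  by apply: (sol_up_down charF0 nu0 mu0 m_gt0 eb ea (sol_swap hs)); rewrite trmx_eq0.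
split=> hab.
  apply: (soc1_iso charF0 rep1 rep2 lay1 L_gt0 lay2 R).
    by move=> c d k hs c0; have [_ ->] := key c d k hs c0; lia.
  have hab' : (b 0 <= a 1)%N by lia.
  have [c [d [h1 _ h2]]] := sol_up_down_ex charF0 nu0 mu0 m_gt0 eb ea hab'.
  exists d^T, c^T; rewrite trmx_eq0; split=> //.
  by rewrite (_ : a 0 - b 1 = a 1 - b 0)%N; [apply: sol_swap|lia].
apply: (soc1_eq0 charF0 rep1 rep2 lay1 L_gt0 lay2 R) => c d k hs.
apply/eqP; apply: contraT => c0; have [h _] := key c d k hs c0; lia.
Qed.

(** Stated for any positive shift so as to cover FU^- for n = 1 and FU_(1,m-1,1) for n > 1 together;
    both have shift 1. *)
Lemma soc1_down del : (0 < del)%N -> (a 0 + m = a 1 + 2 * del)%N -> b 0%N = (b 1 + m)%N ->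
  S1 = 0.
Proof.
move=> hdel ha eb; have hb : (b 0 + m = b 1 + 2 * m)%N by lia.
have [mu [nu [emb R]]] := coords ha hb; have [mu0 nu0 _ _ _] := R.
by apply: (soc1_eq0 charF0 rep1 rep2 lay1 L_gt0 lay2 R) => c d k hs; apply: sol_down hs.
Qed.

Lemma soc1_one : a 0%N = 1%N -> m = (a 1).+1 -> b 1%N = (b 0 + m)%N ->
  (b 0%N = 0%N -> sl2_iso_V T S1 (a 1)) /\ ((0 < b 0)%N -> S1 = 0).
Proof.
move=> ea em eb.
have ha : (a 0 + m = a 1 + 2 * 1)%N by lia.
have hb : (b 0 + m = b 1 + 2 * 0)%N by lia.
have [mu [nu [emb R]]] := coords ha hb; have [mu0 nu0 _ _ _] := R.
have key c d k : @hw_solution F (a 0) (a 1) (b 0) (b 1) 1 0 mu nu c d k -> c != 0 ->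
    b 0%N = 0%N /\ k = a 1%N.
  by move: c; rewrite ea => c; apply: sol_one => //; rewrite -em.
split=> hb0.
  apply: (soc1_iso charF0 rep1 rep2 lay1 L_gt0 lay2 R).
    by move=> c d k hs c0; have [_ ->] := key c d k hs c0.
  rewrite ea hb0; apply: sol_one_ex => //; lia.
apply: (soc1_eq0 charF0 rep1 rep2 lay1 L_gt0 lay2 R) => c d k hs.
by apply/eqP; apply: contraT => c0; have [h _] := key c d k hs c0; rewrite h in hb0.
Qed.

End SecondTerm.
End Assembly.

Theorem theorem4p6
  (F : fieldType) (charF0 : [pchar F] =i pred0)
  (n : nat) (n_gt0 : (0 < n)%N)
  (d1 d2 : nat) (r1 : grep F n d1) (r2 : grep F n d2)
  (V1s : nat -> 'M[F]_d1) (a : nat -> nat)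
  (l : nat) (V2s : nat -> 'M[F]_d2) (b : nat -> nat)
  (rep1 : is_rep r1) (rep2 : is_rep r2)
  (uni1 : uniserial r1) (uni2 : uniserial r2)
  (dec1 : socle_decomp r1 2 V1s a) (dec2 : socle_decomp r2 l V2s b)
  (l_ge1 : (1 <= l)%N)
  (faith1 : faithful r1) (std1 : ~ (n = 2%N /\ a 0%N = 4%N /\ a 1%N = 3%N))
  (typeZ2 : isZ r2 (b 0%N) l \/ isZdual r2 (b l) l) :
  let m := mdeg n in
  let T := tens_rep r1 r2 in
  let S0 := Sterm r1 r2 2 V1s l V2s 0 in
  let S1 := Sterm r1 r2 2 V1s l V2s 1 in
  let a0 := a 0%N in let a1 := a 1%N in
  let b0 := b 0%N in let b1 := b 1%N in
  [/\ is_soc T (S0 + S1)%MS /\ mxdirect2 S0 S1,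
      (S0 == tensmx (V1s 0%N) (V2s 0%N))%MS,
      sl2_iso_sum T S0 [seq (a0 + b0 - 2 * k)%N | k <- iota 0 (minn a0 b0).+1],
      (* case n = 1 (m = 1) *)
      [/\ n = 1%N -> a1 = a0.+1 -> isZ r2 b0 l ->
            sl2_iso_V T S1 (a0 + b0 + m),
          n = 1%N -> a1 = a0.+1 -> isZdual r2 (b l) l ->
            ((a0 <= b1)%N -> sl2_iso_V T S1 (b1 - a0)) /\
            ((b1 < a0)%N -> (S1 == (0 : 'M[F]_(d1 * d2)))%MS),
          n = 1%N -> a0 = a1.+1 -> isZ r2 b0 l ->
            ((b1 <= a0)%N -> sl2_iso_V T S1 (a0 - b1)) /\
            ((a0 < b1)%N -> (S1 == (0 : 'M[F]_(d1 * d2)))%MS) &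
          n = 1%N -> a0 = a1.+1 -> isZdual r2 (b l) l -> (S1 == (0 : 'M[F]_(d1 * d2)))%MS] &
      (* case n > 1 (m >= 3) *)
      [/\ (1 < n)%N -> a1 = (a0 + m)%N -> (a0 <= 1)%N -> isZ r2 b0 l ->
            sl2_iso_V T S1 (a0 + b0 + m),
          (1 < n)%N -> a1 = (a0 + m)%N -> (a0 <= 1)%N -> isZdual r2 (b l) l ->
            ((a0 <= b1)%N -> sl2_iso_V T S1 (b1 - a0)) /\
            ((b1 < a0)%N -> (S1 == (0 : 'M[F]_(d1 * d2)))%MS),
          (1 < n)%N -> a0 = 1%N -> a1 = (m - 1)%N -> isZ r2 b0 l ->
            (b0 = 0%N -> sl2_iso_V T S1 (m - 1)) /\
            ((0 < b0)%N -> (S1 == (0 : 'M[F]_(d1 * d2)))%MS) &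
          (1 < n)%N -> a0 = 1%N -> a1 = (m - 1)%N -> isZdual r2 (b l) l ->
            (S1 == (0 : 'M[F]_(d1 * d2)))%MS]].

Proof.
move=> m T S0 S1 a0 a1 b0 b1.
have [e [lay1 V1e eZ0 eZ1 eZ2]] := faithful_layered charF0 n_gt0 rep1 faith1 dec1.
have [f [Z2 [lay2 V2f]]] : exists f, rZ r2 = 0 /\ layered r2 l f b /\
    forall i, (i <= l)%N -> (V2s i :=: f i)%MS.
  case: typeZ2 => hZ.
    have [f [h1 h2 _]] := isZ_socle charF0 n_gt0 dec2 hZ.
    by exists f; split=> //; apply: isZ_Z0 hZ.
  have [f [h1 h2 _]] := isZdual_socle charF0 n_gt0 dec2 hZ.
  by exists f; split=> //; apply: isZdual_Z0 hZ.
have eS0 : (S0 :=: tensmx (e 0%N) (f 0%N))%MS.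
  by apply: Sterm0 => //; apply: bottom_hinv lay1 _ _ _ lay2.
have eS1 : (S1 :=: soc1 r1 r2 e f)%MS by apply: Sterm1.
have iso k : sl2_iso_V T (soc1 r1 r2 e f) k -> sl2_iso_V T S1 k.
  by apply: iso_eqmx; apply: eqmx_sym.
have zero : soc1 r1 r2 e f = 0 -> (S1 == (0 : 'M[F]_(d1 * d2)))%MS.
  by move=> h; apply/eqmxP; rewrite -h.
have upZ : isZ r2 b0 l -> b1 = (b0 + m)%N.
  exact: (isZ_step charF0 n_gt0 dec2 l_ge1).
have downZ : isZdual r2 (b l) l -> b0 = (b1 + m)%N.
  exact: (isZdual_step charF0 n_gt0 dec2 l_ge1).
have m1 : n = 1%N -> m = 1%N by rewrite /m => ->.
have m3 : (1 < n)%N -> (3 <= m)%N by rewrite /m /mdeg -mul2n; lia.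
split.
- split.
    apply: (hinv_is_soc charF0 rep1 rep2 lay1 eZ0 eZ1 eZ2 l_ge1 lay2 Z2).
    apply: eqmx_trans (adds_eqmx eS0 eS1) _; apply: eqmx_sym.
    exact: (hinv_decomp charF0 rep1 rep2 lay1 eZ0 eZ1 eZ2 l_ge1 lay2 Z2).
  apply/mxdirect_addsP; apply/eqP; rewrite -submx0.
  rewrite -(bottom_soc1_direct (r1 := r1) (r2 := r2) lay1 lay2).
  by apply: capmxS; rewrite ?eS0 ?eS1.
- apply/eqmxP; apply: eqmx_trans eS0 _; apply: eqmx_sym; apply: eqmx_tens.
    exact: V1e.
  exact: V2f.
- exact: (bottom_iso_sum charF0 lay1 lay2 eS0).
- split=> hn ea hZ.
  + have ea' : a 1%N = (a 0 + mdeg n)%N by rewrite [LHS]ea -/m m1 // addn1.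
    apply: iso; exact: (soc1_up_up charF0 n_gt0 rep1 rep2 lay1 l_ge1 lay2 ea' (upZ hZ)).
  + have ea' : a 1%N = (a 0 + mdeg n)%N by rewrite [LHS]ea -/m m1 // addn1.
    have [h1 h2] := soc1_up_down charF0 n_gt0 rep1 rep2 lay1 l_ge1 lay2 ea' (downZ hZ).
    by split=> h; [apply: iso; apply: h1|apply: zero; apply: h2].
  + have ea' : a 0%N = (a 1 + mdeg n)%N by rewrite [LHS]ea -/m m1 // addn1.
    have [h1 h2] := soc1_down_up charF0 n_gt0 rep1 rep2 lay1 l_ge1 lay2 ea' (upZ hZ).
    by split=> h; [apply: iso; apply: h1|apply: zero; apply: h2].
  + have ha : (a 0 + mdeg n = a 1 + 2 * 1)%N.
      by move: (m1 hn) ea; rewrite /m /a0 /a1 => -> ->; lia.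
    apply: zero; exact: (soc1_down charF0 n_gt0 rep1 rep2 lay1 l_ge1 lay2 (ltn0Sn 0) ha (downZ hZ)).
- split=> hn ea.
  + move=> _ hZ; apply: iso.
    exact: (soc1_up_up charF0 n_gt0 rep1 rep2 lay1 l_ge1 lay2 ea (upZ hZ)).
  + move=> _ hZ.
    have [h1 h2] := soc1_up_down charF0 n_gt0 rep1 rep2 lay1 l_ge1 lay2 ea (downZ hZ).
    by split=> h; [apply: iso; apply: h1|apply: zero; apply: h2].
  + rewrite /a1 => ea1 hZ; have hm := m3 hn.
    have em : mdeg n = (a 1).+1 by move: ea1 hm; rewrite /m => ->; lia.
    have [h1 h2] := soc1_one charF0 n_gt0 rep1 rep2 lay1 l_ge1 lay2 ea em (upZ hZ).
    split=> h; last by apply: zero; apply: h2.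
    by apply: iso; rewrite -ea1; apply: h1.
  + rewrite /a1 => ea1 hZ; have hm := m3 hn; apply: zero.
    have ha : (a 0 + mdeg n = a 1 + 2 * 1)%N.
      by move: ea ea1 hm; rewrite /a0 /m => -> ->; lia.
    exact: (soc1_down charF0 n_gt0 rep1 rep2 lay1 l_ge1 lay2 (ltn0Sn 0) ha (downZ hZ)).
Qed.
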